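(* Generic symplectic leaves $\mathcal{L}(\Sigma_{3,0})$ and $\mathcal{L}(\Sigma_{1,1})$ of $\mathfrak{X}$ are (generically) transverse, and so are symplectically dual to each other. Explicitly: there is a dense open subset $\mathcal{U}$ of the smooth locus $\mathcal{X}$ of $\mathfrak{X}$ such that for every $u\in\mathcal{U}$, writing $$\mathcal{L}_3=\mathfrak{b}_{3,0}^{-1}(\mathfrak{b}_{3,0}(u))\cap\mathcal{X},\qquad \mathcal{L}_1=\mathfrak{b}_{1,1}^{-1}(\mathfrak{b}_{1,1}(u))\cap\mathcal{X}$$ for the leaves of $\mathfrak{X}(\Sigma_{3,0})$ and $\mathfrak{X}(\Sigma_{1,1})$ through $u$, one has $$T_u\mathcal{X}=T_u\mathcal{L}_1\oplus T_u\mathcal{L}_3 .$$ Consequently, $T_u\mathcal{L}_1$ and $T_u\mathcal{L}_3$ are symplectic duals (symplectic orthogonal complements) of each other in $T_u\mathcal{X}$ with respect to the product form defined by the symplectic forms of the two leaves.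
   Context: **Character variety.** Let $G=\mathrm{SL}(3,\mathbb{C})$ and let $F_2=\langle x_1,x_2\rangle$ be the free group of rank 2. Let $\mathfrak{X}=\mathrm{Hom}(F_2,G)/\!\!/G=\mathrm{Spec}\big(\mathbb{C}[\mathrm{Hom}(F_2,G)]^{G}\big)$ be the categorical quotient of $\mathrm{Hom}(F_2,G)\cong G\times G$ by conjugation. It is an irreducible affine variety of dimension 8. $\mathcal{X}\subset\mathfrak{X}$ denotes the complement of the singular locus, a complex manifold dense in $\mathfrak{X}$. **Surfaces and boundary maps.** $\Sigma_{3,0}$ is the (oriented) three-holed sphere and $\Sigma_{1,1}$ the (oriented) one-holed torus. Both fundamental groups are identified with $F_2$: $\pi_1(\Sigma_{3,0})=\langle b_1,b_2,b_3\mid b_1b_2b_3=1\rangle$ with $x_1=b_1$, $x_2=b_2$, and $\pi_1(\Sigma_{1,1})=\langle x_1,x_2,b\mid [x_1,x_2]\,b=1\rangle$, where $b_1,b_2,b_3$ and $b$ are the boundary curves. Thus both surfaces give the same variety $\mathfrak{X}$, written $\mathfrak{X}(\Sigma)$ when the surface is to be remembered. The quotient $G/\!\!/G$ is identified with $\mathbb{C}^2$ via $[X]\mapsto(\mathrm{tr}\,X,\mathrm{tr}\,X^{-1})$. The boundary maps send $[\rho]$ to the classes of $\rho$ on the boundary curves: $$\mathfrak{b}_{3,0}:\mathfrak{X}\to(\mathbb{C}^2)^3,\quad [\rho]\mapsto\big(\mathrm{tr}\,\rho(b_i),\mathrm{tr}\,\rho(b_i)^{-1}\big)_{i=1,2,3},\qquad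 \mathfrak{b}_{1,1}:\mathfrak{X}\to\mathbb{C}^2,\quad [\rho]\mapsto\big(\mathrm{tr}\,\rho(b),\mathrm{tr}\,\rho(b)^{-1}\big).$$ **Symplectic leaves.** For $\Sigma=\Sigma_{3,0}$ or $\Sigma_{1,1}$ with boundary map $\mathfrak{b}$, the leaf $\mathcal{L}(\Sigma)$ over a point $c$ is $\mathfrak{b}^{-1}(c)\cap\mathcal{X}$. At regular values of $\mathfrak{b}$ (which are generic) it is a complex submanifold of $\mathcal{X}$, of dimension 2 for $\Sigma_{3,0}$ and 6 for $\Sigma_{1,1}$, and it carries a complex symplectic form $\omega$. This form is characterized by $\{f,g\}=\omega(H_g,H_f)$, $H_f=\{f,\cdot\}$, where $\{\,,\}$ is the Poisson bracket on $\mathbb{C}[\mathfrak{X}(\Sigma)]$ given on trace functions by $$\{\mathrm{tr}(\rho(\alpha)),\mathrm{tr}(\rho(\beta))\}=\sum_{p\in\alpha\cap\beta}\epsilon(p,\alpha,\beta)\Big(\mathrm{tr}(\rho(\alpha_p\beta_p))-\tfrac13\mathrm{tr}(\rho(\alpha))\,\mathrm{tr}(\rho(\beta))\Big).$$ Here $\alpha,\beta\in\pi_1(\Sigma)$ are represented by loops meeting in transverse double points, $\epsilon(p,\alpha,\beta)=\pm1$ is the oriented intersection number at $p$, and $\alpha_p,\beta_p\in\pi_1(\Sigma,p)$ are the loops based at $p$. A generic leaf is one over a regular value. **Symplectic duality.** When $T_u\mathcal{X}=T_u\mathcal{L}_1\oplus T_u\mathcal{L}_3$, the space $T_u\mathcal{X}$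 is given the product symplectic form $\omega_1\oplus\omega_3$, where $\omega_i$ is the symplectic form of $\mathcal{L}_i$ at $u$. The two symplectic submanifolds are called symplectically dual if their tangent spaces are symplectic duals of each other with respect to this form. *)

(* Defs.v *)
(* The complex numbers are R[i] for a realType R. *)
From HB Require Import structures.
From mathcomp Require Import all_boot all_order all_algebra.
From mathcomp Require Import complex.
From mathcomp Require Import all_classical all_reals all_analysis.

Set Implicit Arguments.
Unset Strict Implicit.
Unset Printing Implicit Defensive.

Import Order.TTheory GRing.Theory Num.Theory.
Import numFieldNormedType.Exports.

Local Open Scope classical_set_scope.
Local Open Scope ring_scope.

(* Words in the generators of F_2 stand for its elements: (i, false) is x_(i+1)
   and (i, true) its inverse. *)
Definition letter : Type := ('I_2 * bool)%type.
Definition x1 : letter := (ord0, false).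
Definition x2 : letter := (ord_max, false).
Definition inv_letter (l : letter) : letter := (l.1, ~~ l.2).
Definition inv_word (w : seq letter) : seq letter := rev (map inv_letter w).

Section Representations.
Variable R : realType.
Local Notation C := R[i].

(* Hom(F_2, SL(3, C)), a representation being given by the images of x1 and x2. *)
Definition rep2 : Type :=
  {g : 'M[C]_3 * 'M[C]_3 | (\det g.1 == 1) && (\det g.2 == 1)}.

HB.instance Definition _ := Choice.on rep2.

Lemma rep2_point_subproof :
  (\det (1%:M : 'M[C]_3, 1%:M : 'M[C]_3).1 == 1) &&
  (\det (1%:M : 'M[C]_3, 1%:M : 'M[C]_3).2 == 1).
Proof. by rewrite /= !det1 eqxx. Qed.

HB.instance Definition _ :=
  isPointed.Build rep2 (exist _ (1%:M, 1%:M) rep2_point_subproof).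

Definition rep_letter (g : rep2) (l : letter) : 'M[C]_3 :=
  let M := if l.1 == ord0 then (val g).1 else (val g).2 in
  if l.2 then invmx M else M.

Definition rep_word (g : rep2) (w : seq letter) : 'M[C]_3 :=
  \prod_(l <- w) rep_letter g l.

Definition conjugate (g g' : rep2) : Prop :=
  exists h : 'M[C]_3, [/\ \det h = 1,
    (val g').1 = h *m (val g).1 *m invmx h &
    (val g').2 = h *m (val g).2 *m invmx h].

Inductive regular_function : (rep2 -> C) -> Prop :=
| RegCst c : regular_function (fun=> c)
| RegEntry1 i j : regular_function (fun g => (val g).1 i j)
| RegEntry2 i j : regular_function (fun g => (val g).2 i j)
| RegAdd f1 f2 : regular_function f1 -> regular_function f2 ->
    regular_function (fun g => f1 g + f2 g)
| RegMul f1 f2 : regular_function f1 -> regular_function f2 ->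
    regular_function (fun g => f1 g * f2 g).

Definition invariant (f : rep2 -> C) : Prop :=
  forall g g', conjugate g g' -> f g = f g'.

Definition regular_invariant : {pred (rep2 -> C)} :=
  fun f => `[< regular_function f /\ invariant f >].

Lemma regular_invariant_subring : subring_closed regular_invariant.
Proof.
split.
- by apply/asboolP; split=> //; exact: RegCst.
- move=> f1 f2 /asboolP[r1 i1] /asboolP[r2 i2]; apply/asboolP; split.
    have -> : f1 - f2 = (fun g => f1 g + (-1) * f2 g).
      by apply/funext => g; rewrite mulN1r.
    by apply: RegAdd => //; apply: RegMul => //; exact: RegCst.
  by move=> g g' gg'; rewrite !fctE (i1 _ _ gg') (i2 _ _ gg').
- move=> f1 f2 /asboolP[r1 i1] /asboolP[r2 i2]; apply/asboolP; split.
    exact: RegMul.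
  by move=> g g' gg'; rewrite !fctE (i1 _ _ gg') (i2 _ _ gg').
Qed.

HB.instance Definition _ :=
  GRing.isSubringClosed.Build (rep2 -> C) regular_invariant
    regular_invariant_subring.

Lemma regular_invariant_scale : GRing.scaler_closed regular_invariant.
Proof.
move=> c f /asboolP[rf jf]; apply/asboolP; split.
  by apply: (RegMul (RegCst c)).
by move=> g g' gg'; rewrite !fctE (jf _ _ gg').
Qed.

HB.instance Definition _ :=
  GRing.isScaleClosed.Build C (rep2 -> C) regular_invariant
    regular_invariant_scale.

(* The coordinate ring C[Hom(F_2, SL(3, C))]^SL(3, C). *)
Definition char_ring : Type := {f : rep2 -> C | f \in regular_invariant}.

HB.instance Definition _ := SubChoice.on char_ring.
HB.instance Definition _ := [SubChoice_isSubComNzRing of char_ring by <:].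
HB.instance Definition _ := [SubZmodule_isSubLmodule of char_ring by <:].

Lemma char_ring_scalerAl (c : C) (f1 f2 : char_ring) :
  c *: (f1 * f2) = (c *: f1) * f2.
Proof.
by apply: val_inj; apply/funext => g; exact: mulrA.
Qed.

HB.instance Definition _ :=
  GRing.Lmodule_isLalgebra.Build C char_ring char_ring_scalerAl.

Lemma det_rep_letter g l : \det (rep_letter g l) = 1.
Proof.
have /andP[/eqP d1 /eqP d2] := valP g.
by rewrite /rep_letter; case: l.2; case: ifP => _; rewrite ?det_inv ?d1 ?d2 ?invr1.
Qed.

Lemma regular_sum n (F : 'I_n -> rep2 -> C) :
  (forall k, regular_function (F k)) -> regular_function (fun g => \sum_k F k g).
Proof.
elim: n F => [|n IH] F rF.
  rewrite (_ : (fun g => _) = fun=> 0); first exact: RegCst.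
  by apply/funext => g; rewrite big_ord0.
rewrite (_ : (fun g => _) =
    fun g => F ord0 g + \sum_k F (lift ord0 k) g); last first.
  by apply/funext => g; rewrite big_ord_recl.
by apply: RegAdd => //; exact: IH.
Qed.

Lemma regular_det n (M : rep2 -> 'M[C]_n) :
  (forall i j, regular_function (fun g => M g i j)) ->
  regular_function (fun g => \det (M g)).
Proof.
elim: n M => [|n IH] M rM.
  rewrite (_ : (fun g => _) = fun=> 1); first exact: RegCst.
  by apply/funext => g; rewrite det_mx00.
rewrite (_ : (fun g => _) =
    fun g => \sum_j M g ord0 j * cofactor (M g) ord0 j); last first.
  by apply/funext => g; exact: expand_det_row.
apply: regular_sum => j; apply: RegMul => //.
apply: RegMul; first exact: RegCst.
apply: IH => a b.
rewrite (_ : (fun g => _) = fun g => M g (lift ord0 a) (lift j b)) //.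
by apply/funext => g; rewrite !mxE.
Qed.

Lemma regular_rep_letter l i j : regular_function (fun g => rep_letter g l i j).
Proof.
have rM a b :
    regular_function
      (fun g => (if l.1 == ord0 then (val g).1 else (val g).2) a b).
  by case: (l.1 == ord0); [exact: RegEntry1|exact: RegEntry2].
rewrite /rep_letter; case: l.2 => //.
rewrite (_ : (fun g => _) = fun g =>
  cofactor (if l.1 == ord0 then (val g).1 else (val g).2) j i); last first.
  apply/funext => g; set M := (if _ then _ else _).
  have dM : \det M = 1.
    have /andP[/eqP d1 /eqP d2] := valP g.
    by rewrite /M; case: ifP.
  by rewrite /invmx unitmxE dM unitr1 invr1 scale1r mxE.
apply: RegMul; first exact: RegCst.
apply: regular_det => a b.
apply: (eq_ind _ regular_function (rM (lift j a) (lift i b))).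
by apply/funext => g; rewrite !mxE.
Qed.

Lemma regular_rep_word w i j : regular_function (fun g => rep_word g w i j).
Proof.
elim: w i j => [|l w IH] i j.
  rewrite (_ : (fun g => _) = fun=> (1%:M : 'M[C]_3) i j); first exact: RegCst.
  by apply/funext => g; rewrite /rep_word big_nil.
rewrite (_ : (fun g => _) =
    fun g => \sum_k rep_letter g l i k * rep_word g w k j); last first.
  by apply/funext => g; rewrite /rep_word big_cons mxE.
by apply: regular_sum => k; apply: RegMul => //; exact: regular_rep_letter.
Qed.

Lemma rep_word_conjugate g g' (h : 'M[C]_3) w : \det h = 1 ->
  (val g').1 = h *m (val g).1 *m invmx h ->
  (val g').2 = h *m (val g).2 *m invmx h ->
  rep_word g' w = h *m rep_word g w *m invmx h.
Proof.
move=> dh e1 e2; have hU : h \in unitmx by rewrite unitmxE dh unitr1.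
elim: w => [|l w IH].
  by rewrite /rep_word !big_nil -[1]/(1%:M) mulmx1 mulmxV.
rewrite /rep_word !big_cons -!/(rep_word _ _) IH -!mulmxE.
suff -> : rep_letter g' l = h *m rep_letter g l *m invmx h.
  by rewrite !mulmxA mulmxKV.
have inv_conj (M : 'M[C]_3) : \det M = 1 ->
    invmx (h *m M *m invmx h) = h *m invmx M *m invmx h.
  move=> dM; have MU : M \in unitmx by rewrite unitmxE dM unitr1.
  have /mulmx1C H : h *m M *m invmx h *m (h *m invmx M *m invmx h) = 1%:M.
    by rewrite !mulmxA mulmxKV // mulmxK // mulmxV.
  have NU : h *m M *m invmx h \in unitmx by case/mulmx1_unit: H.
  by rewrite -[RHS]mulmx1 -(mulmxV NU) mulmxA H mul1mx.
have /andP[/eqP d1 /eqP d2] := valP g.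
by rewrite /rep_letter; case: l.2; case: ifP => _; rewrite ?e1 ?e2 ?inv_conj.
Qed.

Lemma trace_word_subproof (w : seq letter) :
  (fun g => \tr (rep_word g w)) \in regular_invariant.
Proof.
apply/asboolP; split.
  by apply: regular_sum => k; exact: regular_rep_word.
move=> g g' [h [dh e1 e2]].
rewrite (rep_word_conjugate w dh e1 e2) mxtrace_mulC mulmxA mulVmx ?mul1mx //.
by rewrite unitmxE dh unitr1.
Qed.

Definition trace_word (w : seq letter) : char_ring :=
  Sub (fun g => \tr (rep_word g w)) (trace_word_subproof w).

(* The complex points of Spec of the coordinate ring. *)
Definition charvar : Type := {lrmorphism char_ring -> C}.

HB.instance Definition _ := gen_eqMixin charvar.
HB.instance Definition _ := gen_choiceMixin charvar.

Definition charvar_eval (u : charvar) : {ptws char_ring -> C^o} :=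
  fun f => u f.

(* The Euclidean topology: the coarsest one making every regular function
   continuous. *)
HB.instance Definition _ :=
  Topological.copy charvar (initial_topology charvar_eval).

(* Tangent vectors are point derivations, seen in the vector space of all maps
   char_ring -> C. *)
Definition tangent (u : charvar) : set (char_ring -> C) :=
  [set D | scalar D /\ forall f1 f2, D (f1 * f2) = u f1 * D f2 + u f2 * D f1].

Definition has_dim (V : lmodType C) (W : set V) (n : nat) : Prop :=
  exists e : 'I_n -> V, (forall i, W (e i)) /\
    forall v, W v -> exists! c : 'rV[C]_n, v = \sum_i c 0 i *: e i.

(* The variety is irreducible of dimension 8, so a point is nonsingular iff its
   Zariski tangent space has dimension 8. *)
Definition smooth_locus : set charvar := [set u | has_dim (tangent u) 8].

(* The tangent space at u of a locally closed subvariety L, cut out by the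
   regular functions vanishing on L. *)
Definition tangent_sub (L : set charvar) (u : charvar) : set (char_ring -> C) :=
  [set D | tangent u D /\
    forall f : char_ring, (forall v : charvar, L v -> v f = 0) -> D f = 0].

Inductive surface : Type := Sigma30 | Sigma11.

Definition boundary_curves (S : surface) : seq (seq letter) :=
  match S with
  | Sigma30 => [:: [:: x1]; [:: x2]; inv_word [:: x1; x2]]
  | Sigma11 => [:: inv_word [:: x1; x2; inv_letter x1; inv_letter x2]]
  end.

Definition boundary_map (S : surface) (u : charvar) : seq (C * C) :=
  [seq (u (trace_word w), u (trace_word (inv_word w))) | w <- boundary_curves S].

Definition leaf (S : surface) (c : seq (C * C)) : set charvar :=
  [set v | smooth_locus v /\ boundary_map S v = c].

(* S is an oriented disc with four disjoint arcs (sides) of its boundary circle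
   labelled by the letters and glued in pairs, the side l to the side l^-1 with
   orientation reversed. A loop leaving the disc through the side l and coming
   back through the side l^-1 contributes the letter l to its word. The sides
   are listed counterclockwise; with these orders the boundary curves of
   [boundary_curves] are, up to conjugation, the boundary components of S with S
   on their left. *)
Definition sides (S : surface) : seq letter :=
  match S with
  | Sigma30 => [:: x1; inv_letter x2; x2; inv_letter x1]
  | Sigma11 => [:: x1; x2; inv_letter x1; inv_letter x2]
  end.

(* A crossing (l, t) is the point at parameter t in ]0, 1[ of the side l, and
   the circle is R / 4Z: the k-th side is the interval ]k, k + 1[. *)
Definition crossing : Type := (letter * R)%type.

Definition circle_point (S : surface) (c : crossing) : R :=
  (index c.1 (sides S))%:R + c.2.

Definition glue (c : crossing) : crossing := (inv_letter c.1, 1 - c.2).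

(* A loop is the cyclic sequence of the crossings by which it leaves the disc.
   Inside the disc it consists of straight chords, the i-th one joining the point
   glued to the previous crossing to the i-th crossing. *)
Definition loop : Type := seq crossing.

Definition word_of (a : loop) : seq letter := map fst a.

Definition chord (S : surface) (a : loop) (i : nat) : R * R :=
  let c0 := (x1, 0) in
  (circle_point S (glue (nth c0 (rotr 1 a) i)), circle_point S (nth c0 a i)).

Definition generic_loops (S : surface) (a b : loop) : Prop :=
  (forall c, c \in a ++ b -> 0 < c.2 < 1) /\
  uniq (map (circle_point S) (a ++ b) ++ map (circle_point S \o glue) (a ++ b)).

Definition ccw (p q r : R) : bool := [|| p < q < r, q < r < p | r < p < q].

(* Two chords with distinct endpoints meet, transversely and once, iff their
   endpoints are linked; the sign is + when (p, q) is a counterclockwise-positive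
   frame, i.e. when q crosses p from right to left. *)
Definition chord_sign (p q : R * R) : int :=
  if ccw p.1 q.1 p.2 && ccw p.2 q.2 p.1 then 1
  else if ccw p.1 q.2 p.2 && ccw p.2 q.1 p.1 then -1 else 0.

(* The loops based at an intersection point of the i-th chord of a and the j-th
   chord of b are read starting with the i-th, resp. j-th, crossing. *)
Definition goldman_sum (S : surface) (a b : loop) : char_ring :=
  \sum_(i < size a) \sum_(j < size b)
    (trace_word (rot i (word_of a) ++ rot j (word_of b))
       - (3%:R^-1 : C) *: (trace_word (word_of a) * trace_word (word_of b)))
    *~ chord_sign (chord S a i) (chord S b j).

Definition poisson_bracket (br : char_ring -> char_ring -> char_ring) : Prop :=
  [/\ forall f (c : C) g1 g2, br f (c *: g1 + g2) = c *: br f g1 + br f g2,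
      forall f g, br f g = - br g f,
      forall f g1 g2, br f (g1 * g2) = br f g1 * g2 + g1 * br f g2 &
      forall f g h, br f (br g h) + br g (br h f) + br h (br f g) = 0].

Definition goldman_bracket (S : surface)
    (br : char_ring -> char_ring -> char_ring) : Prop :=
  poisson_bracket br /\
  forall a b, generic_loops S a b ->
    br (trace_word (word_of a)) (trace_word (word_of b)) = goldman_sum S a b.

Definition hamiltonian (br : char_ring -> char_ring -> char_ring) (f : char_ring)
  (u : charvar) : char_ring -> C := fun g => u (br f g).

Definition symplectic_on (V : lmodType C) (W : set V) (w : V -> V -> C) : Prop :=
  [/\ forall (c : C) D1 D2 E, W D1 -> W D2 -> W E ->
        w (c *: D1 + D2) E = c * w D1 E + w D2 E,
      forall D E, W D -> W E -> w D E = - w E D &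
      forall D, W D -> (forall E, W E -> w D E = 0) -> D = 0].

(* L being a symplectic leaf, its tangent space at u consists of the Hamiltonian
   vectors; hence {f, g} = w (H_g, H_f) determines w on it. *)
Definition leaf_form (br : char_ring -> char_ring -> char_ring) (L : set charvar)
    (u : charvar) (w : (char_ring -> C) -> (char_ring -> C) -> C) : Prop :=
  [/\ tangent_sub L u = range (hamiltonian br ^~ u),
      symplectic_on (tangent_sub L u) w &
      forall f g, u (br f g) = w (hamiltonian br g u) (hamiltonian br f u)].

Definition direct_sum (V : lmodType C) (W W1 W2 : set V) : Prop :=
  W = [set D | exists D1 D2, [/\ W1 D1, W2 D2 & D = D1 + D2]] /\
  W1 `&` W2 = [set 0].

(* The form w1 (+) w2 on W1 (+) W2, through the decomposition of each vector. *)
Definition product_form (V : lmodType C) (W1 W2 : set V) (w1 w2 : V -> V -> C)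
    (D E : V) : C :=
  let split D := xget (0, 0) [set p | [/\ W1 p.1, W2 p.2 & D = p.1 + p.2]] in
  w1 (split D).1 (split E).1 + w2 (split D).2 (split E).2.

Definition symplectic_complement (V : lmodType C) (W : set V) (w : V -> V -> C)
    (W1 : set V) : set V :=
  [set D | W D /\ forall E, W1 E -> w D E = 0].

Definition symplectic_duals (V : lmodType C) (W : set V) (w : V -> V -> C)
    (W1 W2 : set V) : Prop :=
  W1 = symplectic_complement W w W2 /\ W2 = symplectic_complement W w W1.

End Representations.

(* Main.v *)
(* The coordinate ring is free of rank 2 over C[s1, ..., s8], where the s_i are the
   traces of x1, x2, x1 x2, x1 x2^-1 and of their inverses, with basis 1 and
   t = tr [x1, x2]; t and t' = tr [x2, x1] are the roots of X^2 - P X + Q for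
   polynomials P, Q in the s_i (Lawton). To see this, restrict an invariant
   function to the pairs with x1 diagonal: invariance under the torus and under
   the permutations of the eigenvalues makes it a polynomial in the s_i and t
   after multiplication by a power of the discriminant of x1; by symmetry the same
   holds with the discriminant of x2, and the two discriminants are coprime.

   Where P^2 - 4 Q <> 0 the variety is thus smooth with local coordinates
   s1, ..., s8. The leaf of the three-holed sphere is given by s1, ..., s6, that
   of the one-holed torus by P and Q, and they are transverse as soon as the
   Jacobian of (P, Q) in (s7, s8) does not vanish. The Hamiltonian vectors span
   the tangent spaces of the leaves because {s7, s8} = t - t' for the three-holed
   sphere, and because the matrix of the brackets of s1, ..., s6 for the one-holed
   torus is generically invertible. All these are nonvanishing conditions on
   polynomials in the s_i that hold at (0, 0, 0, 0, 0, 0, 1, 0). *)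
Require Import Defs.
From HB Require Import structures.
From mathcomp Require Import all_boot all_order all_algebra.
From mathcomp Require Import complex.
From mathcomp Require Import all_classical all_reals all_analysis.
From mathcomp Require Import ring lra zify.

Set Implicit Arguments.
Unset Strict Implicit.
Unset Printing Implicit Defensive.

Import Order.TTheory GRing.Theory Num.Theory.
Import numFieldNormedType.Exports.

Local Open Scope classical_set_scope.
Local Open Scope ring_scope.

(** * Polynomial expressions in eight variables *)

(** Polynomials in the s_i are kept as syntax trees [pexp], because one expression is evaluated in
    C, in {poly C} and in the coordinate ring; statements in eight variables are reduced to one
    variable by restriction to a line. The two discriminants involve disjoint pairs of variables, so
    interpolation does the work of their coprimality. The main obstacle is the tangent space of a
    leaf, which is cut out by all the functions vanishing at the points of the leaf. That a
    derivation killing the boundary traces kills each of them requires enough points: for the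
    three-holed sphere a line with both values of t, for the one-holed torus points of a level set
    of (P, Q) obtained by correcting small displacements, where a bound on the smallest root of a
    polynomial stands in for the implicit function theorem. The brackets are prescribed only on
    traces of loops in general position; this suffices because a derivation at a point where P^2 - 4
    Q <> 0 is determined by its values on s1, ..., s8. At the chosen point P^2 - 4 Q is -31, the
    Jacobian is -3 and the 6 x 6 matrix of brackets is a signed permutation matrix. *)

Notation o0 := (@Ordinal 8 0 isT).
Notation o1 := (@Ordinal 8 1 isT).
Notation o2 := (@Ordinal 8 2 isT).
Notation o3 := (@Ordinal 8 3 isT).
Notation o4 := (@Ordinal 8 4 isT).
Notation o5 := (@Ordinal 8 5 isT).
Notation o6 := (@Ordinal 8 6 isT).
Notation o7 := (@Ordinal 8 7 isT).

Lemma ord8_ind (P : 'I_8 -> Prop) :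
  P o0 -> P o1 -> P o2 -> P o3 -> P o4 -> P o5 -> P o6 -> P o7 ->
  forall i, P i.
Proof.
move=> ? ? ? ? ? ? ? ? [m lt_m8].
do 8! [case: m lt_m8 => [|m] lt_m8; first by rewrite (bool_irrelevance lt_m8 isT)].
by [].
Qed.

Definition pt8 (T : Type) (v0 v1 v2 v3 v4 v5 v6 v7 : T) : 'I_8 -> T :=
  fun i => nth v0 [:: v0; v1; v2; v3; v4; v5; v6; v7] i.

Declare Scope pexp_scope.
Delimit Scope pexp_scope with P.

Section PolynomialExpressions.
Variable C : comNzRingType.

Inductive pexp : Type :=
| PCst of C | PVar of 'I_8 | PAdd of pexp & pexp | PMul of pexp & pexp.

Fixpoint pev (S : comNzRingType) (i : C -> S) (x : 'I_8 -> S) (p : pexp) : S :=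
  match p with
  | PCst c => i c
  | PVar k => x k
  | PAdd p q => pev i x p + pev i x q
  | PMul p q => pev i x p * pev i x q
  end.

Definition ev : ('I_8 -> C) -> pexp -> C := pev id.

Fixpoint dif (x c : 'I_8 -> C) (p : pexp) : C :=
  match p with
  | PCst _ => 0
  | PVar k => c k
  | PAdd p q => dif x c p + dif x c q
  | PMul p q => ev x p * dif x c q + ev x q * dif x c p
  end.

Fixpoint psubst (s : 'I_8 -> pexp) (p : pexp) : pexp :=
  match p with
  | PCst c => PCst c
  | PVar k => s k
  | PAdd p q => PAdd (psubst s p) (psubst s q)
  | PMul p q => PMul (psubst s p) (psubst s q)
  end.

Fixpoint pdeg (p : pexp) : nat :=
  match p with
  | PCst _ => 0
  | PVar _ => 1
  | PAdd p q => pdeg p + pdeg q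
  | PMul p q => pdeg p + pdeg q
  end.

Definition upd (S : Type) (x : 'I_8 -> S) (j : 'I_8) (z : S) : 'I_8 -> S :=
  fun i => if i == j then z else x i.

Definition line (x c : 'I_8 -> C) (i : 'I_8) : {poly C} :=
  (x i)%:P + (c i)%:P * 'X.

Definition along (x c : 'I_8 -> C) (z : C) (i : 'I_8) : C := x i + c i * z.

Definition psum (T : Type) (r : seq T) (F : T -> pexp) : pexp :=
  foldr (fun k => PAdd (F k)) (PCst 0) r.

Definition ppoly (q : {poly C}) (p : pexp) : pexp :=
  foldr (fun c r => PAdd (PMul r p) (PCst c)) (PCst 0) q.

Fixpoint ppow (p : pexp) (n : nat) : pexp :=
  if n is n'.+1 then PMul p (ppow p n') else PCst 1.

Lemma evC x c : ev x (PCst c) = c. Proof. by []. Qed.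
Lemma evX x k : ev x (PVar k) = x k. Proof. by []. Qed.
Lemma evD x p q : ev x (PAdd p q) = ev x p + ev x q. Proof. by []. Qed.
Lemma evM x p q : ev x (PMul p q) = ev x p * ev x q. Proof. by []. Qed.

Lemma pev_rmorph (S T : comNzRingType) (f : {rmorphism S -> T}) i x p :
  f (pev i x p) = pev (f \o i) (f \o x) p.
Proof. by elim: p => //= p <- q <-; rewrite (rmorphD, rmorphM). Qed.

Lemma eq_pev (S : comNzRingType) (i i' : C -> S) x x' p :
  i =1 i' -> x =1 x' -> pev i x p = pev i' x' p.
Proof. by move=> ei ex; elim: p => //= p -> q ->. Qed.

Lemma eq_ev x x' p : x =1 x' -> ev x p = ev x' p.
Proof. exact: eq_pev. Qed.

Lemma pev_psubst (S : comNzRingType) (i : C -> S) x s p :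
  pev i x (psubst s p) = pev i (fun k => pev i x (s k)) p.
Proof. by elim: p => //= p -> q ->. Qed.

Lemma ev_psubst x s p : ev x (psubst s p) = ev (fun k => ev x (s k)) p.
Proof. exact: pev_psubst. Qed.

Lemma ev_psum (T : Type) (r : seq T) F x :
  ev x (psum r F) = \sum_(k <- r) ev x (F k).
Proof.
elim: r => [|k r IH]; first by rewrite big_nil.
by rewrite big_cons -IH.
Qed.

Lemma ev_ppoly q p x : ev x (ppoly q p) = q.[ev x p].
Proof.
by rewrite /ppoly /horner; elim: (polyseq q) => //= c r <-.
Qed.

Lemma ev_ppow x p n : ev x (ppow p n) = ev x p ^+ n.
Proof. by elim: n => //= n IH; rewrite evM IH exprS. Qed.

Lemma horner_line p x c z :
  (pev polyC (line x c) p).[z] = ev (along x c z) p.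
Proof.
elim: p => [d|k|p IHp q IHq|p IHp q IHq] /=.
- by rewrite hornerC.
- by rewrite !hornerE.
- by rewrite hornerD IHp IHq.
- by rewrite hornerM IHp IHq.
Qed.

Lemma along0 x c : along x c 0 =1 x.
Proof. by move=> i; rewrite /along mulr0 addr0. Qed.

Lemma dif_line p x c : dif x c p = (pev polyC (line x c) p)^`().[0].
Proof.
elim: p => [d|k|p IHp q IHq|p IHp q IHq] /=.
- by rewrite derivC hornerC.
- by rewrite /line derivD derivM !derivC derivX !hornerE.
- by rewrite derivD hornerD IHp IHq.
- rewrite derivM hornerD !hornerM IHp IHq !horner_line.
  by rewrite !(eq_ev _ (along0 x c)) addrC mulrC (mulrC _ (ev x q)) addrC mulrC addrC.
Qed.

Lemma dif_linear x (k : C) c d p :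
  dif x (fun i => k * c i + d i) p = k * dif x c p + dif x d p.
Proof.
elim: p => [e|j|p IHp q IHq|p IHp q IHq] //=.
- by rewrite mulr0 addr0.
- by rewrite IHp IHq mulrDr addrACA.
- by rewrite IHp IHq; ring.
Qed.

Lemma eq_dif x x' c c' p : x =1 x' -> c =1 c' -> dif x c p = dif x' c' p.
Proof.
move=> ex ec; elim: p => //= p -> q -> //.
by rewrite !(eq_ev _ ex).
Qed.

End PolynomialExpressions.

Notation "p + q" := (PAdd p q) : pexp_scope.
Notation "p * q" := (PMul p q) : pexp_scope.
Notation "p - q" := (PAdd p (PMul (PCst (-1)) q)) : pexp_scope.
Notation "# n" := (PCst n%:R) (at level 1, n at level 0) : pexp_scope.

(** * The polynomials P and Q and the discriminants of the two matrices *)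

Section FrickePolynomials.
Variable C : comNzRingType.
Local Notation s1 := (@PVar C o0).
Local Notation s2 := (@PVar C o1).
Local Notation s3 := (@PVar C o2).
Local Notation s4 := (@PVar C o3).
Local Notation s5 := (@PVar C o4).
Local Notation s6 := (@PVar C o5).
Local Notation s7 := (@PVar C o6).
Local Notation s8 := (@PVar C o7).

(* The sum and the product of the traces of [x1, x2] and of its inverse are
   polynomials in s1, ..., s8 (Lawton). They are homogenised here by e, with
   weights 1, 2, 0, 0, 1, 2, 1, 2 of s1, ..., s8 and 3 of e: these are the
   degrees in the eigenvalues a_i of x1 once 1 / a_i is replaced by a_j a_k,
   and e stands for a_1 a_2 a_3. *)
Definition Psum_h (e : pexp C) : pexp C :=
  (s1 * s2 * s3 * s4 - s1 * s3 * s6 - s2 * s4 * s5 - s1 * s4 * s8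
   - s2 * s3 * s7 + s1 * s2 + e * s3 * s4 + s5 * s6 + s7 * s8 - #3 * e)%P.

Definition Pprod_h (e : pexp C) : pexp C :=
  (#9 * e * e - #6 * e * s1 * s2 - #6 * e * e * s3 * s4 - #6 * e * s5 * s6 - #6 * e * s7 * s8 + e * s1 * s1 * s1 
    + #3 * e * s1 * s3 * s6 + #3 * e * s1 * s4 * s8 - #3 * e * s1 * s5 * s7 + s2 * s2 * s2 + #3 * e * s2 * s3 * s7 
    + #3 * e * s2 * s4 * s5 - #3 * s2 * s6 * s8 + e * e * s3 * s3 * s3 - #3 * e * s3 * s5 * s8 + e * e * s4 * s4 * s4 
    - #3 * e * s4 * s6 * s7 + e * s5 * s5 * s5 + s6 * s6 * s6 + e * s7 * s7 * s7 + s8 * s8 * s8 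
    + e * s1 * s1 * s3 * s7 + e * s1 * s1 * s4 * s5 + s1 * s1 * s6 * s8 + e * s1 * s2 * s3 * s4 
    + s1 * s2 * s5 * s6 + s1 * s2 * s7 * s8 + e * s1 * s3 * s3 * s8 - #2 * e * s1 * s3 * s5 * s5 
    + e * s1 * s4 * s4 * s6 - #2 * e * s1 * s4 * s7 * s7 + s1 * s5 * s8 * s8 + s1 * s6 * s6 * s7 
    + s2 * s2 * s3 * s6 + s2 * s2 * s4 * s8 + s2 * s2 * s5 * s7 + e * s2 * s3 * s3 * s5 
    - #2 * s2 * s3 * s8 * s8 + e * s2 * s4 * s4 * s7 - #2 * s2 * s4 * s6 * s6 + s2 * s5 * s5 * s8 
    + s2 * s6 * s7 * s7 + e * s3 * s3 * s6 * s7 + e * s3 * s4 * s5 * s6 + e * s3 * s4 * s7 * s8 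
    + e * s3 * s5 * s7 * s7 + s3 * s6 * s6 * s8 + e * s4 * s4 * s5 * s8 + e * s4 * s5 * s5 * s7 
    + s4 * s6 * s8 * s8 + s5 * s6 * s7 * s8 - e * s1 * s1 * s1 * s3 * s4 - s1 * s1 * s2 * s3 * s6 
    - s1 * s1 * s2 * s4 * s8 + e * s1 * s1 * s3 * s3 * s5 + e * s1 * s1 * s4 * s4 * s7 - s1 * s2 * s2 * s3 * s7 
    - s1 * s2 * s2 * s4 * s5 - e * s1 * s2 * s3 * s3 * s3 - s1 * s2 * s3 * s5 * s8 - e * s1 * s2 * s4 * s4 * s4 
    - s1 * s2 * s4 * s6 * s7 - e * s1 * s3 * s3 * s4 * s6 - e * s1 * s3 * s4 * s4 * s8 
    - e * s1 * s3 * s4 * s5 * s7 - s2 * s2 * s2 * s3 * s4 + s2 * s2 * s3 * s3 * s8 + s2 * s2 * s4 * s4 * s6 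
    - e * s2 * s3 * s3 * s4 * s7 - e * s2 * s3 * s4 * s4 * s5 - s2 * s3 * s4 * s6 * s8 
    + s1 * s1 * s2 * s2 * s3 * s4 + e * s1 * s2 * s3 * s3 * s4 * s4)%P.

(* Discriminant of X^3 - p X^2 + q X - 1. *)
Definition cubic_disc (p q : pexp C) : pexp C :=
  (p * p * q * q - #4 * (p * p * p) - #4 * (q * q * q) + #18 * (p * q) - #27)%P.

End FrickePolynomials.

HB.lock Definition Psum (C : comNzRingType) : pexp C := Psum_h (PCst 1).
HB.lock Definition Pprod (C : comNzRingType) : pexp C := Pprod_h (PCst 1).
HB.lock Definition Pdisc (C : comNzRingType) : pexp C :=
  (Psum C * Psum C - #4 * Pprod C)%P.
HB.lock Definition disc1 (C : comNzRingType) : pexp C :=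
  cubic_disc (PVar C o0) (PVar C o1).
HB.lock Definition disc2 (C : comNzRingType) : pexp C :=
  cubic_disc (PVar C o2) (PVar C o3).

Section FrickeIdentities.
Variables (C : comNzRingType) (a1 a2 a3 x1 x2 x3 y1 y2 y3 : C).

Definition vandermonde := (a1 - a2) * (a1 - a3) * (a2 - a3).

(** The eight traces when the first matrix is diag(a1, a2, a3) and the second has diagonal entries
    x_i and diagonal cofactors y_i; the inverse of a_i is written a_j a_k. *)
Definition frame_pt : 'I_8 -> C :=
  pt8 (a1 + a2 + a3) (a2 * a3 + a1 * a3 + a1 * a2)
      (x1 + x2 + x3) (y1 + y2 + y3)
      (a1 * x1 + a2 * x2 + a3 * x3)
      (a2 * a3 * y1 + a1 * a3 * y2 + a1 * a2 * y3)
      (a1 * y1 + a2 * y2 + a3 * y3)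
      (a2 * a3 * x1 + a1 * a3 * x2 + a1 * a2 * x3).

(** For a 3 x 3 matrix b of determinant 1 with diagonal entries x_i and diagonal cofactors y_i, this
    is b12 b23 b31 + b13 b32 b21, and [cycle_prod] is the product of these two cycles: x2 x3 - y1 =
    b23 b32, and so on. *)
Definition cycle_sum :=
  1 - x1 * x2 * x3 + x1 * (x2 * x3 - y1) + x2 * (x1 * x3 - y2)
  + x3 * (x1 * x2 - y3).

Definition cycle_prod := (x2 * x3 - y1) * (x1 * x3 - y2) * (x1 * x2 - y3).

(** With [twist'], the coefficients of the two 3-cycles of the second matrix in the trace of the
    commutator; [comm_base] is the rest of that trace, which involves only the eigenvalues, the
    diagonal entries and the diagonal cofactors. *)
Definition twist := a1 ^+ 2 * a3 + a2 ^+ 2 * a1 + a3 ^+ 2 * a2.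
Definition twist' := a1 ^+ 2 * a2 + a2 ^+ 2 * a3 + a3 ^+ 2 * a1.

Definition comm_base :=
  x1 * y1 + x2 * y2 + x3 * y3
  - (a1 ^+ 2 * a3 + a2 ^+ 2 * a3) * (x1 * x2 - y3) * x3
  - (a1 ^+ 2 * a2 + a3 ^+ 2 * a2) * (x1 * x3 - y2) * x2
  - (a2 ^+ 2 * a1 + a3 ^+ 2 * a1) * (x2 * x3 - y1) * x1.

Hypothesis a123 : a1 * a2 * a3 = 1.

Lemma Psum_frame :
  ev frame_pt (Psum C) = 2 * comm_base + (twist + twist') * cycle_sum.
Proof.
rewrite (_ : Psum C = Psum_h (PCst (a1 * a2 * a3))); last by rewrite Psum.unlock a123.
rewrite /comm_base /ev /Psum_h /frame_pt /pt8 /=.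
(* These are the terms of degree 0 in the a_i; multiplied by a1 a2 a3 = 1 they make both sides
   homogeneous of degree 3, and [ring] applies. *)
have -> : x1 * y1 + x2 * y2 + x3 * y3 =
    a1 * a2 * a3 * (x1 * y1 + x2 * y2 + x3 * y3) by rewrite a123 mul1r.
rewrite /twist /twist' /cycle_sum.
ring.
Qed.

(** P^2 - 4 Q is (t - t')^2, and t - t' is the difference of the two 3-cycles times
    [twist - twist'], the Vandermonde determinant up to sign. *)
Lemma Pdisc_frame :
  ev frame_pt (Pdisc C) = vandermonde ^+ 2 * (cycle_sum ^+ 2 - 4 * cycle_prod).
Proof.
rewrite Pdisc.unlock (_ : Psum C = Psum_h (PCst (a1 * a2 * a3))); last by rewrite Psum.unlock a123.
rewrite (_ : Pprod C = Pprod_h (PCst (a1 * a2 * a3))); last by rewrite Pprod.unlock a123.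
rewrite /ev /Psum_h /Pprod_h /frame_pt /pt8 /= /vandermonde /cycle_sum /cycle_prod.
ring.
Qed.

Lemma disc1_frame : ev frame_pt (disc1 C) = vandermonde ^+ 2.
Proof.
rewrite disc1.unlock /ev /cubic_disc /frame_pt /pt8 /vandermonde /=.
have -> : 27%:R = 27 * (a1 * a2 * a3) ^+ 2 by rewrite a123 expr1n mulr1.
set p := a1 + a2 + a3; set q := _ + a1 * a2.
have -> : p * p * p = a1 * a2 * a3 * (p * p * p) by rewrite a123 mul1r.
have -> : 18%:R * (p * q) = 18 * (a1 * a2 * a3) * (p * q) by rewrite a123 mulr1.
rewrite /p /q; ring.
Qed.

Lemma twistB : twist - twist' = - vandermonde.
Proof. rewrite /twist /twist' /vandermonde; ring. Qed.

End FrickeIdentities.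

(** * Polynomial functions: vanishing, interpolation, division *)

Lemma poly_seq_eq0 (F : idomainType) (e : nat -> F) (q : {poly F}) :
  injective e -> (forall n, q.[e n] = 0) -> q = 0.
Proof.
move=> e_inj q0; apply/eqP/negP => /negP q_neq0.
have : (size [seq e n | n <- iota 0 (size q)] < size q)%N.
  apply: max_poly_roots => //.
    by apply/allP => _ /mapP[n _ ->]; rewrite rootE q0.
  by rewrite map_inj_uniq ?iota_uniq.
by rewrite size_map size_iota ltnn.
Qed.

Section PolynomialFunctions.
Variable C : numFieldType.
Implicit Types (p q h : pexp C) (x c : 'I_8 -> C).

Lemma poly_fun_eq0 (q : {poly C}) : (forall z, q.[z] = 0) -> q = 0.
Proof.
move=> q0; apply: (@poly_seq_eq0 _ (fun n => n%:R)) => //.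
exact: mulrIn (oner_neq0 _).
Qed.

(** On the line from s to x the product of the two restrictions vanishes everywhere, and the
    restriction of [h] is a nonzero polynomial because of its value at s. *)
Lemma pexp_generic_eq0 h p s : ev s h != 0 ->
  (forall x, ev x h != 0 -> ev x p = 0) -> forall x, ev x p = 0.
Proof.
move=> hs0 p0 x.
pose L q := pev polyC (line s (fun i => x i - s i)) q.
have /poly_fun_eq0/eqP : forall z, (L h * L p).[z] = 0.
  move=> z; rewrite hornerM !horner_line.
  by have [->|/p0->] := eqVneq (ev (along s (fun i => x i - s i) z) h) 0;
    rewrite ?mul0r ?mulr0.
rewrite mulf_eq0 => /orP[] /eqP Lq0.
  have : (L h).[0] = 0 by rewrite Lq0 horner0.
  rewrite horner_line => h0; case/eqP: hs0; rewrite -h0.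
  by apply: eq_ev => i; rewrite along0.
have : (L p).[1] = 0 by rewrite Lq0 horner0.
rewrite horner_line => <-; apply: eq_ev => i.
by rewrite /along mulr1 addrC subrK.
Qed.

(** The trees may differ, but [dif] is the derivative at 0 of the restriction to a line, a
    polynomial in one variable determined by its values. *)
Lemma dif_fun_eq p q : (forall x, ev x p = ev x q) ->
  forall x c, dif x c p = dif x c q.
Proof.
move=> pq x c; rewrite !dif_line.
suff -> : pev polyC (line x c) p = pev polyC (line x c) q by [].
apply/eqP; rewrite -subr_eq0; apply/eqP/poly_fun_eq0 => z.
by rewrite hornerD hornerN !horner_line pq subrr.
Qed.

Lemma lagrange_interpolation (e : nat -> C) n : injective e ->
  exists L : nat -> {poly C}, forall q : {poly C}, (size q <= n)%N ->
    forall z, q.[z] = \sum_(k <- iota 0 n) q.[e k] * (L k).[z].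
Proof.
move=> e_inj.
pose L k := \prod_(l <- iota 0 n | l != k) ((e k - e l)^-1%:P * ('X - (e l)%:P)).
exists L => q szq z.
have szL k : k \in iota 0 n -> (size (L k) <= n)%N.
  move=> kn.
  have szP r : (size (\prod_(l <- r | l != k)
      ((e k - e l)^-1%:P * ('X - (e l)%:P)))%R <= (count (predC1 k) r).+1)%N.
    elim: r => [|l r IH]; first by rewrite big_nil size_poly1.
    rewrite big_cons /=; case: ifP => _ //.
    rewrite mul_polyC -scalerAl (leq_trans (size_scale_leq _ _)) //.
    apply: (leq_trans (size_polyMleq _ _)).
    by rewrite size_XsubC add1n !ltnS.
  apply: (leq_trans (szP _)).
  have := count_predC (pred1 k) (iota 0 n).
  rewrite size_iota count_uniq_mem ?iota_uniq // kn add1n.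
  rewrite (eq_count (a2 := predC1 k)); last by [].
  by move=> ->.
pose D := q - \sum_(k <- iota 0 n) q.[e k] *: L k.
have D0 : D = 0.
  apply/eqP/negP => /negP D_neq0.
  pose r := [seq e k | k <- iota 0 n].
  have : (size r < size D)%N.
    apply: max_poly_roots => //; last by rewrite map_inj_uniq ?iota_uniq.
    apply/allP => _ /mapP[k kn ->]; rewrite rootE /D hornerD hornerN horner_sum.
    rewrite (bigD1_seq k) ?iota_uniq //= big1_seq => [|l /andP[lk ln]].
      rewrite addr0 hornerZ /L horner_prod big1 ?mulr1 ?subrr // => l lk.
      rewrite hornerM hornerC hornerXsubC mulVf // subr_eq0 inj_eq //.
      by rewrite eq_sym.
    apply/eqP; rewrite hornerZ mulf_eq0 /L horner_prod prodf_seq_eq0.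
    apply/orP; right; apply/hasP; exists k => //=.
    by rewrite eq_sym lk /= hornerM hornerXsubC subrr mulr0.
  rewrite size_map size_iota ltnNge => /negP[].
  apply: (leq_trans (size_polyD _ _)); rewrite geq_max szq size_polyN.
  apply: (leq_trans (size_sum _ _ _)); apply/bigmax_leqP_seq => k kn _.
  exact: leq_trans (size_scale_leq _ _) (szL k kn).
have qE : q = \sum_(k <- iota 0 n) q.[e k] *: L k.
  by apply/eqP; rewrite -subr_eq0 -/D D0.
by rewrite {1}qE horner_sum; apply: eq_bigr => k _; rewrite hornerZ.
Qed.

Lemma size_pev_poly (x : 'I_8 -> {poly C}) p :
  (forall i, size (x i) <= 2)%N -> (size (pev polyC x p) <= (pdeg p).+1)%N.
Proof.
move=> szx; elim: p => [d|k|p IHp q IHq|p IHp q IHq] //=.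
- exact: size_polyC_leq1.
- apply: (leq_trans (size_polyD _ _)); rewrite geq_max.
  by rewrite (leq_trans IHp) ?(leq_trans IHq) ?ltnS ?leq_addr ?leq_addl.
- apply: (leq_trans (size_polyMleq _ _)).
  have := leq_add IHp IHq; rewrite addSn addnS.
  by case: (_ + _)%N.
Qed.

Lemma pexp_interpolation (e : nat -> C) p (j : 'I_8) : injective e ->
  exists n (L : nat -> {poly C}), forall x,
    ev x p = \sum_(k <- iota 0 n) ev (upd x j (e k)) p * (L k).[x j].
Proof.
move=> /(lagrange_interpolation (pdeg p).+1)[L Le].
exists (pdeg p).+1, L => x.
pose q := pev polyC (fun i => if i == j then 'X else (x i)%:P) p.
have qE z : q.[z] = ev (upd x j z) p.
  rewrite /q -[LHS]/(horner_eval z _) pev_rmorph; apply: eq_pev => [c|i] /=.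
    by rewrite /horner_eval hornerC.
  by rewrite /upd /horner_eval; case: eqP => _; rewrite ?hornerX ?hornerC.
have szq : (size q <= (pdeg p).+1)%N.
  apply: size_pev_poly => i; case: eqP => _; first by rewrite size_polyX.
  exact: leq_trans (size_polyC_leq1 _) _.
have -> : ev x p = q.[x j].
  by rewrite qE; apply: eq_ev => i; rewrite /upd; case: eqP => [->|].
by rewrite Le //; apply: eq_bigr => k _; rewrite qE.
Qed.

(** The nodes start at -2 because the discriminant vanishes at p = q = -1: 1 + 4 + 4 + 18 - 27 =
    0. *)
Definition node (k : nat) : C := - k.+2%:R.

Lemma node_inj : injective node.
Proof. by move=> k l /oppr_inj /(mulrIn (oner_neq0 _)) []. Qed.

(* All the terms of the discriminant but -27 are nonnegative at negative
   arguments. *)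
Lemma disc2_node x k l : x o2 = node k -> x o3 = node l -> ev x (disc2 C) != 0.
Proof.
move=> xk xl; rewrite disc2.unlock /ev /cubic_disc /= xk xl /node.
set N := (k.+2 * k.+2 * l.+2 * l.+2 + 4 * (k.+2 * k.+2 * k.+2)
  + 4 * (l.+2 * l.+2 * l.+2) + 18 * (k.+2 * l.+2) - 27)%N.
rewrite (_ : _ + _ = N%:R); last first.
  rewrite natrB; last by nia.
  rewrite !natrD !natrM; ring.
by rewrite pnatr_eq0; nia.
Qed.

(** Interpolation in the variables [o2] and [o3] expresses [p] through its restrictions to the
    nodes. There [disc2] is a nonzero constant, and the hypothesis shows the restriction to be a
    multiple of the power of [disc1]. This power is free of [o2] and [o3] and comes out of the
    sum. *)
Lemma disc_division k l p q :
  (forall x, ev x p * ev x (disc2 C) ^+ l = ev x q * ev x (disc1 C) ^+ k) ->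
  exists r, forall x, ev x p = ev x r * ev x (disc1 C) ^+ k.
Proof.
move=> pq.
have [n [L LE]] := pexp_interpolation p o2 node_inj.
have [n' [L' LE']] := pexp_interpolation p o3 node_inj.
pose at_nodes a b (i : 'I_8) : pexp C :=
  if i == o3 then PCst (node b) else if i == o2 then PCst (node a) else PVar _ i.
(* [disc2] involves only [o2] and [o3], so its value at the nodes can be read with all the other
   coordinates equal to 0. *)
pose dn a b := ev (fun i => ev (fun=> 0) (at_nodes a b i)) (disc2 C).
exists (psum (iota 0 n') (fun b => PMul (psum (iota 0 n) (fun a =>
  PMul (PMul (psubst (at_nodes a b) q) (PCst (dn a b ^- l)))
    (ppoly (L a) (PVar _ o2)))) (ppoly (L' b) (PVar _ o3)))) => x.
rewrite LE' ev_psum mulr_suml; apply: eq_bigr => b _.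
rewrite evM ev_ppoly evX.
rewrite mulrAC; congr (_ * _).
rewrite LE ev_psum mulr_suml; apply: eq_bigr => a _.
rewrite evM ev_ppoly evX (_ : upd x o3 (node b) o2 = x o2); last by [].
rewrite mulrAC; congr (_ * _).
rewrite evM ev_psubst evC.
set y := upd _ _ _; set z := fun i => _.
have yz : y =1 z.
  by apply: ord8_ind.
have d1 : ev x (disc1 C) = ev y (disc1 C) by rewrite disc1.unlock.
have d2 : dn a b = ev y (disc2 C) by rewrite /dn disc2.unlock.
rewrite d1 d2 mulrAC -(eq_ev _ yz) -pq mulfK //.
by rewrite expf_neq0 // (@disc2_node _ a b).
Qed.

End PolynomialFunctions.

Notation i0 := (@Ordinal 3 0 isT).
Notation i1 := (@Ordinal 3 1 isT).
Notation i2 := (@Ordinal 3 2 isT).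

(** * Explicit formulas for 3 x 3 matrices and their commutators *)

Section Matrices3.

Lemma ord3_ind (P : 'I_3 -> Prop) : P i0 -> P i1 -> P i2 -> forall i, P i.
Proof.
move=> ? ? ? [m lt_m3].
do 3! [case: m lt_m3 => [|m] lt_m3; first by rewrite (bool_irrelevance lt_m3 isT)].
by [].
Qed.

Lemma sum3 (V : nmodType) (F : 'I_3 -> V) : \sum_i F i = F i0 + F i1 + F i2.
Proof.
rewrite 3!big_ord_recl big_ord0 addr0 addrA.
by congr (F _ + F _ + F _); apply: val_inj.
Qed.

Lemma prod3 (S : pzSemiRingType) (F : 'I_3 -> S) :
  \prod_i F i = F i0 * F i1 * F i2.
Proof.
rewrite 3!big_ord_recl big_ord0 mulr1 mulrA.
by congr (F _ * F _ * F _); apply: val_inj.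
Qed.

Variable F : fieldType.
Implicit Types M N : 'M[F]_3.

Lemma det3 M : \det M =
  M i0 i0 * (M i1 i1 * M i2 i2 - M i1 i2 * M i2 i1)
  - M i0 i1 * (M i1 i0 * M i2 i2 - M i1 i2 * M i2 i0)
  + M i0 i2 * (M i1 i0 * M i2 i1 - M i1 i1 * M i2 i0).
Proof.
(* Indexing by natural numbers lets the minors of the expansion reduce to explicit entries. *)
pose m i j := M (inord i) (inord j).
have -> : M = \matrix_(i, j) m i j.
  by apply/matrixP => i j; rewrite mxE /m !inord_val.
rewrite (expand_det_row _ ord0) !big_ord_recl big_ord0 /cofactor.
rewrite !(expand_det_row _ ord0) !big_ord_recl !big_ord0 /cofactor !det_mx11.
rewrite !mxE /= /bump /=; ring.
Qed.

Definition mx3 (l : seq (seq F)) : 'M[F]_3 :=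
  \matrix_(i, j) nth 0 (nth [::] l i) j.

Lemma mx3P M N : M i0 i0 = N i0 i0 -> M i0 i1 = N i0 i1 -> M i0 i2 = N i0 i2 ->
  M i1 i0 = N i1 i0 -> M i1 i1 = N i1 i1 -> M i1 i2 = N i1 i2 ->
  M i2 i0 = N i2 i0 -> M i2 i1 = N i2 i1 -> M i2 i2 = N i2 i2 -> M = N.
Proof. by move=> *; apply/matrixP; elim/ord3_ind; elim/ord3_ind. Qed.

Definition adj3 M : 'M[F]_3 := mx3
  [:: [:: M i1 i1 * M i2 i2 - M i1 i2 * M i2 i1;
          M i0 i2 * M i2 i1 - M i0 i1 * M i2 i2;
          M i0 i1 * M i1 i2 - M i0 i2 * M i1 i1];
      [:: M i1 i2 * M i2 i0 - M i1 i0 * M i2 i2;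
          M i0 i0 * M i2 i2 - M i0 i2 * M i2 i0;
          M i0 i2 * M i1 i0 - M i0 i0 * M i1 i2];
      [:: M i1 i0 * M i2 i1 - M i1 i1 * M i2 i0;
          M i0 i1 * M i2 i0 - M i0 i0 * M i2 i1;
          M i0 i0 * M i1 i1 - M i0 i1 * M i1 i0]].

Lemma mulmx_invmx M N : M *m N = 1%:M -> invmx M = N.
Proof.
move=> MN; have [uM _] := mulmx1_unit MN.
by rewrite -[LHS]mulmx1 -MN mulKmx.
Qed.

Lemma invmx3 M : \det M = 1 -> invmx M = adj3 M.
Proof.
move=> detM; apply: mulmx_invmx; rewrite det3 in detM.
by apply: mx3P; rewrite !mxE !sum3 !mxE /= ?mulr1n ?mulr0n -?detM; ring.
Qed.

Definition diag3 (a1 a2 a3 : F) := mx3 [:: [:: a1; 0; 0]; [:: 0; a2; 0]; [:: 0; 0; a3]].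

Lemma det_diag3 a1 a2 a3 : \det (diag3 a1 a2 a3) = a1 * a2 * a3.
Proof. by rewrite det3 !mxE /=; ring. Qed.

Lemma invmx_diag3 a1 a2 a3 : a1 * a2 * a3 = 1 ->
  invmx (diag3 a1 a2 a3) = diag3 (a2 * a3) (a1 * a3) (a1 * a2).
Proof.
move=> a123; rewrite invmx3 ?det_diag3 //.
by apply: mx3P; rewrite !mxE /=; ring.
Qed.

Lemma tr_diag3 a1 a2 a3 : \tr (diag3 a1 a2 a3) = a1 + a2 + a3.
Proof. by rewrite /mxtrace sum3 !mxE. Qed.

Lemma tr3 M : \tr M = M i0 i0 + M i1 i1 + M i2 i2.
Proof. exact: sum3. Qed.

Lemma tr_diag3_mul a1 a2 a3 M :
  \tr (diag3 a1 a2 a3 *m M) = a1 * M i0 i0 + a2 * M i1 i1 + a3 * M i2 i2.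
Proof. by rewrite tr3 !mxE !sum3 !mxE /= !mul0r !addr0 !add0r. Qed.

Lemma tr_comm_diag3 (a1 a2 a3 c1 c2 c3 : F) M N :
  \tr (diag3 a1 a2 a3 *m M *m diag3 c1 c2 c3 *m N) =
  a1 * (M i0 i0 * c1 * N i0 i0 + M i0 i1 * c2 * N i1 i0 + M i0 i2 * c3 * N i2 i0)
  + a2 * (M i1 i0 * c1 * N i0 i1 + M i1 i1 * c2 * N i1 i1 + M i1 i2 * c3 * N i2 i1)
  + a3 * (M i2 i0 * c1 * N i0 i2 + M i2 i1 * c2 * N i1 i2 + M i2 i2 * c3 * N i2 i2).
Proof.
rewrite -!mulmxA tr_diag3_mul !mxE !sum3 !mxE !sum3 !mxE /=.
by rewrite !mul0r !addr0 !add0r !mulrA.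
Qed.

Section Commutator.
Variables (a1 a2 a3 : F) (B : 'M[F]_3).
Hypothesis a123 : a1 * a2 * a3 = 1.

Definition cyc := B i0 i1 * B i1 i2 * B i2 i0.
Definition cyc' := B i0 i2 * B i2 i1 * B i1 i0.

Lemma cycle_sum_mx : \det B = 1 -> cycle_sum (B i0 i0) (B i1 i1) (B i2 i2)
  (adj3 B i0 i0) (adj3 B i1 i1) (adj3 B i2 i2) = cyc + cyc'.
Proof. by move=> dB; rewrite /cycle_sum -dB det3 !mxE /= /cyc /cyc'; ring. Qed.

Lemma cycle_prod_mx : cycle_prod (B i0 i0) (B i1 i1) (B i2 i2)
  (adj3 B i0 i0) (adj3 B i1 i1) (adj3 B i2 i2) = cyc * cyc'.
Proof. by rewrite /cycle_prod !mxE /= /cyc /cyc'; ring. Qed.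

Let base := comm_base a1 a2 a3 (B i0 i0) (B i1 i1) (B i2 i2)
  (adj3 B i0 i0) (adj3 B i1 i1) (adj3 B i2 i2).

(** The added term is zero, but it multiplies the part of [comm_base] of degree 0 in the a_i by a1
    a2 a3, so that the two trace formulas below become polynomial identities. *)
Let baseE : base = comm_base a1 a2 a3 (B i0 i0) (B i1 i1) (B i2 i2)
  (adj3 B i0 i0) (adj3 B i1 i1) (adj3 B i2 i2)
  + (a1 * a2 * a3 - 1) * (B i0 i0 * adj3 B i0 i0 + B i1 i1 * adj3 B i1 i1
      + B i2 i2 * adj3 B i2 i2).
Proof. by rewrite a123 subrr mul0r addr0. Qed.

Lemma tr_commutator :
  \tr (diag3 a1 a2 a3 *m B *m diag3 (a2 * a3) (a1 * a3) (a1 * a2) *m adj3 B) =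
  base + twist a1 a2 a3 * cyc + twist' a1 a2 a3 * cyc'.
Proof.
rewrite tr_comm_diag3 baseE /comm_base /twist /twist' /cyc /cyc' !mxE /=; ring.
Qed.

Lemma tr_commutator' :
  \tr (B *m diag3 a1 a2 a3 *m adj3 B *m diag3 (a2 * a3) (a1 * a3) (a1 * a2)) =
  base + twist' a1 a2 a3 * cyc + twist a1 a2 a3 * cyc'.
Proof.
rewrite mxtrace_mulC !mulmxA tr_comm_diag3 baseE.
rewrite /comm_base /twist /twist' /cyc /cyc' !mxE /=; ring.
Qed.

End Commutator.

End Matrices3.

(** * Traces of pairs of matrices *)

Section Coordinates.
Variable R : realType.
Local Notation C := R[i].
Local Notation "f .[: g ]" := (\val f g) (at level 2, format "f .[:  g ]").

Definition coord_word : 'I_8 -> seq letter :=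
  pt8 [:: x1] [:: inv_letter x1] [:: x2] [:: inv_letter x2] [:: x1; x2]
    [:: inv_letter x2; inv_letter x1] [:: x1; inv_letter x2]
    [:: x2; inv_letter x1].

Definition comm_word : seq letter :=
  [:: x1; x2; inv_letter x1; inv_letter x2].

Definition tc (i : 'I_8) : char_ring R := trace_word R (coord_word i).
Definition tcomm : char_ring R := trace_word R comm_word.
Definition tcomm' : char_ring R := trace_word R (inv_word comm_word).

Definition PE (p : pexp C) : char_ring R :=
  @pev C (char_ring R) (fun c => (c%:A : char_ring R)) tc p.

Definition tg (g : rep2 R) : 'I_8 -> C := fun i => (tc i).[: g].

Lemma char_valD (f1 f2 : char_ring R) g : (f1 + f2).[: g] = f1.[: g] + f2.[: g].
Proof. by []. Qed.

Lemma char_valM (f1 f2 : char_ring R) g : (f1 * f2).[: g] = f1.[: g] * f2.[: g].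
Proof. by []. Qed.

Lemma char_valN (f : char_ring R) g : (- f).[: g] = - f.[: g].
Proof. by []. Qed.

Lemma char_valA (c : C) g : (c%:A : char_ring R).[: g] = c.
Proof. exact: mulr1. Qed.

Lemma PE_val p g : (PE p).[: g] = ev (tg g) p.
Proof.
elim: p => [c|k|p IHp q IHq|p IHp q IHq].
- exact: char_valA.
- by [].
- by rewrite evD -IHp -IHq; exact: char_valD.
- by rewrite evM -IHp -IHq; exact: char_valM.
Qed.

Lemma PEC c : PE (PCst c) = c%:A. Proof. by []. Qed.
Lemma PEX i : PE (PVar C i) = tc i. Proof. by []. Qed.
Lemma PED p q : PE (PAdd p q) = PE p + PE q. Proof. by []. Qed.
Lemma PEM p q : PE (PMul p q) = PE p * PE q. Proof. by []. Qed.

Lemma char_ring_ext (f1 f2 : char_ring R) :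
  (forall g, f1.[: g] = f2.[: g]) -> f1 = f2.
Proof. by move=> e; apply: val_inj; apply/funext. Qed.

Lemma char_ring_conj (f : char_ring R) g g' : conjugate g g' -> f.[: g] = f.[: g'].
Proof. by have /asboolP[_] := valP f; apply. Qed.

Lemma trace_wordE w (g : rep2 R) : (trace_word R w).[: g] = \tr (rep_word g w).
Proof. by []. Qed.

Lemma rep_word_cons (g : rep2 R) l w :
  rep_word g (l :: w) = rep_letter g l *m rep_word g w.
Proof. by rewrite /rep_word big_cons. Qed.

Lemma rep_word_nil (g : rep2 R) : rep_word g [::] = 1%:M.
Proof. by rewrite /rep_word big_nil. Qed.

Lemma rep_det1 (g : rep2 R) : \det (val g).1 = 1.
Proof. by have /andP[/eqP] := valP g. Qed.

Lemma rep_det2 (g : rep2 R) : \det (val g).2 = 1.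
Proof. by have /andP[_ /eqP] := valP g. Qed.

Lemma tg0 g : tg g o0 = \tr ((val g).1).
Proof. by rewrite /tg /tc trace_wordE !rep_word_cons rep_word_nil mulmx1. Qed.

Lemma tg1 g : tg g o1 = \tr (invmx (val g).1).
Proof. by rewrite /tg /tc trace_wordE !rep_word_cons rep_word_nil mulmx1. Qed.

Lemma tg2 g : tg g o2 = \tr ((val g).2).
Proof. by rewrite /tg /tc trace_wordE !rep_word_cons rep_word_nil mulmx1. Qed.

Lemma tg3 g : tg g o3 = \tr (invmx (val g).2).
Proof. by rewrite /tg /tc trace_wordE !rep_word_cons rep_word_nil mulmx1. Qed.

Lemma tg4 g : tg g o4 = \tr ((val g).1 *m (val g).2).
Proof. by rewrite /tg /tc trace_wordE !rep_word_cons rep_word_nil mulmx1. Qed.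

Lemma tg5 g : tg g o5 = \tr (invmx (val g).2 *m invmx (val g).1).
Proof. by rewrite /tg /tc trace_wordE !rep_word_cons rep_word_nil mulmx1. Qed.

Lemma tg6 g : tg g o6 = \tr ((val g).1 *m invmx (val g).2).
Proof. by rewrite /tg /tc trace_wordE !rep_word_cons rep_word_nil mulmx1. Qed.

Lemma tg7 g : tg g o7 = \tr ((val g).2 *m invmx (val g).1).
Proof. by rewrite /tg /tc trace_wordE !rep_word_cons rep_word_nil mulmx1. Qed.

Lemma tcommE g : tcomm.[: g] =
  \tr ((val g).1 *m (val g).2 *m invmx (val g).1 *m invmx (val g).2).
Proof.
by rewrite /tcomm trace_wordE !rep_word_cons rep_word_nil mulmx1 !mulmxA.
Qed.

Lemma tcomm'E g : tcomm'.[: g] =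
  \tr ((val g).2 *m (val g).1 *m invmx (val g).2 *m invmx (val g).1).
Proof.
rewrite /tcomm' trace_wordE.
have -> : inv_word comm_word = [:: x2; x1; inv_letter x2; inv_letter x1] by [].
by rewrite !rep_word_cons rep_word_nil mulmx1 !mulmxA.
Qed.

Lemma mkrep_subproof (A B : 'M[C]_3) : \det A = 1 -> \det B = 1 ->
  (\det (A, B).1 == 1) && (\det (A, B).2 == 1).
Proof. by move=> /= -> ->; rewrite eqxx. Qed.

Definition mkrep (A B : 'M[C]_3) (dA : \det A = 1) (dB : \det B = 1) : rep2 R :=
  exist _ (A, B) (mkrep_subproof dA dB).

Section DiagonalFrame.
Variables (g : rep2 R) (a1 a2 a3 : C).
Hypothesis gA : (val g).1 = diag3 a1 a2 a3.
Let B := (val g).2.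

Lemma frame_det : a1 * a2 * a3 = 1.
Proof. by rewrite -(rep_det1 g) gA det_diag3. Qed.

Lemma tg_diag : tg g =1 frame_pt a1 a2 a3 (B i0 i0) (B i1 i1) (B i2 i2)
  (adj3 B i0 i0) (adj3 B i1 i1) (adj3 B i2 i2).
Proof.
have a123 := frame_det.
apply: ord8_ind.
- by rewrite tg0 gA tr_diag3.
- by rewrite tg1 gA invmx_diag3 // tr_diag3.
- by rewrite tg2 tr3.
- by rewrite tg3 invmx3 ?rep_det2 // tr3.
- by rewrite tg4 gA tr_diag3_mul.
- by rewrite tg5 gA invmx_diag3 // mxtrace_mulC invmx3 ?rep_det2 // tr_diag3_mul.
- by rewrite tg6 gA invmx3 ?rep_det2 // tr_diag3_mul.
- by rewrite tg7 gA invmx_diag3 // mxtrace_mulC tr_diag3_mul.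
Qed.

Let base := comm_base a1 a2 a3 (B i0 i0) (B i1 i1) (B i2 i2)
  (adj3 B i0 i0) (adj3 B i1 i1) (adj3 B i2 i2).

Lemma tcomm_diag :
  tcomm.[: g] = base + twist a1 a2 a3 * cyc B + twist' a1 a2 a3 * cyc' B.
Proof.
have a123 := frame_det.
by rewrite tcommE gA invmx_diag3 // (invmx3 (rep_det2 g)) tr_commutator.
Qed.

Lemma tcomm'_diag :
  tcomm'.[: g] = base + twist' a1 a2 a3 * cyc B + twist a1 a2 a3 * cyc' B.
Proof.
have a123 := frame_det.
by rewrite tcomm'E gA invmx_diag3 // (invmx3 (rep_det2 g)) tr_commutator'.
Qed.

Lemma tcommD_diag : tcomm.[: g] + tcomm'.[: g] = ev (tg g) (Psum C).
Proof.
rewrite (eq_ev _ tg_diag) (Psum_frame _ _ _ _ _ _ frame_det) cycle_sum_mx ?rep_det2 //.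
by rewrite tcomm_diag tcomm'_diag /base; ring.
Qed.

Lemma tcommB_diag : (tcomm.[: g] - tcomm'.[: g]) ^+ 2 = ev (tg g) (Pdisc C).
Proof.
rewrite (eq_ev _ tg_diag) (Pdisc_frame _ _ _ _ _ _ frame_det).
rewrite cycle_sum_mx ?rep_det2 // cycle_prod_mx tcomm_diag tcomm'_diag.
have -> : vandermonde a1 a2 a3 ^+ 2 = (twist a1 a2 a3 - twist' a1 a2 a3) ^+ 2.
  by rewrite twistB sqrrN.
by ring.
Qed.

Lemma disc1_diag : ev (tg g) (disc1 C) = vandermonde a1 a2 a3 ^+ 2.
Proof. by rewrite (eq_ev _ tg_diag) disc1_frame // frame_det. Qed.

End DiagonalFrame.

Lemma tg_conj g g' : conjugate g g' -> tg g =1 tg g'.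
Proof. by move=> gg' i; exact: char_ring_conj. Qed.

Lemma disc1_tg g : let X := (val g).1 in ev (tg g) (disc1 C) =
  \tr X ^+ 2 * \tr (invmx X) ^+ 2 - 4 * \tr X ^+ 3 - 4 * \tr (invmx X) ^+ 3
  + 18 * (\tr X * \tr (invmx X)) - 27.
Proof. by rewrite /= disc1.unlock /ev /cubic_disc /= tg0 tg1; ring. Qed.

End Coordinates.

#[global] Opaque PE tcomm tcomm'.

(** * Density of the pairs whose first matrix has distinct eigenvalues *)

Section Density.
Variable R : realType.
Local Notation C := R[i].
Local Notation "f .[: g ]" := (\val f g) (at level 2, format "f .[:  g ]").

Lemma trace_conj n (F : fieldType) (P X : 'M[F]_n) : P \in unitmx ->
  \tr (invmx P *m X *m P) = \tr X.
Proof. by move=> uP; rewrite mxtrace_mulC mulmxA mulmxV // mul1mx. Qed.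

Lemma invmx_conj n (F : fieldType) (P X : 'M[F]_n) : P \in unitmx ->
  X \in unitmx -> invmx (invmx P *m X *m P) = invmx P *m invmx X *m P.
Proof.
move=> uP uX.
have H : invmx P *m X *m P *m (invmx P *m invmx X *m P) = 1%:M.
  by rewrite !mulmxA mulmxK // mulmxK // mulVmx.
have [uY _] := mulmx1_unit H.
by rewrite -[LHS]mulmx1 -H mulKmx.
Qed.

Lemma triangular_conj (F : numClosedFieldType) (A : 'M[F]_3) :
  exists P T : 'M[F]_3, [/\ P \in unitmx, A = invmx P *m T *m P,
    T i0 i1 = 0, T i0 i2 = 0 & T i1 i2 = 0].
Proof.
have [P Punit] := @spectral.Schur F 3 A isT.
move=> trig; exists P, (conjmx P A).
have uP : P \in unitmx by exact: spectral.unitarymx_unit.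
split => //; first by rewrite conjumx // !mulmxA mulVmx // mul1mx mulmxKV.
- by have /is_trig_mxP -> := trig.
- by have /is_trig_mxP -> := trig.
- by have /is_trig_mxP -> := trig.
Qed.

(** Since det (A K^3) = (det K)^3, dividing A K^3 by the scalar det K restores determinant 1
    rationally. In a basis where A is triangular K is taken diagonal, with cubes chosen to make the
    diagonal of A K^3 equal to 1, 2, 4, so that the eigenvalues are distinct. *)
Lemma regular_semisimple_multiple (F : numClosedFieldType) (A : 'M[F]_3) :
  \det A = 1 -> exists K : 'M[F]_3, \det K != 0 /\
    let X := (\det K)^-1 *: (A *m (K *m K *m K)) in
    \tr X ^+ 2 * \tr (invmx X) ^+ 2 - 4 * \tr X ^+ 3 - 4 * \tr (invmx X) ^+ 3
    + 18 * (\tr X * \tr (invmx X)) - 27 != 0.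
Proof.
move=> dA; have [P [T [uP AE T01 T02 T12]]] := triangular_conj A.
have dP : \det P != 0 by rewrite -unitfE -unitmxE.
have dT : T i0 i0 * T i1 i1 * T i2 i2 = 1.
  transitivity (\det T); first by rewrite det3 T01 T02 T12; ring.
  by rewrite -dA AE !det_mulmx det_inv mulrC mulrA divff ?mul1r.
have T_neq0 : [/\ T i0 i0 != 0, T i1 i1 != 0 & T i2 i2 != 0].
  split; apply/eqP => T0; move: dT; rewrite T0 ?(mulr0, mul0r) => /eqP;
  by rewrite eq_sym oner_eq0.
case: T_neq0 => T0 T1 T2.
pose k1 := 3.-root (T i0 i0)^-1.
pose k2 := 3.-root (2 / T i1 i1).
pose k3 := 3.-root (4 / T i2 i2).
have k1E : k1 ^+ 3 = (T i0 i0)^-1 by rewrite rootCK.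
have k2E : k2 ^+ 3 = 2 / T i1 i1 by rewrite rootCK.
have k3E : k3 ^+ 3 = 4 / T i2 i2 by rewrite rootCK.
pose D := diag3 k1 k2 k3.
pose K := invmx P *m D *m P.
pose kk := k1 * k2 * k3.
have kk3 : kk ^+ 3 = 8.
  rewrite /kk !exprMn k1E k2E k3E.
  transitivity (8 * (T i0 i0 * T i1 i1 * T i2 i2)^-1); last by rewrite dT invr1 mulr1.
  by field; rewrite T0 T1 T2.
have kk_neq0 : kk != 0.
  by apply/eqP => k0; move: kk3; rewrite k0 expr0n /= => /eqP; rewrite eq_sym pnatr_eq0.
have dK : \det K = kk.
  by rewrite /K !det_mulmx det_inv det_diag3 mulrC mulrA divff ?mul1r.
exists K; split; first by rewrite dK.
rewrite dK /=; set X := _ *: _.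
pose Y := kk^-1 *: (T *m (D *m D *m D)).
have XE : X = invmx P *m Y *m P.
  rewrite /X /Y AE /K -scalemxAr -scalemxAl; congr (_ *: _).
  by rewrite !mulmxA !mulmxK.
have dY : \det Y = 1.
  rewrite detZ !det_mulmx det_diag3 -/kk.
  transitivity (kk ^- 3 * \det T * kk ^+ 3); first by rewrite exprVn; ring.
  rewrite det3 T01 T02 T12.
  transitivity (kk ^- 3 * (T i0 i0 * T i1 i1 * T i2 i2) * kk ^+ 3); first by ring.
  by rewrite dT mulr1 mulVf // expf_neq0.
have uY : Y \in unitmx by rewrite unitmxE dY unitr1.
rewrite XE invmx_conj // !trace_conj // invmx3 //.
have Y01 : Y i0 i1 = 0 by rewrite /Y !mxE !sum3 !mxE !sum3 !mxE !sum3 !mxE /= T01 T02; ring.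
have Y02 : Y i0 i2 = 0 by rewrite /Y !mxE !sum3 !mxE !sum3 !mxE !sum3 !mxE /= T01 T02; ring.
have Y12 : Y i1 i2 = 0 by rewrite /Y !mxE !sum3 !mxE !sum3 !mxE !sum3 !mxE /= T12; ring.
have Y0 : Y i0 i0 = kk^-1.
  transitivity (kk^-1 * (T i0 i0 * k1 ^+ 3)); last by rewrite k1E divff ?mulr1.
  by rewrite /Y !mxE !sum3 !mxE !sum3 !mxE !sum3 !mxE /=; ring.
have Y1 : Y i1 i1 = 2 * kk^-1.
  transitivity (kk^-1 * (T i1 i1 * k2 ^+ 3)); last by rewrite k2E; field; rewrite kk_neq0.
  by rewrite /Y !mxE !sum3 !mxE !sum3 !mxE !sum3 !mxE /=; ring.
have Y2 : Y i2 i2 = 4 * kk^-1.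
  transitivity (kk^-1 * (T i2 i2 * k3 ^+ 3)); last by rewrite k3E; field; rewrite kk_neq0.
  by rewrite /Y !mxE !sum3 !mxE !sum3 !mxE !sum3 !mxE /=; ring.
clearbody Y; rewrite !tr3 !mxE /= Y01 Y02 Y12 Y0 Y1 Y2.
set w := kk^-1.
have w3 : w ^+ 3 = 8^-1 by rewrite /w exprVn kk3.
(* The discriminant for p = 7 w and q = 14 w^2, the elementary symmetric functions of w, 2 w, 4 w.
   Its value 9 / 16 is the square of (1 - 2) (1 - 4) (2 - 4) / 8. *)
rewrite (_ : _ - 27 = - 1372 * (w ^+ 3) ^+ 2 + 392 * w ^+ 3 - 27); last by ring.
rewrite w3 (_ : _ - 27 = 9 / 16); last by field.
by rewrite mulf_neq0 ?invr_eq0 // pnatr_eq0.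
Qed.

Definition pathK (M : 'M[C]_3) (z : C) : 'M[C]_3 := 1%:M + z *: M.

Lemma pathK_poly (M : 'M[C]_3) : exists Kp : 'M[{poly C}]_3,
  forall z, pathK M z = map_mx (fun q : {poly C} => q.[z]) Kp.
Proof.
exists (\matrix_(i, j) (((1%:M : 'M[C]_3) i j)%:P + 'X * (M i j)%:P)) => z.
by apply/matrixP => i j; rewrite !mxE !hornerE mulrC mulrC.
Qed.

(* Along A K(z)^3 / det K(z), which stays in SL(3, C), a regular function is
   rational in z. *)
Lemma regular_path (g : rep2 R) (M : 'M[C]_3) (f : rep2 R -> C) :
  regular_function f -> exists (n : nat) (q : {poly C}), forall (z : C) (g' : rep2 R),
    let K := pathK M z in \det K != 0 ->
    (val g').1 = (\det K)^-1 *: ((val g).1 *m (K *m K *m K)) ->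
    (val g').2 = (val g).2 -> f g' * \det K ^+ n = q.[z].
Proof.
have [Kp KE] := pathK_poly M.
have detE z : \det (pathK M z) = (\det Kp).[z].
  by rewrite KE -[RHS]/(horner_eval z _) -det_map_mx.
elim=> [c|i j|i j|f1 f2 _ [n1 [q1 H1]] _ [n2 [q2 H2]]|f1 f2 _ [n1 [q1 H1]] _ [n2 [q2 H2]]].
- by exists 0%N, c%:P => z g' K _ _ _; rewrite mulr1 hornerC.
- exists 1%N, ((map_mx polyC (val g).1 *m (Kp *m Kp *m Kp)) i j) => z g' K K0 -> _.
  rewrite mxE mulrC expr1 mulVKf //.
  transitivity (map_mx (horner_eval z)
    (map_mx polyC (val g).1 *m (Kp *m Kp *m Kp)) i j); last by rewrite mxE.
  rewrite !map_mxM.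
  congr ((_ *m _) i j).
    by apply/matrixP => ? ?; rewrite !mxE /= /horner_eval hornerC.
  by rewrite /K KE.
- by exists 0%N, ((val g).2 i j)%:P => z g' K K0 _ ->; rewrite mulr1 hornerC.
- exists (n1 + n2)%N, (q1 * (\det Kp) ^+ n2 + q2 * (\det Kp) ^+ n1) => z g' K K0 e1 e2.
  rewrite hornerD !hornerM !horner_exp -(H1 _ _ K0 e1 e2) -(H2 _ _ K0 e1 e2).
  by rewrite -detE -/K exprD; ring.
- exists (n1 + n2)%N, (q1 * q2) => z g' K K0 e1 e2.
  by rewrite hornerM -(H1 _ _ K0 e1 e2) -(H2 _ _ K0 e1 e2) exprD; ring.
Qed.

Lemma char_ring_regular (f : char_ring R) : regular_function (\val f).
Proof. by have /asboolP[] := valP f. Qed.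

(** The path A K(z)^3 / det K(z) starts at [g] for z = 0 and has distinct eigenvalues at z = 1.
    Along it f and [disc1] become polynomials q and r after multiplication by powers of det K(z).
    Their product vanishes while r is nonzero, so q = 0, and f(g) = q(0). *)
Lemma disc1_dense (f : char_ring R) :
  (forall g, ev (tg g) (disc1 C) != 0 -> f.[: g] = 0) -> f = 0.
Proof.
move=> f0; apply: char_ring_ext => g; rewrite [RHS]/(0 : C).
have [K1 [dK1 D1]] := regular_semisimple_multiple (rep_det1 g).
pose M := K1 - 1%:M.
have [Kp KE] := pathK_poly M.
have detE z : \det (pathK M z) = (\det Kp).[z].
  by rewrite KE -[RHS]/(horner_eval z _) -det_map_mx.
have K_1 : pathK M 1 = K1 by rewrite /pathK scale1r /M addrC subrK.
have K_0 : pathK M 0 = 1%:M by rewrite /pathK scale0r addr0.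
have [n [q qE]] := regular_path g M (char_ring_regular f).
have [m [r rE]] := regular_path g M (char_ring_regular (PE (disc1 C))).
have path_rep z : \det (pathK M z) != 0 -> exists g' : rep2 R,
    (val g').1 = (\det (pathK M z))^-1 *: ((val g).1 *m (pathK M z *m pathK M z *m pathK M z))
    /\ (val g').2 = (val g).2.
  move=> dK; set A := _ *: _.
  have dA : \det A = 1.
    rewrite /A detZ !det_mulmx rep_det1 mul1r -!expr2 exprVn.
    by rewrite -exprSr mulVf // expf_neq0.
  by exists (mkrep dA (rep_det2 g)).
(* The factor [\det Kp] covers the parameters at which the path is not defined. *)
have /poly_fun_eq0 qr0 : forall z, (q * r * \det Kp).[z] = 0.
  move=> z; rewrite !hornerM -detE.
  have [->|dK] := eqVneq (\det (pathK M z)) 0; first by rewrite mulr0.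
  have [g' [e1 e2]] := path_rep z dK.
  rewrite -(qE _ _ dK e1 e2) -(rE _ _ dK e1 e2) PE_val.
  have [->|/f0->] := eqVneq (ev (tg g') (disc1 C)) 0; by rewrite !(mulr0, mul0r).
have dKp : \det Kp != 0.
  by apply/eqP => K0; move: dK1; rewrite -K_1 detE K0 horner0 eqxx.
have r_neq0 : r != 0.
  have dK : \det (pathK M 1) != 0 by rewrite K_1.
  have [g' [e1 e2]] := path_rep 1 dK.
  apply/eqP => r0; have := rE _ _ dK e1 e2.
  rewrite r0 horner0 PE_val disc1_tg e1 => /eqP.
  rewrite mulf_eq0 expf_eq0 (negPf dK) andbF orbF K_1 => D0.
  by case/negP: D1; exact: D0.
have q0 : q = 0.
  by apply/eqP; move/eqP: qr0; rewrite !mulf_eq0 (negPf r_neq0) (negPf dKp) !orbF.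
have d0 : \det (pathK M 0) = 1 by rewrite K_0 det1.
have := qE 0 g; rewrite /= d0 q0 horner0 expr1n mulr1; apply.
- exact: oner_neq0.
- by rewrite K_0 invr1 scale1r !mulmx1.
- by [].
Qed.

End Density.

(** * The quadratic relation for the trace of the commutator, and two symmetries *)

Section Relations.
Variable R : realType.
Local Notation C := R[i].
Local Notation "f .[: g ]" := (\val f g) (at level 2, format "f .[:  g ]").

Lemma normalized_conj (F : numClosedFieldType) (h : 'M[F]_3) : h \in unitmx ->
  exists2 k : 'M[F]_3, \det k = 1 &
    forall X, k *m X *m invmx k = h *m X *m invmx h.
Proof.
move=> uh; have dh : \det h != 0 by rewrite -unitfE -unitmxE.
pose t := 3.-root (\det h)^-1.
have t3 : t ^+ 3 = (\det h)^-1 by rewrite rootCK.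
have t_neq0 : t != 0.
  by apply/eqP => t0; move/eqP: t3; rewrite t0 expr0n /= eq_sym invr_eq0 (negPf dh).
exists (t *: h); first by rewrite detZ t3 mulVf.
move=> X; have -> : invmx (t *: h) = t^-1 *: invmx h.
  apply: mulmx_invmx.
  by rewrite -scalemxAl -scalemxAr scalerA mulfV // scale1r mulmxV.
by rewrite -!scalemxAl -scalemxAr scalerA mulfV // scale1r.
Qed.

Lemma diagonalize_distinct (F : numClosedFieldType) (A : 'M[F]_3) : \det A = 1 ->
  \tr A ^+ 2 * \tr (invmx A) ^+ 2 - 4 * \tr A ^+ 3 - 4 * \tr (invmx A) ^+ 3
    + 18 * (\tr A * \tr (invmx A)) - 27 != 0 ->
  exists (k : 'M[F]_3) a1 a2 a3,
    \det k = 1 /\ k *m A *m invmx k = diag3 a1 a2 a3.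
Proof.
move=> dA; have [P [T [uP AE T01 T02 T12]]] := triangular_conj A.
have dT : \det T = 1.
  have dP : \det P != 0 by rewrite -unitfE -unitmxE.
  by rewrite -dA AE !det_mulmx det_inv mulrC mulrA divff ?mul1r.
have uT : T \in unitmx by rewrite unitmxE dT unitr1.
rewrite AE invmx_conj // !trace_conj // invmx3 // !tr3 !mxE /= T01 T02 T12.
rewrite det3 T01 T02 T12 in dT.
(* Writing 1 as (det T)^2 makes the constant term of degree 6 in the diagonal of T; the expression
   is then the squared Vandermonde up to a multiple of the product of the diagonal minus 1. *)
have -> : 27 = 27 * (T i0 i0 * (T i1 i1 * T i2 i2 - 0 * T i2 i1) -
  0 * (T i1 i0 * T i2 i2 - 0 * T i2 i0) + 0 * (T i1 i0 * T i2 i1 - T i1 i1 * T i2 i0)) ^+ 2.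
  by rewrite dT expr1n mulr1.
set X := (X in X != 0 -> _).
have XE : X = vandermonde (T i0 i0) (T i1 i1) (T i2 i2) ^+ 2
    + (T i0 i0 * T i1 i1 * T i2 i2 - 1) *
      (4 * (T i0 i0 + T i1 i1 + T i2 i2) ^+ 3
       - 18 * (T i0 i0 + T i1 i1 + T i2 i2)
         * (T i1 i1 * T i2 i2 + T i0 i0 * T i2 i2 + T i0 i0 * T i1 i1)).
  by rewrite /X /vandermonde; ring.
have -> : X = vandermonde (T i0 i0) (T i1 i1) (T i2 i2) ^+ 2.
  have e : T i0 i0 * T i1 i1 * T i2 i2 = 1 by rewrite -dT; ring.
  by rewrite XE e subrr mul0r addr0.
rewrite expf_eq0 /= /vandermonde !mulf_eq0 !negb_or !subr_eq0.
move=> /andP[/andP[t01 t02] t12].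
have Ttrig : is_trig_mx T.
  apply/is_trig_mxP; elim/ord3_ind; elim/ord3_ind => //.
have [Q uQ QT] : diagonalizable T.
  apply/diagonalizableP; exists [:: T i0 i0; T i1 i1; T i2 i2].
    by rewrite /= !inE negb_or t01 t02 t12.
  rewrite !big_cons big_nil mulr1 mulrA.
  by have := mxminpoly_dvd_char T; rewrite char_poly_trig // prod3.
have [d /(simmxRL uQ) QE] := @diagonalizable_forPex _ _ _ Q T QT.
have uh : Q *m P \in unitmx by rewrite unitmx_mul uQ.
have [k dk kE] := normalized_conj uh.
exists k, (d 0 i0), (d 0 i1), (d 0 i2); split => //.
rewrite -AE kE {1}AE.
have -> : invmx (Q *m P) = invmx P *m invmx Q.
  by apply: mulmx_invmx; rewrite mulmxA mulmxK // mulmxV.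
rewrite !mulmxA mulmxK // mulmxK // -QE.
by apply: mx3P; rewrite !mxE.
Qed.

Lemma diag_frame (g : rep2 R) : ev (tg g) (disc1 C) != 0 ->
  exists g' a1 a2 a3, [/\ conjugate g g', (val g').1 = diag3 a1 a2 a3 &
    vandermonde a1 a2 a3 != 0].
Proof.
move=> D; have := D; rewrite disc1_tg.
move=> /(diagonalize_distinct (rep_det1 g))[k [a1 [a2 [a3 [dk kE]]]]].
have dk0 : \det k != 0 by rewrite dk oner_neq0.
have conj_det X : \det X = 1 -> \det (k *m X *m invmx k) = 1.
  by move=> dX; rewrite !det_mulmx det_inv dk dX invr1 !mulr1.
pose g' := mkrep (conj_det _ (rep_det1 g)) (conj_det _ (rep_det2 g)).
have gg' : conjugate g g' by exists k.
exists g', a1, a2, a3; split => //.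
move: D; rewrite (eq_ev _ (tg_conj gg')) (@disc1_diag _ g' a1 a2 a3) //.
by rewrite expf_eq0.
Qed.

(** Both sides are invariant, so by density and conjugation they need only be compared where the
    first matrix is diagonal. *)
Lemma tcommD : tcomm R + tcomm' R = PE (Psum C).
Proof.
apply/eqP; rewrite -subr_eq0; apply/eqP/disc1_dense => g /diag_frame.
move=> [g' [a1 [a2 [a3 [gg' gE _]]]]].
rewrite (char_ring_conj _ gg') char_valD char_valN char_valD PE_val.
by rewrite (tcommD_diag gE) subrr.
Qed.

Lemma tcommB : (tcomm R - tcomm' R) ^+ 2 = PE (Pdisc C).
Proof.
apply/eqP; rewrite -subr_eq0; apply/eqP/disc1_dense => g /diag_frame.
move=> [g' [a1 [a2 [a3 [gg' gE _]]]]].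
rewrite (char_ring_conj _ gg') char_valD char_valN expr2 char_valM char_valD char_valN PE_val.
by rewrite -expr2 (tcommB_diag gE) subrr.
Qed.

Lemma tcomm'_val (g : rep2 R) : (tcomm' R).[: g] = ev (tg g) (Psum C) - (tcomm R).[: g].
Proof.
by rewrite -PE_val -tcommD char_valD addrC addKr.
Qed.

(** The equations t' = P - t and (t - t')^2 = P^2 - 4 Q give the relation multiplied by 4. *)
Lemma tcomm_rel_val (g : rep2 R) : (tcomm R).[: g] ^+ 2 =
  ev (tg g) (Psum C) * (tcomm R).[: g] - ev (tg g) (Pprod C).
Proof.
set t := (tcomm R).[: g]; set P := ev _ _; set Q := ev _ _.
have : (t - (P - t)) ^+ 2 = P ^+ 2 - 4 * Q.
  transitivity (ev (tg g) (Pdisc C)); last first.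
    by rewrite Pdisc.unlock evD !evM !evC -/P -/Q; ring.
  by rewrite -PE_val -tcommB expr2 char_valM char_valD char_valN tcomm'_val -expr2.
move=> e; apply: (mulfI (_ : 4 != 0 :> C)); first by rewrite pnatr_eq0.
transitivity ((t - (P - t)) ^+ 2 + 4 * P * t - P ^+ 2); first by ring.
by rewrite e; ring.
Qed.

Lemma tcomm_rel : tcomm R * tcomm R = PE (Psum C) * tcomm R - PE (Pprod C).
Proof.
apply: char_ring_ext => g.
rewrite char_valD (char_valN (PE _)) (char_valM (PE _)) (char_valM (tcomm R)).
by rewrite !PE_val -tcomm_rel_val expr2.
Qed.

(** Transposing both matrices reverses words: the eight traces are kept, while the traces of the
    commutator and of its inverse are exchanged. This reaches the second value of t over the same
    s1, ..., s8. *)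
Lemma transpose_rep (g : rep2 R) : exists g' : rep2 R,
  tg g' =1 tg g /\ (tcomm R).[: g'] = (tcomm' R).[: g].
Proof.
have dA : \det (val g).1^T = 1 by rewrite det_tr rep_det1.
have dB : \det (val g).2^T = 1 by rewrite det_tr rep_det2.
exists (mkrep dA dB); split.
  apply: ord8_ind.
  - by rewrite !tg0 mxtrace_tr.
  - by rewrite !tg1 -trmx_inv mxtrace_tr.
  - by rewrite !tg2 mxtrace_tr.
  - by rewrite !tg3 -trmx_inv mxtrace_tr.
  - by rewrite !tg4 -trmx_mul mxtrace_tr mxtrace_mulC.
  - by rewrite !tg5 -!trmx_inv -trmx_mul mxtrace_tr mxtrace_mulC.
  - by rewrite !tg6 -trmx_inv -trmx_mul mxtrace_tr mxtrace_mulC.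
  - by rewrite !tg7 -trmx_inv -trmx_mul mxtrace_tr mxtrace_mulC.
rewrite tcommE tcomm'E /= -!trmx_inv -!trmx_mul mxtrace_tr.
by rewrite mulmxA mxtrace_mulC !mulmxA.
Qed.

Definition swap_rep (g : rep2 R) : rep2 R := mkrep (rep_det2 g) (rep_det1 g).

Definition swap_coord : 'I_8 -> 'I_8 := pt8 o2 o3 o0 o1 o4 o5 o7 o6.

Lemma tg_swap g : tg (swap_rep g) =1 tg g \o swap_coord.
Proof.
apply: ord8_ind.
- by rewrite tg0; exact: esym (tg2 g).
- by rewrite tg1; exact: esym (tg3 g).
- by rewrite tg2; exact: esym (tg0 g).
- by rewrite tg3; exact: esym (tg1 g).
- by rewrite tg4 mxtrace_mulC; exact: esym (tg4 g).
- by rewrite tg5 mxtrace_mulC; exact: esym (tg5 g).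
- by rewrite tg6; exact: esym (tg7 g).
- by rewrite tg7; exact: esym (tg6 g).
Qed.

Lemma tcomm_swap g : (tcomm R).[: swap_rep g] = (tcomm' R).[: g].
Proof. by rewrite tcommE tcomm'E. Qed.

Lemma swap_char_subproof (f : char_ring R) :
  (fun g => f.[: swap_rep g]) \in @regular_invariant R.
Proof.
apply/asboolP; split.
  have : regular_function (\val f) by exact: char_ring_regular.
  elim=> [c|i j|i j|f1 f2 _ IH1 _ IH2|f1 f2 _ IH1 _ IH2].
  - exact: RegCst.
  - exact: RegEntry2.
  - exact: RegEntry1.
  - exact: RegAdd.
  - exact: RegMul.
move=> g g' [h [dh e1 e2]]; apply: char_ring_conj.
by exists h.
Qed.

(** Exchanging the matrices turns [disc1] into [disc2] and t into t', which transfers results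
    obtained up to powers of [disc1] to [disc2]. *)
Definition swap_char (f : char_ring R) : char_ring R :=
  Sub (fun g => f.[: swap_rep g]) (swap_char_subproof f).

Lemma swap_charE f g : (swap_char f).[: g] = f.[: swap_rep g].
Proof. by []. Qed.

End Relations.

(** * Generation of the coordinate ring by traces *)

Section TraceAlgebra.
Variable R : realType.
Local Notation C := R[i].
Local Notation "f .[: g ]" := (\val f g) (at level 2, format "f .[:  g ]").

Definition tval (g : rep2 R) (p : pexp C * pexp C) : C :=
  ev (tg g) p.1 + ev (tg g) p.2 * (tcomm R).[: g].

Lemma tvalE g p q : tval g (p, q) = ev (tg g) p + ev (tg g) q * (tcomm R).[: g].
Proof. by []. Qed.

Definition in_traces (h : rep2 R -> C) : Prop :=
  exists p, forall g, h g = tval g p.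

Lemma in_traces_pexp p : in_traces (fun g => ev (tg g) p).
Proof. by exists (p, PCst 0) => g; rewrite /tval /= evC mul0r addr0. Qed.

Lemma in_traces_cst c : in_traces (fun=> c).
Proof. exact: in_traces_pexp (PCst c). Qed.

Lemma in_traces_coord i : in_traces (fun g => tg g i).
Proof. exact: in_traces_pexp (PVar C i). Qed.

Lemma in_traces_comm : in_traces (fun g => (tcomm R).[: g]).
Proof. by exists (PCst 0, PCst 1) => g; rewrite /tval /= !evC mul1r add0r. Qed.

Lemma in_tracesD h1 h2 : in_traces h1 -> in_traces h2 ->
  in_traces (fun g => h1 g + h2 g).
Proof.
move=> [p pE] [q qE]; exists (PAdd p.1 q.1, PAdd p.2 q.2) => g.
by rewrite pE qE /tval /= !evD mulrDl addrACA.
Qed.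

Lemma tvalM (F : comNzRingType) (p1 p2 q1 q2 t P Q : F) : t ^+ 2 = P * t - Q ->
  (p1 + p2 * t) * (q1 + q2 * t) =
  p1 * q1 + -1 * (p2 * q2 * Q) + (p1 * q2 + p2 * q1 + p2 * q2 * P) * t.
Proof.
move=> rel; transitivity (p1 * q1 + (p1 * q2 + p2 * q1) * t + p2 * q2 * t ^+ 2).
  by ring.
by rewrite rel; ring.
Qed.

Lemma in_tracesM h1 h2 : in_traces h1 -> in_traces h2 ->
  in_traces (fun g => h1 g * h2 g).
Proof.
move=> [[p1 p2] pE] [[q1 q2] qE].
exists ((p1 * q1 - p2 * q2 * Pprod C)%P,
  (p1 * q2 + p2 * q1 + p2 * q2 * Psum C)%P) => g.
rewrite pE qE !tvalE (tvalM _ _ _ _ (tcomm_rel_val g)).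
by rewrite !(evD, evM, evC).
Qed.

(* Functions of the eigenvalues (a1, a2, a3) of the first matrix and of the
   representation that are polynomial in the eigenvalues and the traces. *)
Inductive eig_fun : (C -> C -> C -> rep2 R -> C) -> Prop :=
| EigA1 : eig_fun (fun a1 _ _ _ => a1)
| EigA2 : eig_fun (fun _ a2 _ _ => a2)
| EigA3 : eig_fun (fun _ _ a3 _ => a3)
| EigT h : in_traces h -> eig_fun (fun _ _ _ => h)
| EigD u v : eig_fun u -> eig_fun v ->
    eig_fun (fun a1 a2 a3 g => u a1 a2 a3 g + v a1 a2 a3 g)
| EigM u v : eig_fun u -> eig_fun v ->
    eig_fun (fun a1 a2 a3 g => u a1 a2 a3 g * v a1 a2 a3 g)
| EigE u v : eig_fun u -> (forall a1 a2 a3 g, u a1 a2 a3 g = v a1 a2 a3 g) ->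
    eig_fun v.

Lemma EigC c : eig_fun (fun _ _ _ _ => c).
Proof. exact: EigT (in_traces_cst c). Qed.

Lemma EigB u v : eig_fun u -> eig_fun v ->
  eig_fun (fun a1 a2 a3 g => u a1 a2 a3 g - v a1 a2 a3 g).
Proof.
move=> eu ev; apply: EigE (EigD eu (EigM (EigC (-1)) ev)) _ => *.
by rewrite mulN1r.
Qed.

Lemma EigX u n : eig_fun u -> eig_fun (fun a1 a2 a3 g => u a1 a2 a3 g ^+ n).
Proof.
move=> eu; elim: n => [|n IH]; first exact: EigC 1.
by apply: EigE (EigM eu IH) _ => *; rewrite exprS.
Qed.

Lemma EigV : eig_fun (fun a1 a2 a3 _ => vandermonde a1 a2 a3).
Proof. by do 2?[apply: EigM]; apply: EigB; constructor. Qed.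

Definition eig_of (a1 a2 a3 : C) (g : rep2 R) : Prop :=
  [/\ a1 * a2 * a3 = 1, tg g o0 = a1 + a2 + a3 &
      tg g o1 = a2 * a3 + a1 * a3 + a1 * a2].

Definition S3sum (u : C -> C -> C -> rep2 R -> C) a1 a2 a3 g : C :=
  u a1 a2 a3 g + u a1 a3 a2 g + u a2 a1 a3 g + u a2 a3 a1 g + u a3 a1 a2 g
  + u a3 a2 a1 g.

(** All monomial multiples of [u] are required at once, so that multiplying [u] by an eigenvalue
    preserves the property; the induction of [symmetrizableM] rests on this. *)
Definition symmetrizable (u : C -> C -> C -> rep2 R -> C) : Prop :=
  forall i j k, exists h, in_traces h /\ forall a1 a2 a3 g, eig_of a1 a2 a3 g ->
    S3sum (fun a1 a2 a3 g => a1 ^+ i * a2 ^+ j * a3 ^+ k * u a1 a2 a3 g) a1 a2 a3 g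
    = h g.

Lemma newton2 (F : comNzRingType) (a1 a2 a3 : F) : a1 ^+ 2 + a2 ^+ 2 + a3 ^+ 2 =
  (a1 + a2 + a3) * (a1 + a2 + a3) + -1 * (2 * (a2 * a3 + a1 * a3 + a1 * a2)).
Proof. ring. Qed.

(** Newton's recursion for power sums, the third elementary symmetric function being 1. *)
Lemma newton3 (F : comNzRingType) (a1 a2 a3 : F) n : a1 * a2 * a3 = 1 ->
  a1 ^+ n.+3 + a2 ^+ n.+3 + a3 ^+ n.+3 =
  (a1 + a2 + a3) * (a1 ^+ n.+2 + a2 ^+ n.+2 + a3 ^+ n.+2)
  + (-1 * ((a2 * a3 + a1 * a3 + a1 * a2) * (a1 ^+ n.+1 + a2 ^+ n.+1 + a3 ^+ n.+1))
  + (a1 ^+ n + a2 ^+ n + a3 ^+ n)).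
Proof.
move=> e; rewrite !exprS.
have -> : a1 ^+ n + a2 ^+ n + a3 ^+ n =
    a1 * a2 * a3 * (a1 ^+ n + a2 ^+ n + a3 ^+ n) by rewrite e mul1r.
by move: (a1 ^+ n) (a2 ^+ n) (a3 ^+ n) => u1 u2 u3; ring.
Qed.

Lemma power_sum_traces n : exists h, in_traces h /\ forall a1 a2 a3 g,
  eig_of a1 a2 a3 g -> a1 ^+ n + a2 ^+ n + a3 ^+ n = h g.
Proof.
elim/ltn_ind: n => -[|[|[|n]]] IH.
- exists (fun=> 3); split=> [|a1 a2 a3 g _]; first exact: in_traces_cst.
  by rewrite !expr0; ring.
- exists (fun g => tg g o0); split=> [|a1 a2 a3 g [_ -> _]]; first exact: in_traces_coord.
  by rewrite !expr1.
- exists (fun g => ev (tg g) (PVar C o0 * PVar C o0 - #2 * PVar C o1)%P); split.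
    exact: in_traces_pexp.
  move=> a1 a2 a3 g [_ e1 e2]; rewrite evD !evM !evX !evC e1 e2; exact: newton2.
have [h2 [th2 H2]] := IH n.+2 (ltnSn _).
have [h1 [th1 H1]] := IH n.+1 (leqW (ltnSn _)).
have [h0 [th0 H0]] := IH n (leqW (leqW (ltnSn _))).
exists (fun g => tg g o0 * h2 g + (-1 * (tg g o1 * h1 g) + h0 g)); split.
  apply: in_tracesD; first by apply: in_tracesM => //; exact: in_traces_coord.
  apply: in_tracesD => //; apply: in_tracesM; first exact: in_traces_cst.
  by apply: in_tracesM => //; exact: in_traces_coord.
move=> a1 a2 a3 g ag; rewrite -(H2 _ _ _ _ ag) -(H1 _ _ _ _ ag) -(H0 _ _ _ _ ag).
by have [e -> ->] := ag; exact: newton3.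
Qed.

(** Inclusion-exclusion on coinciding indices, starting from the sum over all triples. When x, y, z
    are powers of the eigenvalues, all the sums on the right are power sums. *)
Lemma S3sum_monomial (F : comNzRingType) (x1 x2 x3 y1 y2 y3 z1 z2 z3 : F) :
  x1 * y2 * z3 + x1 * y3 * z2 + x2 * y1 * z3 + x2 * y3 * z1 + x3 * y1 * z2
    + x3 * y2 * z1 =
  (x1 + x2 + x3) * ((y1 + y2 + y3) * (z1 + z2 + z3))
  + (-1 * ((x1 * y1 + x2 * y2 + x3 * y3) * (z1 + z2 + z3))
  + (-1 * ((x1 * z1 + x2 * z2 + x3 * z3) * (y1 + y2 + y3))
  + (-1 * ((y1 * z1 + y2 * z2 + y3 * z3) * (x1 + x2 + x3))
  + 2 * (x1 * y1 * z1 + x2 * y2 * z2 + x3 * y3 * z3)))).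
Proof. ring. Qed.

Lemma symmetrizable1 : symmetrizable (fun _ _ _ _ => 1).
Proof.
move=> i j k.
have [hi [ti Hi]] := power_sum_traces i.
have [hj [tj Hj]] := power_sum_traces j.
have [hk [tk Hk]] := power_sum_traces k.
have [hij [tij Hij]] := power_sum_traces (i + j).
have [hik [tik Hik]] := power_sum_traces (i + k).
have [hjk [tjk Hjk]] := power_sum_traces (j + k).
have [hijk [tijk Hijk]] := power_sum_traces (i + j + k).
exists (fun g => hi g * (hj g * hk g) + (-1 * (hij g * hk g)
  + (-1 * (hik g * hj g) + (-1 * (hjk g * hi g) + 2 * hijk g)))); split.
  by repeat first [assumption | exact: in_traces_cst | apply: in_tracesM | apply: in_tracesD].
move=> a1 a2 a3 g ag; rewrite /S3sum !mulr1 S3sum_monomial -!exprD.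
by rewrite (Hi _ _ _ _ ag) (Hj _ _ _ _ ag) (Hk _ _ _ _ ag) (Hij _ _ _ _ ag)
  (Hik _ _ _ _ ag) (Hjk _ _ _ _ ag) (Hijk _ _ _ _ ag).
Qed.

Lemma symmetrizable_ext u v :
  (forall a1 a2 a3 g, u a1 a2 a3 g = v a1 a2 a3 g) ->
  symmetrizable u -> symmetrizable v.
Proof.
move=> e su i j k; have [h [th H]] := su i j k; exists h; split=> // a1 a2 a3 g ag.
by rewrite -(H _ _ _ _ ag) /S3sum !e.
Qed.

Lemma symmetrizableM u v : eig_fun u -> symmetrizable v ->
  symmetrizable (fun a1 a2 a3 g => u a1 a2 a3 g * v a1 a2 a3 g).
Proof.
move=> eu; elim: eu v => [v sv|v sv|v sv|h th v sv|u1 u2 _ IH1 _ IH2 v sv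
  |u1 u2 _ IH1 _ IH2 v sv|u1 u2 _ IH e v sv] i j k.
- have [h [th H]] := sv i.+1 j k; exists h; split=> // a1 a2 a3 g ag.
  by rewrite -(H _ _ _ _ ag) /S3sum !exprS; ring.
- have [h [th H]] := sv i j.+1 k; exists h; split=> // a1 a2 a3 g ag.
  by rewrite -(H _ _ _ _ ag) /S3sum !exprS; ring.
- have [h [th H]] := sv i j k.+1; exists h; split=> // a1 a2 a3 g ag.
  by rewrite -(H _ _ _ _ ag) /S3sum !exprS; ring.
- have [h' [th' H]] := sv i j k; exists (fun g => h g * h' g).
  split=> [|a1 a2 a3 g ag]; first exact: in_tracesM.
  by rewrite -(H _ _ _ _ ag) /S3sum; ring.
- have [h1 [th1 H1]] := IH1 v sv i j k; have [h2 [th2 H2]] := IH2 v sv i j k.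
  exists (fun g => h1 g + h2 g); split=> [|a1 a2 a3 g ag]; first exact: in_tracesD.
  by rewrite -(H1 _ _ _ _ ag) -(H2 _ _ _ _ ag) /S3sum; ring.
- apply: (symmetrizable_ext _ (IH1 _ (IH2 v sv))) => *; exact: mulrA.
- apply: (symmetrizable_ext _ (IH v sv)) => *; by rewrite e.
Qed.

Lemma S3sum_traces u : eig_fun u -> exists h, in_traces h /\
  forall a1 a2 a3 g, eig_of a1 a2 a3 g -> S3sum u a1 a2 a3 g = h g.
Proof.
move=> eu; have [h [th H]] := symmetrizableM eu symmetrizable1 0 0 0.
exists h; split=> // a1 a2 a3 g ag; rewrite -(H _ _ _ _ ag) /S3sum !expr0.
by rewrite !mul1r !mulr1.
Qed.

End TraceAlgebra.

(** * Torus invariants on the slice where the first matrix is diagonal *)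

Section TorusInvariants.
Variable R : realType.
Local Notation C := R[i].

Definition laurent_monomial : Type := (C * ('I_3 -> nat) * ('I_3 -> 'I_3 -> nat))%type.

Definition amon (a1 a2 a3 : C) (e : 'I_3 -> nat) : C :=
  a1 ^+ e i0 * a2 ^+ e i1 * a3 ^+ e i2.

Definition bmon (n : 'I_3 -> 'I_3 -> nat) (B : 'M[C]_3) : C :=
  \prod_i \prod_j B i j ^+ n i j.

Definition mon_val (a1 a2 a3 : C) (B : 'M[C]_3) (t : laurent_monomial) : C :=
  t.1.1 * amon a1 a2 a3 t.1.2 * bmon t.2 B.

Definition mon_mul (t u : laurent_monomial) : laurent_monomial :=
  (t.1.1 * u.1.1, fun i => (t.1.2 i + u.1.2 i)%N, fun i j => (t.2 i j + u.2 i j)%N).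

Lemma mon_valM a1 a2 a3 B t u :
  mon_val a1 a2 a3 B (mon_mul t u) = mon_val a1 a2 a3 B t * mon_val a1 a2 a3 B u.
Proof.
rewrite /mon_val /=.
have -> : bmon (fun i j => t.2 i j + u.2 i j)%N B = bmon t.2 B * bmon u.2 B.
  rewrite /bmon -big_split; apply: eq_bigr => i _.
  by rewrite -big_split; apply: eq_bigr => j _; rewrite exprD.
have -> : amon a1 a2 a3 (fun i => t.1.2 i + u.1.2 i)%N =
    amon a1 a2 a3 t.1.2 * amon a1 a2 a3 u.1.2.
  by rewrite /amon /= !exprD; ring.
by ring.
Qed.

Lemma bmon0 B : bmon (fun _ _ => 0%N) B = 1.
Proof. by rewrite /bmon big1 // => i _; rewrite big1. Qed.

Lemma amon0 a1 a2 a3 : amon a1 a2 a3 (fun=> 0%N) = 1.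
Proof. by rewrite /amon !expr0 !mulr1. Qed.

Lemma bmon_delta i j B : bmon (fun k l => (k == i) && (l == j))%N B = B i j.
Proof.
rewrite /bmon (bigD1 i) //= (bigD1 j) //= !eqxx /= expr1.
rewrite big1 => [|l /negPf lj]; last by rewrite lj expr0.
rewrite mulr1 big1 ?mulr1 // => k /negPf ki.
by rewrite big1 // => l _; rewrite ki expr0.
Qed.

Lemma amon_delta a1 a2 a3 i : amon a1 a2 a3 (fun k => (k == i) : nat) =
  (diag3 a1 a2 a3) i i.
Proof.
rewrite /diag3 mxE; elim/ord3_ind: i; rewrite /amon /= ?expr0 ?expr1 ?mul1r ?mulr1 //.
Qed.

Lemma regular_diag_expansion (f : rep2 R -> C) : regular_function f ->
  exists l : seq laurent_monomial, forall g a1 a2 a3, (val g).1 = diag3 a1 a2 a3 ->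
    f g = \sum_(t <- l) mon_val a1 a2 a3 (val g).2 t.
Proof.
elim=> [c|i j|i j|f1 f2 _ [l1 H1] _ [l2 H2]|f1 f2 _ [l1 H1] _ [l2 H2]].
- exists [:: (c, fun=> 0%N, fun _ _ => 0%N)] => g a1 a2 a3 _.
  by rewrite big_seq1 /mon_val /= amon0 bmon0 !mulr1.
- exists (if i == j then [:: (1, fun k => (k == i) : nat, fun _ _ => 0%N)] else [::]).
  move=> g a1 a2 a3 ->; case: eqP => [->|/eqP ij].
    by rewrite big_seq1 /mon_val /= amon_delta bmon0 mulr1 mul1r.
  by rewrite big_nil mxE; elim/ord3_ind: i ij; elim/ord3_ind: j.
- exists [:: (1, fun=> 0%N, fun k l => (k == i) && (l == j) : nat)] => g a1 a2 a3 _.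
  by rewrite big_seq1 /mon_val /= amon0 bmon_delta !mul1r.
- exists (l1 ++ l2) => g a1 a2 a3 gA.
  by rewrite big_cat (H1 _ _ _ _ gA) (H2 _ _ _ _ gA).
- exists [seq mon_mul t u | t <- l1, u <- l2] => g a1 a2 a3 gA.
  rewrite (H1 _ _ _ _ gA) (H2 _ _ _ _ gA) big_distrlr big_allpairs_dep /=.
  by apply: eq_bigr => t _; apply: eq_bigr => u _; rewrite mon_valM.
Qed.

Lemma eq_sum_all (V : nmodType) (T : Type) (P : pred T) (l : seq T) (F G : T -> V) :
  all P l -> (forall t, P t -> F t = G t) ->
  \sum_(t <- l) F t = \sum_(t <- l) G t.
Proof.
move=> + FG; elim: l => [|t l IH]; first by rewrite !big_nil.
by rewrite !big_cons => /andP[/FG-> /IH->].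
Qed.

(** Shifting the exponents by a common [M] gives an identity between polynomials, whose coefficients
    of degree [M] are compared. *)
Lemma laurent_constant (T : Type) (l : seq T) (v : T -> C) (w : T -> int) (c : C) :
  (forall z, z != 0 -> c = \sum_(t <- l) v t * z ^ w t) ->
  c = \sum_(t <- l | w t == 0) v t.
Proof.
move=> H.
have [M Mw] : exists M : nat, all (fun t => 0 <= w t + M%:Z) l.
  elim: l {H} => [|t l [M IH]]; first by exists 0%N.
  exists (M + `|w t|)%N => /=; apply/andP; split; first lia.
  by apply: sub_all IH => u; lia.
pose q := \sum_(t <- l) v t *: 'X^`|w t + M%:Z| - c *: 'X^M.
have q0 : q = 0.
  (* The factor ['X] takes care of z = 0, where nothing is assumed. *)
  suff : q * 'X = 0 by move/eqP; rewrite mulf_eq0 polyX_eq0 orbF => /eqP.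
  apply: poly_fun_eq0 => z; rewrite hornerM hornerX.
  have [->|z0] := eqVneq z 0; first by rewrite mulr0.
  apply/eqP; rewrite mulf_eq0 (negPf z0) orbF /q hornerD hornerN hornerZ hornerXn.
  rewrite horner_sum (H z z0) mulr_suml subr_eq0; apply/eqP.
  apply: (eq_sum_all Mw) => t wt.
  rewrite hornerZ hornerXn -mulrA; congr (_ * _).
  by rewrite !exprnP -expfzDr // gez0_abs.
have := congr1 (fun p : {poly C} => p`_M) q0.
rewrite coef0 /q coefB coefZ coefXn eqxx mulr1 coef_sum => /eqP.
rewrite subr_eq0 => /eqP <-; rewrite [RHS]big_mkcond /=.
apply: (eq_sum_all Mw) => t Mt.
rewrite coefZ coefXn.
have -> : (M == `|(w t + M%:Z)%R|%N) = (w t == 0) by apply/eqP/eqP; lia.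
by case: eqP => _; rewrite ?mulr1 ?mulr0.
Qed.

(** Conjugation by the diagonal matrix of the powers of s, which has determinant 1 because the
    exponents add up to 0. *)
Lemma torus_conj (g : rep2 R) a1 a2 a3 (z : 'I_3 -> int) (s : C) : s != 0 ->
  z i0 + z i1 + z i2 = 0 -> (val g).1 = diag3 a1 a2 a3 ->
  exists g', [/\ conjugate g g', (val g').1 = diag3 a1 a2 a3 &
    forall i j, (val g').2 i j = s ^ (z i - z j) * (val g).2 i j].
Proof.
move=> s0 z0 gA.
pose h := diag3 (s ^ z i0) (s ^ z i1) (s ^ z i2).
pose k := diag3 (s ^ (- z i0)) (s ^ (- z i1)) (s ^ (- z i2)).
have dh : \det h = 1 by rewrite det_diag3 -!expfzDr // z0.
have hk : h *m k = 1%:M.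
  apply: mx3P; rewrite !mxE sum3 !mxE /= ?mul0r ?mulr0 ?add0r ?addr0 //;
  by rewrite -expfzDr // subrr.
have hV : invmx h = k by exact: mulmx_invmx.
have conj_det X : \det X = 1 -> \det (h *m X *m invmx h) = 1.
  by move=> dX; rewrite !det_mulmx det_inv dh dX invr1 !mulr1.
exists (mkrep (conj_det _ (rep_det1 g)) (conj_det _ (rep_det2 g))); split.
- by exists h.
- rewrite /= gA hV; apply: mx3P; rewrite !mxE !sum3 !mxE !sum3 !mxE /=
    ?mul0r ?mulr0 ?add0r ?addr0 ?mul0r ?add0r //;
  by rewrite mulrAC -expfzDr // subrr mul1r.
- rewrite /= hV; elim/ord3_ind; elim/ord3_ind;
  by rewrite !mxE !sum3 !mxE !sum3 !mxE /= ?mul0r ?mulr0 ?add0r ?addr0 mulrAC -expfzDr.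
Qed.

Definition weight (z : 'I_3 -> int) (n : 'I_3 -> 'I_3 -> nat) : int :=
  \sum_i \sum_j (z i - z j) * (n i j)%:Z.

Lemma bmon_torus (z : 'I_3 -> int) (s : C) n (B B' : 'M[C]_3) : s != 0 ->
  (forall i j, B' i j = s ^ (z i - z j) * B i j) ->
  bmon n B' = s ^ weight z n * bmon n B.
Proof.
move=> s0 H; rewrite /bmon /weight.
have powD : {morph (fun x : int => s ^ x) : x y / x + y >-> x * y}.
  by move=> x y; exact: expfzDr.
rewrite (big_morph _ powD (expr0z s)) -big_split; apply: eq_bigr => i _ /=.
rewrite (big_morph _ powD (expr0z s)) -big_split; apply: eq_bigr => j _ /=.
by rewrite H exprMn -exprz_exp -exprnP.
Qed.

(** A torus conjugation multiplies each monomial by s to the power of its weight and leaves f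
    unchanged, so only weight 0 contributes. *)
Lemma torus_average (f : char_ring R) (z : 'I_3 -> int) (l : seq laurent_monomial) :
  z i0 + z i1 + z i2 = 0 ->
  (forall g a1 a2 a3, (val g).1 = diag3 a1 a2 a3 ->
     \val f g = \sum_(t <- l) mon_val a1 a2 a3 (val g).2 t) ->
  forall g a1 a2 a3, (val g).1 = diag3 a1 a2 a3 ->
    \val f g = \sum_(t <- [seq t <- l | weight z t.2 == 0]) mon_val a1 a2 a3 (val g).2 t.
Proof.
move=> z0 H g a1 a2 a3 gA; rewrite big_filter.
apply: laurent_constant => s s0.
have [g' [gg' gA' gB']] := torus_conj s0 z0 gA.
rewrite (char_ring_conj f gg') (H _ _ _ _ gA'); apply: eq_bigr => t _.
rewrite /mon_val (bmon_torus _ s0 gB') mulrCA mulrC //.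
Qed.

(** With n i j read as a number of edges from i to j, as many edges leave each vertex as arrive; the
    condition at the third vertex follows from the other two. *)
Definition balanced (n : 'I_3 -> 'I_3 -> nat) : bool :=
  (n i0 i1 + n i0 i2 == n i1 i0 + n i2 i0)%N
  && (n i1 i0 + n i1 i2 == n i0 i1 + n i2 i1)%N.

Lemma invariant_expansion (f : char_ring R) : exists l : seq laurent_monomial,
  all (fun t => balanced t.2) l /\
  forall g a1 a2 a3, (val g).1 = diag3 a1 a2 a3 ->
    \val f g = \sum_(t <- l) mon_val a1 a2 a3 (val g).2 t.
Proof.
have [l H] := regular_diag_expansion (char_ring_regular f).
(* The one-parameter subgroups diag(s, 1/s, 1) and diag(s, 1, 1/s). Weight 0 for both says that
   outgoing minus incoming edges is the same at the three vertices, hence 0, since these differences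
   add up to 0. *)
pose z1 (i : 'I_3) : int := nth 0 [:: 1; -1; 0] i.
pose z2 (i : 'I_3) : int := nth 0 [:: 1; 0; -1] i.
have {}H := torus_average (erefl : z1 i0 + z1 i1 + z1 i2 = 0) H.
have {}H := torus_average (erefl : z2 i0 + z2 i1 + z2 i2 = 0) H.
exists [seq t <- [seq t <- l | weight z1 t.2 == 0] | weight z2 t.2 == 0].
split=> //; apply/allP => t; rewrite !mem_filter => /andP[+ /andP[+ _]].
rewrite /weight !sum3 /z1 /z2 /= /balanced; lia.
Qed.

(** A balanced graph on three vertices splits into loops, 2-cycles and copies of one oriented
    3-cycle, because n01 - n10 = n12 - n21 = n20 - n02. Subtraction is truncated, so at least one of
    [d] and [d'] is 0. *)
Lemma balanced_monomial n (B : 'M[C]_3) : balanced n ->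
  let d := (n i0 i1 - n i1 i0)%N in let d' := (n i1 i0 - n i0 i1)%N in
  bmon n B = B i0 i0 ^+ n i0 i0 * B i1 i1 ^+ n i1 i1 * B i2 i2 ^+ n i2 i2
    * (B i0 i1 * B i1 i0) ^+ minn (n i0 i1) (n i1 i0)
    * (B i0 i2 * B i2 i0) ^+ minn (n i0 i2) (n i2 i0)
    * (B i1 i2 * B i2 i1) ^+ minn (n i1 i2) (n i2 i1)
    * cyc B ^+ d * cyc' B ^+ d'.
Proof.
move=> bal d d'; rewrite /bmon !prod3 /cyc /cyc' !exprMn.
case: (leqP (n i1 i0) (n i0 i1)) => le10.
  have d'0 : d' = 0%N by rewrite /d'; lia.
  have e01 : n i0 i1 = (n i1 i0 + d)%N by rewrite /d; lia.
  have e12 : n i1 i2 = (n i2 i1 + d)%N by move: bal; rewrite /balanced /d; lia.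
  have e20 : n i2 i0 = (n i0 i2 + d)%N by move: bal; rewrite /balanced /d; lia.
  rewrite d'0 !expr0 !mulr1 e01 e12 e20.
  have -> : minn (n i0 i2) (n i0 i2 + d) = n i0 i2 by lia.
  have -> : minn (n i2 i1 + d) (n i2 i1) = n i2 i1 by lia.
  by rewrite !exprD !mulrA; ring.
have d0 : d = 0%N by rewrite /d; lia.
have e10 : n i1 i0 = (n i0 i1 + d')%N by rewrite /d'; lia.
have e21 : n i2 i1 = (n i1 i2 + d')%N by move: bal; rewrite /balanced /d'; lia.
have e02 : n i0 i2 = (n i2 i0 + d')%N by move: bal; rewrite /balanced /d'; lia.
rewrite d0 !expr0 !mulr1 e10 e21 e02.
have -> : minn (n i2 i0 + d') (n i2 i0) = n i2 i0 by lia.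
have -> : minn (n i1 i2) (n i1 i2 + d') = n i1 i2 by lia.
by rewrite !exprD !mulrA; ring.
Qed.

End TorusInvariants.

(** * Diagonal entries and cofactors from the eigenvalues and the traces *)

Section DiagonalFunctions.
Variable R : realType.
Local Notation C := R[i].

Lemma EigN (u : C -> C -> C -> rep2 R -> C) : eig_fun u ->
  eig_fun (fun a1 a2 a3 g => - u a1 a2 a3 g).
Proof. by move=> eu; apply: EigE (EigM (EigC (-1)) eu) _ => *; rewrite mulN1r. Qed.

(* Functions of a diagonal matrix and of a second matrix that become
   polynomial in the eigenvalues and the traces after multiplication by a power
   of the Vandermonde determinant. *)
Definition diag_fun (f : C -> C -> C -> 'M[C]_3 -> C) : Prop :=
  exists (N : nat) (u : C -> C -> C -> rep2 R -> C), eig_fun u /\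
    forall g a1 a2 a3, (val g).1 = diag3 a1 a2 a3 ->
      f a1 a2 a3 (val g).2 * vandermonde a1 a2 a3 ^+ N = u a1 a2 a3 g.

Lemma diag_fun_ext f f' : (forall a1 a2 a3 B, f a1 a2 a3 B = f' a1 a2 a3 B) ->
  diag_fun f -> diag_fun f'.
Proof.
move=> e [N [u [eu H]]]; exists N, u; split=> // g a1 a2 a3 gA.
by rewrite -e; exact: H.
Qed.

Lemma diag_funD f1 f2 : diag_fun f1 -> diag_fun f2 ->
  diag_fun (fun a1 a2 a3 B => f1 a1 a2 a3 B + f2 a1 a2 a3 B).
Proof.
move=> [N1 [u1 [eu1 H1]]] [N2 [u2 [eu2 H2]]].
exists (N1 + N2)%N, (fun a1 a2 a3 g => u1 a1 a2 a3 g * vandermonde a1 a2 a3 ^+ N2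
  + u2 a1 a2 a3 g * vandermonde a1 a2 a3 ^+ N1); split.
  by apply: EigD; apply: EigM => //; apply: EigX; exact: EigV.
move=> g a1 a2 a3 gA; rewrite -(H1 _ _ _ _ gA) -(H2 _ _ _ _ gA).
by rewrite exprD mulrDl !mulrA; congr (_ + _); rewrite mulrAC.
Qed.

Lemma diag_funM f1 f2 : diag_fun f1 -> diag_fun f2 ->
  diag_fun (fun a1 a2 a3 B => f1 a1 a2 a3 B * f2 a1 a2 a3 B).
Proof.
move=> [N1 [u1 [eu1 H1]]] [N2 [u2 [eu2 H2]]].
exists (N1 + N2)%N, (fun a1 a2 a3 g => u1 a1 a2 a3 g * u2 a1 a2 a3 g); split.
  exact: EigM.
move=> g a1 a2 a3 gA; rewrite -(H1 _ _ _ _ gA) -(H2 _ _ _ _ gA).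
by rewrite exprD mulrACA.
Qed.

Lemma diag_fun_eig (u : C -> C -> C -> C) :
  eig_fun (fun a1 a2 a3 (_ : rep2 R) => u a1 a2 a3) ->
  diag_fun (fun a1 a2 a3 _ => u a1 a2 a3).
Proof.
by move=> eu; exists 0%N, (fun a1 a2 a3 _ => u a1 a2 a3); split=> // *; rewrite mulr1.
Qed.

Lemma diag_funC c : diag_fun (fun _ _ _ _ => c).
Proof. by apply: diag_fun_eig; exact: EigC. Qed.

Lemma diag_funX f n : diag_fun f -> diag_fun (fun a1 a2 a3 B => f a1 a2 a3 B ^+ n).
Proof.
move=> df; elim: n => [|n IH]; first exact: diag_funC 1.
by apply: diag_fun_ext (diag_funM df IH) => *; rewrite exprS.
Qed.

Lemma diag_funB f1 f2 : diag_fun f1 -> diag_fun f2 ->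
  diag_fun (fun a1 a2 a3 B => f1 a1 a2 a3 B - f2 a1 a2 a3 B).
Proof.
move=> d1 d2; apply: diag_fun_ext (diag_funD d1 (diag_funM (diag_funC (-1)) d2)).
by move=> *; rewrite mulN1r.
Qed.

Ltac eig_tac := repeat first
  [ exact: EigA1 | exact: EigA2 | exact: EigA3 | exact: EigC
  | exact: (EigT (in_traces_coord _ _)) | exact: (EigT (in_traces_comm _))
  | apply: EigN | apply: EigX | apply: EigD | apply: EigM ].

(** Cramer's rule for the linear system with rows (1, 1, 1), (a1, a2, a3) and (a2 a3, a1 a3, a1 a2),
    whose determinant is the Vandermonde up to sign. It recovers the diagonal of the second matrix,
    or of its inverse, from the traces. *)
Lemma vandermonde_solve (F : comNzRingType) (a1 a2 a3 x1 x2 x3 : F) :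
  let p := x1 + x2 + x3 in let q := a1 * x1 + a2 * x2 + a3 * x3 in
  let r := a2 * a3 * x1 + a1 * a3 * x2 + a1 * a2 * x3 in
  let V := vandermonde a1 a2 a3 in
  [/\ x1 * V = (a2 - a3) * (a1 * q - a1 * (a2 + a3) * p + r),
      x2 * V = (a3 - a1) * (a2 * q - a2 * (a1 + a3) * p + r) &
      x3 * V = (a1 - a2) * (a3 * q - a3 * (a1 + a2) * p + r)].
Proof. by rewrite /vandermonde; split; ring. Qed.

Lemma diag_fun_x i : diag_fun (fun _ _ _ B => B i i).
Proof.
have H (g : rep2 R) (a1 a2 a3 : C) : (val g).1 = diag3 a1 a2 a3 ->
    let B := (val g).2 in let V := vandermonde a1 a2 a3 in
  [/\ B i0 i0 * V = (a2 - a3) * (a1 * tg g o4 - a1 * (a2 + a3) * tg g o2 + tg g o7),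
      B i1 i1 * V = (a3 - a1) * (a2 * tg g o4 - a2 * (a1 + a3) * tg g o2 + tg g o7) &
      B i2 i2 * V = (a1 - a2) * (a3 * tg g o4 - a3 * (a1 + a2) * tg g o2 + tg g o7)].
  move=> gA B V; rewrite !(tg_diag gA) /frame_pt /pt8 [nth _ _ o4]/= [nth _ _ o2]/= [nth _ _ o7]/=.
  exact: vandermonde_solve.
elim/ord3_ind: i; eexists 1%N, _; split;
  try (move=> g a1 a2 a3 gA; have [h1 h2 h3] := H _ _ _ _ gA; rewrite expr1;
       first [exact: h1 | exact: h2 | exact: h3]); eig_tac.
Qed.

Lemma diag_fun_y i : diag_fun (fun _ _ _ B => adj3 B i i).
Proof.
have H (g : rep2 R) (a1 a2 a3 : C) : (val g).1 = diag3 a1 a2 a3 ->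
    let B := adj3 (val g).2 in let V := vandermonde a1 a2 a3 in
  [/\ B i0 i0 * V = (a2 - a3) * (a1 * tg g o6 - a1 * (a2 + a3) * tg g o3 + tg g o5),
      B i1 i1 * V = (a3 - a1) * (a2 * tg g o6 - a2 * (a1 + a3) * tg g o3 + tg g o5) &
      B i2 i2 * V = (a1 - a2) * (a3 * tg g o6 - a3 * (a1 + a2) * tg g o3 + tg g o5)].
  move=> gA B V; rewrite !(tg_diag gA) /frame_pt /pt8 [nth _ _ o6]/= [nth _ _ o3]/= [nth _ _ o5]/=.
  exact: vandermonde_solve.
elim/ord3_ind: i; eexists 1%N, _; split;
  try (move=> g a1 a2 a3 gA; have [h1 h2 h3] := H _ _ _ _ gA; rewrite expr1;
       first [exact: h1 | exact: h2 | exact: h3]); eig_tac.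
Qed.

End DiagonalFunctions.

(** * Cycles, and symmetrization over the orders of the eigenvalues *)

Section Generation.
Variable R : realType.
Local Notation C := R[i].
Local Notation "f .[: g ]" := (\val f g) (at level 2, format "f .[:  g ]").

(** t is [base] plus a combination of the two 3-cycles, and their sum is known from the diagonal
    entries and cofactors. Eliminating one cycle leaves the other with coefficient the Vandermonde,
    up to sign. *)
Lemma diag_fun_cycle : exists E E' : C -> C -> C -> 'M[C]_3 -> C,
  [/\ diag_fun E, diag_fun E' & forall (g : rep2 R) a1 a2 a3,
    (val g).1 = diag3 a1 a2 a3 ->
    vandermonde a1 a2 a3 * cyc (val g).2 = E a1 a2 a3 (val g).2 - (tcomm R).[: g] /\
    vandermonde a1 a2 a3 * cyc' (val g).2 = (tcomm R).[: g] - E' a1 a2 a3 (val g).2].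
Proof.
pose x (B : 'M[C]_3) i := B i i; pose y (B : 'M[C]_3) i := adj3 B i i.
pose base a1 a2 a3 B := comm_base a1 a2 a3 (x B i0) (x B i1) (x B i2) (y B i0) (y B i1) (y B i2).
pose sg B := cycle_sum (x B i0) (x B i1) (x B i2) (y B i0) (y B i1) (y B i2).
have dA1 : diag_fun (fun (a1 a2 a3 : C) _ => a1) by apply: diag_fun_eig; exact: EigA1.
have dA2 : diag_fun (fun (a1 a2 a3 : C) _ => a2) by apply: diag_fun_eig; exact: EigA2.
have dA3 : diag_fun (fun (a1 a2 a3 : C) _ => a3) by apply: diag_fun_eig; exact: EigA3.
have dsg : diag_fun (fun _ _ _ B => sg B).
  rewrite /sg /cycle_sum.
  by repeat first [exact: diag_funC | exact: diag_fun_x | exact: diag_fun_y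
    | apply: diag_funB | apply: diag_funD | apply: diag_funM].
have dbase : diag_fun base.
  rewrite /base /comm_base.
  by repeat first [exact: dA1 | exact: dA2 | exact: dA3 | exact: diag_fun_x
    | exact: diag_fun_y | apply: diag_funB | apply: diag_funD | apply: diag_funM
    | apply: diag_funX].
exists (fun a1 a2 a3 B => base a1 a2 a3 B + twist' a1 a2 a3 * sg B).
exists (fun a1 a2 a3 B => base a1 a2 a3 B + twist a1 a2 a3 * sg B); split.
- rewrite /twist'.
  by repeat first [exact: dA1 | exact: dA2 | exact: dA3 | exact: dbase | exact: dsg
    | apply: diag_funD | apply: diag_funM | apply: diag_funX].
- rewrite /twist.
  by repeat first [exact: dA1 | exact: dA2 | exact: dA3 | exact: dbase | exact: dsg
    | apply: diag_funD | apply: diag_funM | apply: diag_funX].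
move=> g a1 a2 a3 gA; rewrite (tcomm_diag gA) -/(base _ _ _ _).
rewrite /sg (cycle_sum_mx (rep_det2 g)) -[vandermonde _ _ _]opprK -twistB.
by set b := base _ _ _ _; split; ring.
Qed.

Lemma diag_fun_cyc : diag_fun (fun _ _ _ (B : 'M[C]_3) => cyc B).
Proof.
have [E [E' [[N [u [eu H]]] _ EE]]] := diag_fun_cycle.
exists N.+1, (fun a1 a2 a3 g => u a1 a2 a3 g - (tcomm R).[: g] * vandermonde a1 a2 a3 ^+ N).
split.
  apply: EigD => //; apply: EigN; apply: EigM; last by apply: EigX; exact: EigV.
  by apply: EigT; exact: in_traces_comm.
move=> g a1 a2 a3 gA; have [e _] := EE g _ _ _ gA.
by rewrite exprS mulrA [cyc _ * _]mulrC e mulrBl H.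
Qed.

Lemma diag_fun_cyc' : diag_fun (fun _ _ _ (B : 'M[C]_3) => cyc' B).
Proof.
have [E' [E [_ [N [u [eu H]]] EE]]] := diag_fun_cycle.
exists N.+1, (fun a1 a2 a3 g => (tcomm R).[: g] * vandermonde a1 a2 a3 ^+ N - u a1 a2 a3 g).
split.
  apply: EigD; last exact: EigN.
  by apply: EigM; [apply: EigT; exact: in_traces_comm | apply: EigX; exact: EigV].
move=> g a1 a2 a3 gA; have [_ e] := EE g _ _ _ gA.
by rewrite exprS mulrA [cyc' _ * _]mulrC e mulrBl H.
Qed.

(** The product is B i i * B j j minus the diagonal cofactor at the third index k. *)
Lemma diag_fun_pair i j k : [|| [&& i == i0, j == i1 & k == i2],
   [&& i == i0, j == i2 & k == i1] | [&& i == i1, j == i2 & k == i0]] ->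
  diag_fun (fun _ _ _ (B : 'M[C]_3) => B i j * B j i).
Proof.
move=> ijk; apply: diag_fun_ext (diag_funB (diag_funM (diag_fun_x R i) (diag_fun_x R j))
  (diag_fun_y R k)) => _ _ _ B.
by case/or3P: ijk => /and3P[/eqP-> /eqP-> /eqP->]; rewrite mxE /=; ring.
Qed.

Lemma diag_fun_char (f : char_ring R) : exists E, diag_fun E /\
  forall g a1 a2 a3, (val g).1 = diag3 a1 a2 a3 -> f.[: g] = E a1 a2 a3 (val g).2.
Proof.
have [l [bal H]] := invariant_expansion f.
exists (fun a1 a2 a3 B => \sum_(t <- l) mon_val a1 a2 a3 B t); split=> //.
elim: l bal {H} => [_|t l IH /andP[bt bl]].
  by apply: diag_fun_ext (diag_funC 0) => *; rewrite big_nil.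
apply: (diag_fun_ext _ (diag_funD _ (IH bl))) => [a1 a2 a3 B|]; first by rewrite big_cons.
rewrite /mon_val; apply: diag_funM.
  apply: diag_funM; first exact: diag_funC.
  by rewrite /amon; do 2?[apply: diag_funM]; apply: diag_funX; apply: diag_fun_eig;
    [exact: EigA1 | exact: EigA2 | exact: EigA3].
apply: (diag_fun_ext (fun _ _ _ B => esym (balanced_monomial B bt))).
by repeat first [exact: diag_fun_x | exact: diag_fun_cyc | exact: diag_fun_cyc'
  | exact: (@diag_fun_pair i0 i1 i2 isT) | exact: (@diag_fun_pair i0 i2 i1 isT)
  | exact: (@diag_fun_pair i1 i2 i0 isT) | apply: diag_funX | apply: diag_funM].
Qed.

(** Equality of all invariants replaces conjugacy, so that frames are reordered without composing
    conjugations. *)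
Definition framed (g : rep2 R) a1 a2 a3 : Prop :=
  exists g' : rep2 R, (val g').1 = diag3 a1 a2 a3 /\
    forall f : char_ring R, f.[: g] = f.[: g'].

Lemma framed_conj g a1 a2 a3 b1 b2 b3 (h k : 'M[C]_3) : \det h = 1 -> h *m k = 1%:M ->
  h *m diag3 a1 a2 a3 *m k = diag3 b1 b2 b3 -> framed g a1 a2 a3 -> framed g b1 b2 b3.
Proof.
move=> dh /mulmx_invmx hk hD [g' [gA gf]].
have conj_det X : \det X = 1 -> \det (h *m X *m invmx h) = 1.
  by move=> dX; rewrite !det_mulmx det_inv dh dX invr1 !mulr1.
exists (mkrep (conj_det _ (rep_det1 g')) (conj_det _ (rep_det2 g'))).
split=> [|f]; first by rewrite /= gA hk hD.
by rewrite gf; apply: char_ring_conj; exists h.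
Qed.

Lemma framed_swap g a1 a2 a3 : framed g a1 a2 a3 -> framed g a2 a1 a3.
Proof.
(* The entry -1 brings the determinant of the transposition to 1 and disappears when a diagonal
   matrix is conjugated. *)
pose h : 'M[C]_3 := mx3 [:: [:: 0; 1; 0]; [:: 1; 0; 0]; [:: 0; 0; -1]].
apply: (@framed_conj _ _ _ _ _ _ _ h h); first by rewrite det3 !mxE /=; ring.
  by apply: mx3P; rewrite !mxE !sum3 !mxE /=; ring.
by apply: mx3P; rewrite !mxE !sum3 !mxE /= !sum3 !mxE /=; ring.
Qed.

Lemma framed_rot g a1 a2 a3 : framed g a1 a2 a3 -> framed g a2 a3 a1.
Proof.
pose h : 'M[C]_3 := mx3 [:: [:: 0; 1; 0]; [:: 0; 0; 1]; [:: 1; 0; 0]].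
pose k : 'M[C]_3 := mx3 [:: [:: 0; 0; 1]; [:: 1; 0; 0]; [:: 0; 1; 0]].
apply: (@framed_conj _ _ _ _ _ _ _ h k); first by rewrite det3 !mxE /=; ring.
  by apply: mx3P; rewrite !mxE !sum3 !mxE /=; ring.
by apply: mx3P; rewrite !mxE !sum3 !mxE /= !sum3 !mxE /=; ring.
Qed.

Lemma eig_fun_framed u a1 a2 a3 g g' : eig_fun u ->
  (forall f : char_ring R, f.[: g] = f.[: g']) -> u a1 a2 a3 g = u a1 a2 a3 g'.
Proof.
move=> eu gg'; elim: eu => // [h [[p q] pE]|v w _ -> _ -> //|v w _ -> _ -> //|v w _ e H].
  by rewrite !pE !tvalE -!PE_val !gg'.
by rewrite -!H.
Qed.

Lemma framed_disc1 g a1 a2 a3 : framed g a1 a2 a3 ->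
  ev (tg g) (disc1 C) = vandermonde a1 a2 a3 ^+ 2.
Proof. by move=> [g' [gA gf]]; rewrite -PE_val gf PE_val (disc1_diag gA). Qed.

Lemma framed_eig g a1 a2 a3 : framed g a1 a2 a3 -> eig_of a1 a2 a3 g.
Proof.
move=> [g' [gA gf]].
have tgg' i : tg g i = tg g' i by exact: gf.
split; first exact: frame_det gA.
  by rewrite tgg' tg0 gA tr_diag3.
by rewrite tgg' tg1 gA invmx_diag3 ?tr_diag3 // (frame_det gA).
Qed.

(** In a frame [disc1] is V^2, so that f times its N-th power is u V^N. The former ignores the order
    of the eigenvalues; it is therefore the mean of u V^N over the six orders, which is symmetric
    and so of the form p + q t. *)
Lemma generation_disc1 (f : char_ring R) : exists (N : nat) p,
  forall g, f.[: g] * ev (tg g) (disc1 C) ^+ N = tval g p.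
Proof.
have [E [[N [u [eu H]]] fE]] := diag_fun_char f.
have framedE g a1 a2 a3 : framed g a1 a2 a3 ->
    f.[: g] * ev (tg g) (disc1 C) ^+ N = u a1 a2 a3 g * vandermonde a1 a2 a3 ^+ N.
  move=> fr; rewrite (framed_disc1 fr); have [g' [gA gf]] := fr.
  rewrite (eig_fun_framed _ _ _ eu gf) -(H _ _ _ _ gA) gf (fE _ _ _ _ gA).
  by rewrite -mulrA -exprD -exprM mul2n addnn.
have eV : eig_fun (fun a1 a2 a3 (g : rep2 R) => u a1 a2 a3 g * vandermonde a1 a2 a3 ^+ N).
  by apply: EigM => //; apply: EigX; exact: EigV.
have [h [[[p q] hE] Hh]] := S3sum_traces eV.
pose p6 := PMul (PCst 6^-1) p; pose q6 := PMul (PCst 6^-1) q.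
exists N, (p6, q6) => g.
suff /(congr1 (fun f : char_ring R => f.[: g])) : f * PE (ppow (disc1 C) N) - (PE p6 + PE q6 * tcomm R) = 0.
  rewrite (char_valD (f * _)) (char_valN (_ + _)) (char_valD (PE p6)) (char_valM f) (char_valM (PE q6)).
  by rewrite !PE_val ev_ppow => /eqP; rewrite subr_eq0 => /eqP ->.
apply: disc1_dense => {}g D.
rewrite (char_valD (f * _)) (char_valN (_ + _)) (char_valD (PE p6)) (char_valM f) (char_valM (PE q6)).
rewrite !PE_val ev_ppow /p6 /q6 !evM !evC.
have [g' [a1 [a2 [a3 [gg' gA _]]]]] := diag_frame D.
have f123 : framed g a1 a2 a3 by exists g'; split=> // f'; exact: char_ring_conj.
have f231 := framed_rot f123; have f312 := framed_rot f231.
have f213 := framed_swap f123; have f132 := framed_rot f213.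
have f321 := framed_rot f132.
have := Hh _ _ _ _ (framed_eig f123).
rewrite /S3sum -!(framedE g) // hE tvalE => e.
apply/eqP; rewrite subr_eq0 -mulrA -mulrDr -e; apply/eqP.
apply: (mulfI (_ : 6 != 0 :> C)); first by rewrite pnatr_eq0.
rewrite [RHS]mulVKf ?pnatr_eq0 //.
by move: (f.[: g] * _) => X; ring.
Qed.

End Generation.

(** * Pairs of matrices with prescribed traces *)

Section Realization.
Variable F : numClosedFieldType.

Lemma cubic_roots (p q : F) : exists a1 a2 a3 : F,
  [/\ a1 * a2 * a3 = 1, p = a1 + a2 + a3 & q = a2 * a3 + a1 * a3 + a1 * a2].
Proof.
pose P : {poly F} := Poly [:: -1; q; - p; 1].
have PE : P = [:: -1; q; - p; 1] :> seq F.
  by rewrite (@PolyK _ 0) //= oner_eq0.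
have [r] := closed_field_poly_normal P.
rewrite lead_coefE PE /= scale1r => Pr.
have : size P = 4%N by rewrite PE.
rewrite Pr size_prod_XsubC; case: r Pr => [|a1 [|a2 [|a3 [|? ?]]]] // Pr _.
exists a1, a2, a3.
have {}Pr : P = 'X^3 - (a1 + a2 + a3)%:P * 'X^2
    + (a2 * a3 + a1 * a3 + a1 * a2)%:P * 'X - (a1 * a2 * a3)%:P.
  rewrite Pr !big_cons big_nil mulr1 !polyCD !polyCM; ring.
have e0 := congr1 (fun P : {poly F} => P`_0) Pr.
have e1 := congr1 (fun P : {poly F} => P`_1) Pr.
have e2 := congr1 (fun P : {poly F} => P`_2) Pr.
move: e0 e1 e2; rewrite /= PE /= !(coefD, coefB, coefN, coefCM, coefXn, coefX, coefC) /=.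
rewrite !(mulr0, mulr1, oppr0, subr0, add0r, addr0, sub0r).
by move=> /oppr_inj e0 e1 /oppr_inj e2.
Qed.

Lemma vandermonde_surj (a1 a2 a3 p q r : F) : vandermonde a1 a2 a3 != 0 ->
  exists x1 x2 x3, [/\ p = x1 + x2 + x3, q = a1 * x1 + a2 * x2 + a3 * x3 &
    r = a2 * a3 * x1 + a1 * a3 * x2 + a1 * a2 * x3].
Proof.
rewrite /vandermonde !mulf_eq0 !negb_or => /andP[/andP[V12 V13] V23].
have V21 : a2 - a1 != 0 by rewrite -opprB oppr_eq0.
have V31 : a3 - a1 != 0 by rewrite -opprB oppr_eq0.
have V32 : a3 - a2 != 0 by rewrite -opprB oppr_eq0.
exists ((a1 * q - a1 * (a2 + a3) * p + r) / ((a1 - a2) * (a1 - a3))).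
exists ((a2 * q - a2 * (a1 + a3) * p + r) / ((a2 - a1) * (a2 - a3))).
exists ((a3 * q - a3 * (a1 + a2) * p + r) / ((a3 - a1) * (a3 - a2))).
by split; field; rewrite V12 V13 V23 V21 V31 V32.
Qed.

(** X^2 - s X + p has two distinct roots, which cannot both be 0. The chosen root is an entry by
    which [matrix_of_cycles] divides. *)
Lemma nonzero_root (s p : F) : s ^+ 2 - 4 * p != 0 ->
  exists2 c, c != 0 & c * (s - c) = p.
Proof.
move=> D; pose d := sqrtC (s ^+ 2 - 4 * p).
have d2 : d ^+ 2 = s ^+ 2 - 4 * p by rewrite sqrtCK.
have root e : e ^+ 2 = d ^+ 2 -> (s + e) / 2 * (s - (s + e) / 2) = p.
  move=> e2; transitivity ((s ^+ 2 - e ^+ 2) / 4); first by field.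
  by rewrite e2 d2; field.
have [s0|s0] := eqVneq (s + d) 0; last first.
  by exists ((s + d) / 2); [rewrite mulf_neq0 ?invr_eq0 ?pnatr_eq0 | exact: root].
exists ((s + - d) / 2); last by apply: root; rewrite sqrrN.
rewrite mulf_neq0 ?invr_eq0 ?pnatr_eq0 //; apply/eqP => s1.
have s00 : s = 0.
  apply: (mulfI (_ : 2 != 0 :> F)); first by rewrite pnatr_eq0.
  by transitivity ((s + d) + (s - d)); [ring | rewrite s0 s1 addr0 mulr0].
move: s0; rewrite s00 add0r => d0; move: D; rewrite -d2 d0 expr0n /=.
by rewrite eqxx.
Qed.

(** With the normalisation b12 = b23 = 1 the first cycle is b31 = c. The diagonal cofactors fix the
    products b_ij b_ji, hence the remaining entries, and determinant 1 means that the second cycle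
    is [cycle_sum] minus c. *)
Lemma matrix_of_cycles (x1 x2 x3 y1 y2 y3 : F) :
  (cycle_sum x1 x2 x3 y1 y2 y3) ^+ 2 - 4 * cycle_prod x1 x2 x3 y1 y2 y3 != 0 ->
  exists B : 'M[F]_3, [/\ \det B = 1,
    [/\ B i0 i0 = x1, B i1 i1 = x2 & B i2 i2 = x3] &
    [/\ adj3 B i0 i0 = y1, adj3 B i1 i1 = y2 & adj3 B i2 i2 = y3]].
Proof.
move=> /nonzero_root[c c0 cE].
exists (mx3 [:: [:: x1; 1; (x1 * x3 - y2) / c]; [:: x1 * x2 - y3; x2; 1];
  [:: c; x2 * x3 - y1; x3]]); split.
- rewrite det3 !mxE /=.
  transitivity (1 - cycle_sum x1 x2 x3 y1 y2 y3 + c + cycle_prod x1 x2 x3 y1 y2 y3 / c).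
    by rewrite /cycle_sum /cycle_prod; field.
  by rewrite -cE [c * _]mulrC mulfK //; ring.
- by rewrite !mxE.
- by rewrite !mxE /=; split; field.
Qed.

End Realization.

(** * Existence and uniqueness of the form p + q t *)

Section Structure.
Variable R : realType.
Local Notation C := R[i].
Local Notation "f .[: g ]" := (\val f g) (at level 2, format "f .[:  g ]").

(** The first matrix is diagonal with eigenvalues given by a cubic; two Vandermonde systems give the
    diagonal entries and cofactors of the second, and [Pdisc] provides its off-diagonal entries. *)
Lemma rep_exists (s : 'I_8 -> C) : ev s (disc1 C) != 0 -> ev s (Pdisc C) != 0 ->
  exists g : rep2 R, tg g =1 s.
Proof.
move=> D1 D2; have [a1 [a2 [a3 [a123 s0E s1E]]]] := cubic_roots (s o0) (s o1).
have V : vandermonde a1 a2 a3 != 0.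
  have := D1; have <- : ev (frame_pt a1 a2 a3 0 0 0 0 0 0) (disc1 C) = ev s (disc1 C).
    by rewrite disc1.unlock /ev /cubic_disc /= s0E s1E.
  by rewrite disc1_frame // expf_eq0.
have [x1 [x2 [x3 [s2E s4E s7E]]]] := vandermonde_surj (s o2) (s o4) (s o7) V.
have [y1 [y2 [y3 [s3E s6E s5E]]]] := vandermonde_surj (s o3) (s o6) (s o5) V.
have sE : s =1 frame_pt a1 a2 a3 x1 x2 x3 y1 y2 y3 by apply: ord8_ind.
move: D2; rewrite (eq_ev _ sE) Pdisc_frame // mulf_eq0 expf_eq0 /= (negPf V) /=.
move=> /matrix_of_cycles[B [dB [B0 B1 B2] [A0 A1 A2]]].
have dA : \det (diag3 a1 a2 a3) = 1 by rewrite det_diag3.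
exists (mkrep dA dB) => i; rewrite sE.
by rewrite (@tg_diag _ (mkrep dA dB) a1 a2 a3) //= B0 B1 B2 A0 A1 A2.
Qed.

Definition base_pt : 'I_8 -> C := pt8 0 0 0 0 0 0 1 0.

Lemma disc1_base : ev base_pt (disc1 C) != 0.
Proof.
rewrite disc1.unlock /ev /cubic_disc /= /base_pt /pt8 /=.
rewrite (_ : _ + _ = - 27); last by ring.
by rewrite oppr_eq0 pnatr_eq0.
Qed.

Lemma Pdisc_base : ev base_pt (Pdisc C) = - 31.
Proof.
rewrite Pdisc.unlock Psum.unlock Pprod.unlock /ev /Psum_h /Pprod_h /= /base_pt /pt8 /=.
ring.
Qed.

(** A generic point is realised with both t and t', so p + q t = p + q t' = 0 with t and t'
    distinct. *)
Lemma traces_unique p q : (forall g : rep2 R, tval g (p, q) = 0) ->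
  forall s, ev s p = 0 /\ ev s q = 0.
Proof.
move=> pq0.
have H s : ev s (PMul (disc1 C) (Pdisc C)) != 0 -> ev s p = 0 /\ ev s q = 0.
  rewrite evM mulf_eq0 negb_or => /andP[D1 D2].
  have [g gs] := rep_exists D1 D2; have [g' [g'g tg']] := transpose_rep g.
  have := pq0 g; have := pq0 g'.
  rewrite !tvalE tg' !(eq_ev _ g'g) !(eq_ev _ gs) => e' e.
  have tD : (tcomm R).[: g] - (tcomm' R).[: g] != 0.
    have := D2; rewrite -(eq_ev _ gs) -PE_val -tcommB.
    by rewrite expr2 char_valM char_valD char_valN mulf_eq0 orbb.
  have q0 : ev s q = 0.
    apply/eqP; have /eqP : ev s q * ((tcomm R).[: g] - (tcomm' R).[: g]) = 0.
      by rewrite mulrBr; apply/eqP; rewrite subr_eq0 -(inj_eq (addrI (ev s p))) e e'.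
    by rewrite mulf_eq0 (negPf tD) orbF.
  by move: e; rewrite q0 mul0r addr0.
have D0 : ev base_pt (PMul (disc1 C) (Pdisc C)) != 0.
  by rewrite evM mulf_neq0 ?disc1_base // Pdisc_base oppr_eq0 pnatr_eq0.
by move=> s; split; apply: (pexp_generic_eq0 D0) => x /H[].
Qed.

Lemma swap_repK (g : rep2 R) : swap_rep (swap_rep g) = g.
Proof. by apply: val_inj => /=; case: (val g). Qed.

Lemma disc2_swap (s : 'I_8 -> C) : ev (s \o swap_coord) (disc1 C) = ev s (disc2 C).
Proof. by rewrite disc1.unlock disc2.unlock. Qed.

(** Multiplied by a power of [disc1], or of [disc2], f has the form p + q t. Uniqueness of the
    coefficients relates the two forms, and [disc_division] then removes the power of [disc1]. *)
Lemma generation (f : char_ring R) : exists p, forall g, f.[: g] = tval g p.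
Proof.
have [N [[p1 p2] pE]] := generation_disc1 f.
have [M [[q1 q2] qE]] := generation_disc1 (swap_char f).
pose sw := psubst (fun i => PVar C (swap_coord i)).
have swE x q : ev x (sw q) = ev (x \o swap_coord) q by rewrite /sw ev_psubst.
(* The exchange of the matrices sends t to t' = P - t, which is expanded here. *)
pose r1 := (sw q1 + sw q2 * Psum C)%P; pose r2 := (PCst (-1) * sw q2)%P.
have rE g : f.[: g] * ev (tg g) (disc2 C) ^+ M = tval g (r1, r2).
  have := qE (swap_rep g); rewrite swap_charE swap_repK (eq_ev _ (tg_swap g)) disc2_swap.
  rewrite !tvalE tcomm_swap !(eq_ev _ (tg_swap g)) -!swE tcomm'_val => ->.
  by rewrite /r1 /r2 evD !evM evC; ring.
clearbody r1 r2.
have H i (s : 'I_8 -> C) : ev s (if i then p1 else p2) * ev s (disc2 C) ^+ M =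
    ev s (if i then r1 else r2) * ev s (disc1 C) ^+ N.
  pose z1 := (p1 * ppow (disc2 C) M - r1 * ppow (disc1 C) N)%P.
  pose z2 := (p2 * ppow (disc2 C) M - r2 * ppow (disc1 C) N)%P.
  have z0 g : tval g (z1, z2) = 0.
    rewrite tvalE /z1 /z2 !evD !evM !evC !ev_ppow.
    transitivity (tval g (p1, p2) * ev (tg g) (disc2 C) ^+ M
      - tval g (r1, r2) * ev (tg g) (disc1 C) ^+ N); first by rewrite !tvalE; ring.
    by rewrite -pE -rE; ring.
  have [] := traces_unique z0 s; rewrite /z1 /z2 !evD !evM !evC !ev_ppow !mulN1r.
  by move=> /eqP + /eqP; rewrite !subr_eq0 => /eqP e1 /eqP e2; case: i.
have [s1 s1E] := disc_division (H true); have [s2 s2E] := disc_division (H false).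
exists (s1, s2) => g; rewrite tvalE.
suff /(congr1 (fun f : char_ring R => f.[: g])) : f - (PE s1 + PE s2 * tcomm R) = 0.
  rewrite (char_valD f) (char_valN (_ + _)) (char_valD (PE s1)) (char_valM (PE s2)).
  by rewrite !PE_val => /eqP; rewrite subr_eq0 => /eqP.
apply: disc1_dense => {}g D.
rewrite (char_valD f) (char_valN (_ + _)) (char_valD (PE s1)) (char_valM (PE s2)) !PE_val.
apply/eqP; rewrite subr_eq0; apply/eqP.
apply: (mulIf (expf_neq0 N D)); rewrite pE tvalE /= in s1E s2E *.
by rewrite s1E s2E mulrDl mulrAC.
Qed.

End Structure.

(** * Points and tangent vectors *)

Section Points.
Variable R : realType.
Local Notation C := R[i].

Definition coord (u : charvar R) : 'I_8 -> C := fun i => u (tc R i).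
Definition comm (u : charvar R) : C := u (tcomm R).

Lemma charvarA (u : charvar R) c : u (c%:A) = c.
Proof. by rewrite linearZ rmorph1; exact: mulr1. Qed.

Lemma charvarD (u : charvar R) f g : u (f + g) = u f + u g.
Proof. exact: rmorphD. Qed.
Lemma charvarB (u : charvar R) f g : u (f - g) = u f - u g.
Proof. exact: rmorphB. Qed.
Lemma charvarM (u : charvar R) f g : u (f * g) = u f * u g.
Proof. exact: rmorphM. Qed.
Lemma charvarZ (u : charvar R) c f : u (c *: f) = c * u f.
Proof. exact: linearZ. Qed.

Lemma charvar_PE (u : charvar R) p : u (PE p) = ev (coord u) p.
Proof.
elim: p => [c|i|p IHp q IHq|p IHp q IHq].
- by rewrite PEC charvarA.
- by rewrite PEX.
- by rewrite PED charvarD IHp IHq.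
- by rewrite PEM charvarM IHp IHq.
Qed.

Definition normal_form (p : pexp C * pexp C) : char_ring R :=
  PE p.1 + PE p.2 * tcomm R.

Lemma normal_formE (f : char_ring R) : exists p, f = normal_form p.
Proof.
have [p pE] := generation f; exists p; apply: char_ring_ext => g.
rewrite pE /normal_form (char_valD (PE p.1)) (char_valM (PE p.2)) !PE_val.
by [].
Qed.

Lemma normal_form_inj p q : normal_form p = normal_form q -> forall s,
  ev s p.1 = ev s q.1 /\ ev s p.2 = ev s q.2.
Proof.
move=> e s.
have [|e1 e2] := @traces_unique R (p.1 - q.1)%P (p.2 - q.2)%P _ s.
  move=> g; have : \val (normal_form p) g = \val (normal_form q) g by rewrite e.
  rewrite /normal_form (char_valD (PE p.1)) (char_valD (PE q.1))
    (char_valM (PE p.2)) (char_valM (PE q.2)) !PE_val => e'.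
  rewrite tvalE !evD !evM !evC.
  transitivity (ev (tg g) p.1 + ev (tg g) p.2 * \val (tcomm R) g
    - (ev (tg g) q.1 + ev (tg g) q.2 * \val (tcomm R) g)); first by ring.
  by rewrite e' subrr.
move: e1 e2; rewrite !evD !evM !evC !mulN1r => /eqP + /eqP.
by rewrite !subr_eq0 => /eqP -> /eqP ->.
Qed.

Definition nf_mul (p q : pexp C * pexp C) : pexp C * pexp C :=
  ((p.1 * q.1 - p.2 * q.2 * Pprod C)%P,
   (p.1 * q.2 + p.2 * q.1 + p.2 * q.2 * Psum C)%P).

Lemma normal_formM p q : normal_form p * normal_form q = normal_form (nf_mul p q).
Proof.
rewrite /normal_form /nf_mul [fst _]/= [snd _]/= !(PED, PEM, PEC).
rewrite (tvalM _ _ _ _ (_ : tcomm R ^+ 2 = PE (Psum C) * tcomm R - PE (Pprod C))).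
  by rewrite scaleN1r.
by rewrite expr2 tcomm_rel.
Qed.

Lemma normal_formD c p q : c *: normal_form p + normal_form q =
  normal_form ((PCst c * p.1 + q.1)%P, (PCst c * p.2 + q.2)%P).
Proof.
rewrite /normal_form [fst _]/= [snd _]/= !(PED, PEM, PEC).
rewrite !mulr_algl scalerDr mulrDl scalerAl; exact: addrACA.
Qed.

Lemma charvar_nf (u : charvar R) p :
  u (normal_form p) = ev (coord u) p.1 + ev (coord u) p.2 * comm u.
Proof. by rewrite /normal_form charvarD charvarM !charvar_PE. Qed.

Lemma comm_rel (u : charvar R) :
  comm u ^+ 2 = ev (coord u) (Psum C) * comm u - ev (coord u) (Pprod C).
Proof.
by rewrite -!charvar_PE /comm -charvarM -charvarB -tcomm_rel charvarM expr2.
Qed.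

Lemma charvar_comm' (u : charvar R) :
  u (tcomm' R) = ev (coord u) (Psum C) - comm u.
Proof. by rewrite -charvar_PE -tcommD charvarD addrC addKr. Qed.

Lemma comm_disc (u : charvar R) :
  (2 * comm u - ev (coord u) (Psum C)) ^+ 2 = ev (coord u) (Pdisc C).
Proof.
rewrite Pdisc.unlock !(evD, evM, evC).
transitivity (4 * comm u ^+ 2 - 4 * ev (coord u) (Psum C) * comm u
  + ev (coord u) (Psum C) ^+ 2); first by ring.
by rewrite comm_rel; ring.
Qed.

(** The value at f is read on a chosen normal form of f, and uniqueness of the coefficients makes it
    independent of the choice. The equation on t is what multiplicativity demands. *)
Lemma point_exists (s : 'I_8 -> C) (t : C) :
  t ^+ 2 = ev s (Psum C) * t - ev s (Pprod C) ->
  exists u : charvar R, coord u =1 s /\ comm u = t.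
Proof.
move=> rel.
pose nf f := projT1 (cid (normal_formE f)).
have nfE f : f = normal_form (nf f) by rewrite /nf; case: cid.
pose phi f := ev s (nf f).1 + ev s (nf f).2 * t.
have phiE p : phi (normal_form p) = ev s p.1 + ev s p.2 * t.
  by have [e1 e2] := normal_form_inj (nfE (normal_form p)) s; rewrite /phi e1 e2.
have phiL c f g : phi (c *: f + g) = c * phi f + phi g.
  rewrite (nfE f) (nfE g) normal_formD !phiE.
  by rewrite [fst _]/= [snd _]/= !(evD, evM, evC); ring.
have phiM f g : phi (f * g) = phi f * phi g.
  rewrite (nfE f) (nfE g) normal_formM !phiE (tvalM _ _ _ _ rel).
  by rewrite /nf_mul [fst _]/= [snd _]/= !(evD, evM, evC).
have phiA c : phi (c%:A) = c.
  rewrite (_ : c%:A = normal_form (PCst c, PCst 0)); last first.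
    by rewrite /normal_form !PEC scale0r mul0r addr0.
  by rewrite phiE !evC mul0r addr0.
have phi0 : phi 0 = 0 by rewrite -(scale0r 1) phiA.
have phi1 : phi 1 = 1 by rewrite -(scale1r 1) phiA.
have zmod : zmod_morphism phi.
  by move=> f g; rewrite addrC -scaleN1r phiL mulN1r addrC.
have scal : scalable phi.
  by move=> c f; rewrite -[c *: f]addr0 phiL phi0 addr0.
have mono : monoid_morphism phi by [].
pose phiZ := GRing.isZmodMorphism.Build (char_ring R) C phi zmod.
pose phiMn := GRing.isMonoidMorphism.Build (char_ring R) C phi mono.
pose phiS := GRing.isScalable.Build C (char_ring R) C *:%R phi scal.
pose u : charvar R := HB.pack phi phiZ phiMn phiS.
exists u; split=> [i|].
  rewrite -[coord u i]/(phi (tc R i)).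
  rewrite (_ : tc R i = normal_form (PVar C i, PCst 0)); last first.
    by rewrite /normal_form PEC PEX scale0r mul0r addr0.
  by rewrite phiE evC mul0r addr0.
rewrite -[comm u]/(phi (tcomm R)).
rewrite (_ : tcomm R = normal_form (PCst 0, PCst 1)); last first.
  by rewrite /normal_form !PEC scale0r scale1r mul1r add0r.
by rewrite phiE !evC mul1r add0r.
Qed.

End Points.

(** * Tangent vectors in the coordinates s1, ..., s8 *)

Section Tangent.
Variable R : realType.
Local Notation C := R[i].
Implicit Types (u : charvar R) (D E : char_ring R -> C).

Lemma tangentL u D : tangent u D ->
  forall c f g, D (c *: f + g) = c * D f + D g.
Proof. by move=> [DL _]. Qed.

Lemma tangentM u D : tangent u D -> forall f g, D (f * g) = u f * D g + u g * D f.
Proof. by move=> [_ DM]. Qed.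

Lemma tangent0r u D : tangent u D -> D 0 = 0.
Proof.
by move=> tD; have := tangentM tD 0 0; rewrite mul0r (rmorph0 u) !mul0r addr0.
Qed.

Lemma tangentD u D : tangent u D -> forall f g, D (f + g) = D f + D g.
Proof. by move=> tD f g; rewrite -{1}[f]scale1r (tangentL tD) mul1r. Qed.

Lemma tangentZ u D : tangent u D -> forall c f, D (c *: f) = c * D f.
Proof. by move=> tD c f; rewrite -[c *: f]addr0 (tangentL tD) (tangent0r tD) addr0. Qed.

Lemma tangentB u D : tangent u D -> forall f g, D (f - g) = D f - D g.
Proof.
by move=> tD f g; rewrite -scaleN1r (tangentD tD) (tangentZ tD) mulN1r.
Qed.

Lemma tangentC u D : tangent u D -> forall c, D (c%:A) = 0.
Proof.
move=> tD c; rewrite (tangentZ tD).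
have := tangentM tD 1 1; rewrite mulr1 (rmorph1 u) !mul1r => /eqP.
by rewrite -[X in X == _]addr0 (inj_eq (addrI _)) => /eqP <-; rewrite mulr0.
Qed.

Lemma tangent_comb u D E (c : C) : tangent u D -> tangent u E -> tangent u (c *: D + E).
Proof.
move=> tD tE; split.
  move=> k f g; rewrite !fctE (tangentL tD) (tangentL tE).
  rewrite -[_ *: _]/(c * _) -[c *: D f]/(c * D f) -[c *: D g]/(c * D g); ring.
move=> f g; rewrite !fctE (tangentM tD) (tangentM tE).
rewrite -[_ *: _]/(c * _) -[c *: D f]/(c * D f) -[c *: D g]/(c * D g); ring.
Qed.

Lemma tangent0 u : tangent u 0.
Proof.
split=> [c f g|f g]; apply/esym.
  by transitivity (c * 0 + 0 : C); rewrite ?mulr0 ?addr0.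
by transitivity (u f * 0 + u g * 0 : C); rewrite ?mulr0 ?addr0.
Qed.

Lemma tangent_sum u (n : nat) (c : 'I_n -> C) (e : 'I_n -> char_ring R -> C) :
  (forall i, tangent u (e i)) -> tangent u (\sum_i c i *: e i).
Proof.
move=> te; elim/big_ind: _ => [|D E tD tE|i _].
- exact: tangent0.
- by rewrite -[D]scale1r; exact: tangent_comb.
- by rewrite -[_ *: _]addr0; apply: tangent_comb => //; exact: tangent0.
Qed.

Definition tvec D : 'I_8 -> C := fun i => D (tc R i).

Lemma tangent_PE u D p : tangent u D -> D (PE p) = dif (coord u) (tvec D) p.
Proof.
move=> tD; elim: p => [c|i|p IHp q IHq|p IHp q IHq] /=.
- by rewrite PEC (tangentC tD).
- by rewrite PEX.
- by rewrite PED (tangentD tD) IHp IHq.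
- by rewrite PEM (tangentM tD) IHp IHq !charvar_PE.
Qed.

Lemma tangent_nf u D p : tangent u D -> D (normal_form p) =
  dif (coord u) (tvec D) p.1 + (ev (coord u) p.2 * D (tcomm R)
  + comm u * dif (coord u) (tvec D) p.2).
Proof.
move=> tD; rewrite /normal_form (tangentD tD) (tangentM tD) !(tangent_PE _ tD).
by rewrite charvar_PE.
Qed.

(** The derivative of t along c, from t^2 = P t - Q; the denominator is t - t'. *)
Definition comm_slope u (c : 'I_8 -> C) : C :=
  (comm u * dif (coord u) c (Psum C) - dif (coord u) c (Pprod C))
  / (2 * comm u - ev (coord u) (Psum C)).

(** The complement of the ramification of the double cover (s, t) -> s. *)
Definition unramified u : Prop := ev (coord u) (Pdisc C) != 0.

Lemma unramifiedP u : unramified u -> 2 * comm u - ev (coord u) (Psum C) != 0.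
Proof. by rewrite /unramified -comm_disc expf_eq0. Qed.

Lemma tangent_comm u D : unramified u -> tangent u D ->
  D (tcomm R) = comm_slope u (tvec D).
Proof.
move=> nu tD; have nz := unramifiedP nu.
have := congr1 D (tcomm_rel R).
rewrite (tangentM tD) (tangentB tD) (tangentM tD) !(tangent_PE _ tD) charvar_PE.
rewrite -/(comm u) => e; rewrite /comm_slope; apply: (mulIf nz); rewrite divfK //.
apply/eqP; rewrite -subr_eq0; apply/eqP; move/eqP: e; rewrite -subr_eq0 => /eqP e.
by rewrite -[RHS]e; ring.
Qed.

Lemma tangent_inj u D E : unramified u -> tangent u D -> tangent u E ->
  tvec D =1 tvec E -> D = E.
Proof.
move=> nu tD tE DE; apply/funext => f; have [p ->] := normal_formE f.
rewrite (tangent_nf _ tD) (tangent_nf _ tE) (tangent_comm nu tD) (tangent_comm nu tE).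
by rewrite /comm_slope !(eq_dif _ (frefl _) DE).
Qed.

(** The coordinates get velocity c and t gets [comm_slope u c]; the product rule on normal forms
    then comes down to the differentiated relation [dE]. *)
Lemma tangent_exists u (c : 'I_8 -> C) : unramified u ->
  exists D, tangent u D /\ tvec D =1 c.
Proof.
move=> nu; have nz := unramifiedP nu.
pose s := coord u; pose t := comm u; pose d := comm_slope u c.
have dE : (2 * t - ev s (Psum C)) * d = t * dif s c (Psum C) - dif s c (Pprod C).
  by rewrite mulrC /d /comm_slope divfK.
have tE : t ^+ 2 = ev s (Psum C) * t - ev s (Pprod C) := comm_rel u.
pose nf (f : char_ring R) := projT1 (cid (normal_formE f)).
have nfE f : f = normal_form (nf f) by rewrite /nf; case: cid.
pose V (p : pexp C * pexp C) := dif s c p.1 + (ev s p.2 * d + t * dif s c p.2).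
pose D f := V (nf f).
have DE p : D (normal_form p) = V p.
  have e := normal_form_inj (nfE (normal_form p)).
  have e1 : forall x, ev x (nf (normal_form p)).1 = ev x p.1 by move=> x; have [] := e x.
  have e2 : forall x, ev x (nf (normal_form p)).2 = ev x p.2 by move=> x; have [] := e x.
  by rewrite /D /V (dif_fun_eq e1) (dif_fun_eq e2) e2.
exists D; split; last first.
  move=> i; rewrite /tvec (_ : tc R i = normal_form (PVar C i, PCst 0)); last first.
    by rewrite /normal_form PEC PEX scale0r mul0r addr0.
  by rewrite DE /V /= evC mul0r mulr0 !addr0.
split=> [k f g|f g].
  rewrite (nfE f) (nfE g) normal_formD !DE /V [fst _]/= [snd _]/= !(evD, evM, evC) /=.
  by rewrite ?evC; ring.
have uE h : u h = ev s (nf h).1 + ev s (nf h).2 * t by rewrite {1}(nfE h) charvar_nf.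
have -> : D (f * g) = V (nf_mul (nf f) (nf g)).
  by rewrite {1}(nfE f) {1}(nfE g) normal_formM DE.
rewrite !uE -[D f]/(V (nf f)) -[D g]/(V (nf g)).
case: (nf f) => p1 p2; case: (nf g) => q1 q2.
rewrite /V /nf_mul [fst _]/= [snd _]/= !(evD, evM, evC) /= !evM ?evC.
clear D DE uE V; clearbody d t.
move: (ev s p1) (ev s p2) (ev s q1) (ev s q2) (dif s c p1) (dif s c p2)
  (dif s c q1) (dif s c q2) (ev s (Psum C)) (ev s (Pprod C)) (dif s c (Psum C))
  (dif s c (Pprod C)) dE tE => {p1 p2 q1 q2} p1 p2 q1 q2 p1' p2' q1' q2' P Q P' Q'.
move=> dE tE.
have -> : Q = P * t - t ^+ 2 by rewrite tE; ring.
have -> : Q' = t * P' - (2 * t - P) * d by rewrite dE; ring.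
ring.
Qed.

Lemma unramified_smooth u : unramified u -> smooth_locus u.
Proof.
move=> nu.
have [e eP] : exists e : 'I_8 -> char_ring R -> C, forall i, tangent u (e i) /\
    tvec (e i) =1 (fun j => (j == i)%:R).
  exists (fun i => projT1 (cid (tangent_exists (fun j => (j == i)%:R) nu))) => i.
  by case: cid.
have tvec_sum (c : 'rV[C]_8) j : tvec (\sum_i c 0 i *: e i) j = c 0 j.
  rewrite /tvec fct_sumE (bigD1 j) //= big1 => [|i ij].
    rewrite addr0 fctE; have [_ /(_ j)] := eP j; rewrite /tvec => ->.
    by rewrite eqxx; exact: mulr1.
  rewrite fctE; have [_ /(_ j)] := eP i; rewrite /tvec => ->.
  by rewrite eq_sym (negPf ij); exact: mulr0.
exists e; split=> [i|D tD]; first by have [] := eP i.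
exists (\row_j tvec D j); split.
  apply: (tangent_inj nu tD); first by apply: tangent_sum => i; have [] := eP i.
  by move=> j; rewrite tvec_sum mxE.
by move=> c Dc; apply/rowP => j; rewrite mxE Dc tvec_sum.
Qed.

End Tangent.

(** * Tangent spaces of the leaves *)

Section CurveTangent.
Variable F : numClosedFieldType.
Implicit Types (p q h : pexp F) (s c v x : 'I_8 -> F).

Definition shift s v : 'I_8 -> F := fun i => s i + v i.

Lemma pexp_lipschitz p s : exists2 K, 0 <= K & forall r v, r <= 1 ->
  (forall i, `|v i| <= r) -> `|ev (shift s v) p - ev s p| <= K * r.
Proof.
elim: p => [k|i|p [K1 K1p H1] q [K2 K2p H2]|p [K1 K1p H1] q [K2 K2p H2]].
- by exists 0 => // r v _ _; rewrite !evC subrr normr0 mul0r.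
- by exists 1 => // r v _ vr; rewrite !evX /shift addrC addKr mul1r.
- exists (K1 + K2) => [|r v r1 vr]; first exact: addr_ge0.
  rewrite !evD opprD addrACA mulrDl (le_trans (ler_normD _ _)) //.
  by apply: lerD; [exact: H1 | exact: H2].
exists (K1 * K2 + `|ev s p| * K2 + `|ev s q| * K1) => [|r v r1 vr].
  by rewrite !addr_ge0 // mulr_ge0.
have r0 : 0 <= r := le_trans (normr_ge0 _) (vr o0).
have := H1 r v r1 vr; have := H2 r v r1 vr; rewrite !evM.
set p1 := ev _ p; set q1 := ev _ q; set p0 := ev s p; set q0 := ev s q => hq hp.
have -> : p1 * q1 - p0 * q0 = (p1 - p0) * (q1 - q0) + p0 * (q1 - q0) + q0 * (p1 - p0).
  by ring.
rewrite ![in X in _ <= X]mulrDl; apply: le_trans (ler_normD _ _) _; apply: lerD; last first.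
  by rewrite normrM -mulrA ler_wpM2l.
apply: le_trans (ler_normD _ _) _; apply: lerD; last by rewrite normrM -mulrA ler_wpM2l.
rewrite normrM; apply: le_trans (ler_pM _ _ hp hq) _ => //.
by rewrite mulrACA ler_wpM2l ?mulr_ge0 // ler_piMr.
Qed.

Lemma pexp_taylor p s : exists2 K, 0 <= K & forall r v, r <= 1 ->
  (forall i, `|v i| <= r) ->
  `|ev (shift s v) p - ev s p - dif s v p| <= K * r ^+ 2.
Proof.
elim: p => [k|i|p [K1 K1p H1] q [K2 K2p H2]|p [K1 K1p H1] q [K2 K2p H2]] /=.
- by exists 0 => // r v _ _; rewrite !evC !subrr normr0 mul0r.
- by exists 0 => // r v _ vr; rewrite !evX /shift [s i + _]addrC addrK subrr normr0 mul0r.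
- exists (K1 + K2) => [|r v r1 vr]; first exact: addr_ge0.
  rewrite !evD mulrDl.
  rewrite (_ : _ - _ = (ev (shift s v) p - ev s p - dif s v p)
    + (ev (shift s v) q - ev s q - dif s v q)); last by ring.
  rewrite (le_trans (ler_normD _ _)) //.
  by apply: lerD; [exact: H1 | exact: H2].
have [L1 L1p M1] := pexp_lipschitz p s; have [L2 L2p M2] := pexp_lipschitz q s.
exists (`|ev s p| * K2 + `|ev s q| * K1 + L1 * L2) => [|r v r1 vr].
  by rewrite !addr_ge0 // mulr_ge0.
have r0 : 0 <= r := le_trans (normr_ge0 _) (vr o0).
have := H1 r v r1 vr; have := H2 r v r1 vr.
have := M1 r v r1 vr; have := M2 r v r1 vr; rewrite !evM.
set p1 := ev _ p; set q1 := ev _ q; set p0 := ev s p; set q0 := ev s q.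
set p' := dif s v p; set q' := dif s v q => mq mp hq hp.
rewrite (_ : _ - _ = p0 * (q1 - q0 - q') + q0 * (p1 - p0 - p')
  + (p1 - p0) * (q1 - q0)); last by ring.
rewrite ![in X in _ <= X]mulrDl; apply: le_trans (ler_normD _ _) _; apply: lerD; last first.
  by rewrite normrM; apply: le_trans (ler_pM _ _ mp mq) _; rewrite // mulrACA expr2.
apply: le_trans (ler_normD _ _) _; apply: lerD.
  by rewrite normrM -mulrA ler_wpM2l.
by rewrite normrM -mulrA ler_wpM2l.
Qed.

(** G'(0) / G(0) is minus the sum of the inverses of the roots. If all the roots, at most d in
    number, were larger than d |G(0)| / |G'(0)|, this sum would be too small. *)
Lemma small_root (G : {poly F}) (d : nat) : (size G <= d.+1)%N -> G^`().[0] != 0 ->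
  exists w, root G w /\ `|w| * `|G^`().[0]| <= d%:R * `|G.[0]|.
Proof.
move=> szG G1.
have [G0|G0] := eqVneq G.[0] 0.
  by exists 0; rewrite rootE G0 eqxx normr0 mul0r mulr_ge0.
have G_neq0 : G != 0 by apply/eqP => Gz; rewrite Gz horner0 eqxx in G0.
have [r Gr] := closed_field_poly_normal G.
have lc : lead_coef G != 0 by rewrite lead_coef_eq0.
have rG w : w \in r -> root G w.
  by move=> wr; rewrite Gr rootZ // root_prod_XsubC.
have szr : (size r <= d)%N.
  by move: szG; rewrite {1}Gr size_scale // size_prod_XsubC.
have r0 : 0 \notin r.
  by apply/negP => /rG; rewrite rootE (negPf G0).
have dprod (t : seq F) : 0 \notin t ->
    (\prod_(z <- t) ('X - z%:P))^`().[0] =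
    - (\prod_(z <- t) ('X - z%:P)).[0] * \sum_(z <- t) z^-1.
  elim: t => [|z t IH]; first by rewrite !big_nil derivC hornerC mulr0.
  rewrite inE negb_or eq_sym => /andP[z0 t0]; rewrite !big_cons derivM.
  rewrite derivXsubC hornerD !hornerM hornerC hornerXsubC IH //.
  by field.
have dG : G^`().[0] = - G.[0] * \sum_(z <- r) z^-1.
  by rewrite {1 2}Gr derivZ !hornerZ dprod // mulrA mulrN.
have [/hasP[w wr hw]|/hasPn H] := boolP (has (fun w => `|w| * `|G^`().[0]| <= d%:R * `|G.[0]|) r).
  by exists w; split=> //; exact: rG.
have nG1 : 0 < `|G^`().[0]| by rewrite normr_gt0.
have nG0 : 0 < `|G.[0]| by rewrite normr_gt0.
have : `|G^`().[0]| < `|G^`().[0]|.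
  rewrite {1}dG normrM normrN.
  have d_gt0 : (0 < d)%N.
    case: r szr dG {Gr rG r0 H} => [|? ?]; last by case: d {szG}.
    by rewrite big_nil mulr0 => _ dG0; rewrite dG0 eqxx in G1.
  have bound z : z \in r -> `|z^-1| < `|G^`().[0]| / (d%:R * `|G.[0]|).
    move=> zr; have z0 : z != 0 by apply/eqP => z0; rewrite z0 (negPf r0) in zr.
    have := H z zr; rewrite -real_ltNge ?realM ?normr_real ?realn // => lt.
    rewrite normfV ltr_pdivlMr ?mulr_gt0 ?ltr0n // mulrC ltr_pdivrMr ?normr_gt0 //.
    by rewrite [X in _ < X]mulrC.
  apply: (@le_lt_trans _ _ (`|G.[0]| * \sum_(z <- r) `|z^-1|)).
    by rewrite ler_wpM2l // ler_norm_sum.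
  apply: (@lt_le_trans _ _ (`|G.[0]| * \sum_(z <- r) (`|G^`().[0]| / (d%:R * `|G.[0]|)))).
    rewrite ltr_pM2l //.
    case: r dG bound {Gr rG szr r0 H} => [|z t] dG bound.
      by rewrite dG big_nil mulr0 eqxx in G1.
    rewrite !big_cons ltr_leD ?bound ?mem_head // !big_seq ler_sum // => y yt.
    by rewrite ltW // bound // inE yt orbT.
  rewrite big_const_seq count_predT iter_addr_0 -[_ *+ size r]mulr_natl.
  have -> : `|G.[0]| * ((size r)%:R * (`|G^`().[0]| / (d%:R * `|G.[0]|))) =
      (size r)%:R / d%:R * `|G^`().[0]|.
    by field; rewrite ?pnatr_eq0 -?lt0n ?d_gt0 ?normr_eq0 ?G0.
  by rewrite ler_piMl // ler_pdivrMr ?ltr0n // mul1r ler_nat.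
by rewrite ltxx.
Qed.

End CurveTangent.

(** * Points of the level sets of (P, Q) near a given point *)

Section LevelCurves.
Variable F : numClosedFieldType.
Implicit Types (p q h A B : pexp F) (s c v x : 'I_8 -> F).

Fixpoint pdir c p : pexp F :=
  match p with
  | PCst _ => PCst 0
  | PVar i => PCst (c i)
  | PAdd p q => PAdd (pdir c p) (pdir c q)
  | PMul p q => PAdd (PMul p (pdir c q)) (PMul q (pdir c p))
  end.

Lemma ev_pdir x c p : ev x (pdir c p) = dif x c p.
Proof. by elim: p => //= p IHp q IHq; rewrite evD ?evM IHp IHq. Qed.

Lemma dif_ppowD x c A m n : dif x c (ppow A (m + n)) =
  dif x c (ppow A m) * ev x A ^+ n + ev x A ^+ m * dif x c (ppow A n).
Proof.
elim: m => [|m IH] /=; first by rewrite add0n mul0r mul1r add0r.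
by rewrite IH !ev_ppow exprD exprS; ring.
Qed.

Definition unit7 (i : 'I_8) : F := (i == o7)%:R.
Definition unit6 (i : 'I_8) : F := (i == o6)%:R.

(** Serves to eliminate [o7] by an equation affine in it, with denominators cleared by a power of A.
    At a zero of B the derivative of B / A is dB / A, whence the formula for the derivative of h. *)
Lemma substitute_quotient p A B : exists N h, forall x, ev x A != 0 ->
  ev (upd x o7 (x o7 + ev x B / ev x A)) p * ev x A ^+ N = ev x h /\
  (ev x B = 0 -> forall c, dif x c h = dif x c (ppow A N) * ev x p
     + ev x A ^+ N * dif x (fun i => dif x c B / ev x A * unit7 i + c i) p).
Proof.
have upd0 x : ev x B = 0 -> upd x o7 (x o7 + ev x B / ev x A) =1 x.
  by move=> B0 i; rewrite /upd B0 mul0r addr0; case: eqP => [->|].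
elim: p => [k|i|p [N1 [h1 H1]] q [N2 [h2 H2]]|p [N1 [h1 H1]] q [N2 [h2 H2]]].
- exists 0%N, (PCst k) => x A0; split=> [|B0 c]; first by rewrite !evC mulr1.
  by rewrite /= mul0r mulr0 add0r.
- have [->|i7] := eqVneq i o7.
    exists 1%N, (PVar F o7 * A + B)%P => x A0; rewrite evD evM !evX /upd eqxx expr1.
    split=> [|B0 c]; first by rewrite mulrDl divfK.
    by rewrite /= !evC /unit7 eqxx evX mulr1n; field.
  exists 0%N, (PVar F i) => x A0; rewrite !evX /upd (negPf i7) expr0 mulr1.
  by split=> // B0 c; rewrite /= /unit7 (negPf i7) mul0r mul1r add0r mulr0 add0r.
- exists (N1 + N2)%N, (h1 * ppow A N2 + h2 * ppow A N1)%P => x A0.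
  have [e1 d1] := H1 x A0; have [e2 d2] := H2 x A0.
  rewrite !evD !evM !ev_ppow -e1 -e2; split=> [|B0 c]; first by rewrite exprD; ring.
  have {}d1 := d1 B0 c; have {}d2 := d2 B0 c.
  have E := upd0 x B0; rewrite !(eq_ev _ E) in e1 e2.
  by rewrite /= dif_ppowD d1 d2 !ev_ppow -e1 -e2 exprD; ring.
- exists (N1 + N2)%N, (h1 * h2)%P => x A0.
  have [e1 d1] := H1 x A0; have [e2 d2] := H2 x A0.
  rewrite !evM -e1 -e2; split=> [|B0 c]; first by rewrite exprD; ring.
  have {}d1 := d1 B0 c; have {}d2 := d2 B0 c.
  have E := upd0 x B0; rewrite !(eq_ev _ E) in e1 e2.
  by rewrite /= dif_ppowD d1 d2 -e1 -e2 exprD; ring.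
Qed.

(** The coefficient of s8 in P, which is affine in s8. *)
Definition Psum8 : pexp F := (PVar F o6 - PVar F o0 * PVar F o3)%P.

Lemma Psum_affine x w :
  ev (upd x o7 (x o7 + w)) (Psum F) = ev x (Psum F) + w * ev x Psum8.
Proof.
rewrite Psum.unlock /Psum8 /ev /Psum_h /= /upd /=; ring.
Qed.

Lemma dif_Psum7 s : dif s unit7 (Psum F) = ev s Psum8.
Proof.
rewrite Psum.unlock /Psum8 /ev /Psum_h /= /unit7 /= /ev /=; ring.
Qed.

Definition jacobian s : F :=
  dif s unit6 (Psum F) * dif s unit7 (Pprod F)
  - dif s unit7 (Psum F) * dif s unit6 (Pprod F).

Lemma half_bound (a b : F) : `|b - a| <= `|a| / 2 -> `|a| / 2 <= `|b|.
Proof.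
rewrite distrC => /(le_trans (lerB_dist a b)); rewrite lerBlDr -lerBlDl.
by apply: le_trans; rewrite [X in _ <= X - _](splitr `|a|) addrK.
Qed.

(** P being affine in [o7], the equation P = P(s) is solved exactly for that variable. Inserted into
    Q = Q(s) it leaves a polynomial equation for the displacement w of [o6], with nonzero derivative
    thanks to the Jacobian, and [small_root] bounds a solution by a multiple of z. *)
Lemma level_curve s c : ev s Psum8 != 0 -> jacobian s != 0 ->
  exists e K : F, [/\ 0 < e, 0 <= K & forall z, 0 < z -> z <= e -> K * z <= 1 /\
    exists w w', let v i := z * c i + (w * unit6 i + w' * unit7 i) in
    [/\ forall i, `|v i| <= K * z, ev (shift s v) (Psum F) = ev s (Psum F) &
      ev (shift s v) (Pprod F) = ev s (Pprod F)]].
Proof.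
move=> A0 J0.
pose A := Psum8; pose B := (PCst (ev s (Psum F)) - Psum F)%P.
pose Q := (Pprod F - PCst (ev s (Pprod F)))%P.
have [N [h hP]] := substitute_quotient Q A B.
have Bs : ev s B = 0 by rewrite /B evD evM !evC mulN1r subrr.
have Qs : ev s Q = 0 by rewrite /Q evD evM !evC mulN1r subrr.
have [hs dhs] := hP s A0; have {}dhs := dhs Bs.
have hs0 : ev s h = 0.
  rewrite -hs (eq_ev (x' := s)) ?Qs ?mul0r // => i.
  by rewrite /upd Bs mul0r addr0; case: eqP => [->|].
pose g1 := dif s unit6 h.
have g1_neq0 : g1 != 0.
  (* Chain rule: along [o6], with [o7] adjusted to keep P constant, the derivative of Q is -J / A;
     the power of A comes from the cleared denominators. *)
  have e : g1 * ev s A = - (ev s A ^+ N * jacobian s).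
    rewrite /g1 dhs Qs mulr0 add0r dif_linear /B /Q /= !evC /jacobian dif_Psum7 -/A.
    by field.
  apply/eqP => g0; move/eqP: e; rewrite g0 mul0r eq_sym oppr_eq0 mulf_eq0.
  by rewrite (negPf J0) orbF expf_eq0 (negPf A0) andbF.
have [L0 L0p H0] := pexp_lipschitz h s.
have [L1 L1p H1] := pexp_lipschitz (pdir unit6 h) s.
have [LA LAp HA] := pexp_lipschitz A s.
have [LB LBp HB] := pexp_lipschitz B s.
pose M := \sum_i `|c i|.
have M0 : 0 <= M by rewrite sumr_ge0.
have cM i : `|c i| <= M by rewrite /M (bigD1 i) //= lerDl sumr_ge0.
pose d := pdeg h.
pose K1 := d%:R * (L0 * M) / (`|g1| / 2).
have g1p : 0 < `|g1| / 2 by rewrite divr_gt0 ?normr_gt0.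
have Ap : 0 < `|ev s A| / 2 by rewrite divr_gt0 ?normr_gt0.
have K1p : 0 <= K1 by rewrite /K1 divr_ge0 ?mulr_ge0 // ltW.
pose K2 := LB * (M + K1) / (`|ev s A| / 2).
have MK1 : 0 <= M + K1 by rewrite addr_ge0.
have K2p : 0 <= K2 by rewrite /K2 divr_ge0 ?mulr_ge0 // ltW.
pose X1 := L1 * M / (`|g1| / 2); pose X2 := LA * (M + K1) / (`|ev s A| / 2).
have X1p : 0 <= X1 by rewrite /X1 divr_ge0 ?mulr_ge0 // ltW.
have X2p : 0 <= X2 by rewrite /X2 divr_ge0 ?mulr_ge0 // ltW.
pose K := M + K1 + K2.
have Kp : 0 <= K by rewrite /K addr_ge0.
(* T dominates each constant whose product with z has to stay below 1. *)
pose T := 1 + (K + (X1 + X2)).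
have Tp : 0 < T by rewrite /T ltr_wpDr ?addr_ge0.
exists T^-1, K; split; rewrite ?invr_gt0 // => z z0 zT.
have small X Y : 0 <= Y -> X + Y = T -> X * z <= 1.
  move=> Y0 XT; rewrite -(mulfV (lt0r_neq0 Tp)).
  apply: (@le_trans _ _ (T * z)); last by rewrite ler_wpM2l // ltW.
  by rewrite ler_wpM2r ?(ltW z0) // -XT lerDl.
have Kz : K * z <= 1 by apply: (@small K (1 + (X1 + X2))); rewrite ?addr_ge0 // /T; ring.
have X1z : X1 * z <= 1 by apply: (@small X1 (1 + (K + X2))); rewrite ?addr_ge0 // /T; ring.
have X2z : X2 * z <= 1 by apply: (@small X2 (1 + (K + X1))); rewrite ?addr_ge0 // /T; ring.
have Mz : M * z <= 1.
  by apply: (@small M (1 + (K1 + K2 + (X1 + X2)))); rewrite ?addr_ge0 // /T /K; ring.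
have MK1z : (M + K1) * z <= 1.
  by apply: (@small _ (1 + (K2 + (X1 + X2)))); rewrite ?addr_ge0 // /T /K; ring.
split=> //.
have nz : `|z| = z by rewrite ger0_norm // ltW.
pose sz := shift s (fun i => z * c i).
have czM i : `|z * c i| <= M * z.
  by rewrite normrM nz mulrC ler_wpM2r // ltW.
pose G := pev polyC (line sz unit6) h.
have G0E : G.[0] = ev sz h.
  by rewrite horner_line; apply: eq_ev => i; rewrite along0.
have G1E : G^`().[0] = ev sz (pdir unit6 h) by rewrite -dif_line ev_pdir.
have G0b : `|G.[0]| <= L0 * M * z.
  by rewrite G0E -mulrA; have := H0 _ _ Mz czM; rewrite hs0 subr0.
have G1b : `|g1| / 2 <= `|G^`().[0]|.
  rewrite G1E; apply: half_bound.
  have := H1 _ _ Mz czM; rewrite [X in _ - X]ev_pdir -/g1 => /le_trans; apply.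
  by rewrite mulrA -[X in _ <= X]mul1r -ler_pdivrMr // mulrAC.
have G1_neq0 : G^`().[0] != 0.
  by rewrite -normr_gt0 (lt_le_trans g1p).
have szG : (size G <= d.+1)%N.
  apply: size_pev_poly => i; rewrite /line.
  apply: (leq_trans (size_polyD _ _)); rewrite geq_max.
  rewrite (leq_trans (size_polyC_leq1 _)) //= mul_polyC.
  by rewrite (leq_trans (size_scale_leq _ _)) // size_polyX.
have [w [rw wb]] := small_root szG G1_neq0.
have wz : `|w| <= K1 * z.
  rewrite /K1 mulrAC ler_pdivlMr //.
  apply: (le_trans (ler_wpM2l (normr_ge0 w) G1b)); apply: (le_trans wb).
  by rewrite -mulrA ler_wpM2l.
pose u i := z * c i + w * unit6 i.
have ub i : `|u i| <= (M + K1) * z.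
  rewrite /u mulrDl; apply: le_trans (ler_normD _ _) _; apply: lerD => //.
  apply: le_trans wz; rewrite normrM /unit6.
  by case: eqP => _; rewrite ?normr1 ?mulr1 ?normr0 ?mulr0.
pose x := shift s u.
have xh : ev x h = 0.
  move/rootP: rw; rewrite horner_line => <-; apply: eq_ev => i.
  by rewrite /x /shift /along /sz /shift /u addrA [w * _]mulrC.
have Axb : `|ev s A| / 2 <= `|ev x A|.
  apply: half_bound; apply: (le_trans (HA _ _ MK1z ub)).
  by rewrite mulrA -[X in _ <= X]mul1r -ler_pdivrMr // mulrAC.
have Ax : ev x A != 0 by rewrite -normr_gt0 (lt_le_trans Ap).
have Bxb : `|ev x B| <= LB * (M + K1) * z.
  by rewrite -mulrA; have := HB _ _ MK1z ub; rewrite Bs subr0.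
pose w' := ev x B / ev x A.
have w'b : `|w'| <= K2 * z.
  rewrite /w' normrM normfV /K2 mulrAC.
  by apply: ler_pM => //; rewrite ?invr_ge0 // lef_pV2 ?posrE ?normr_gt0.
exists w, w'; set v := fun i => _.
have vx : shift s v =1 upd x o7 (x o7 + w').
  move=> i; rewrite /shift /v /upd /x /shift /u /unit7 /unit6.
  by case: (eqVneq i o7) => [->|_]; rewrite ?mulr1n ?mulr0n; ring.
split=> [i||].
- rewrite /v addrA /K mulrDl; apply: le_trans (ler_normD _ _) _; apply: lerD.
    exact: ub.
  apply: le_trans w'b; rewrite normrM /unit7.
  by case: eqP => _; rewrite ?normr1 ?mulr1 ?normr0 ?mulr0.
- rewrite (eq_ev _ vx) Psum_affine /w' -/A divfK // /B evD evM !evC; ring.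
- have [e _] := hP x Ax; move/eqP: e; rewrite xh mulf_eq0 expf_eq0 (negPf Ax) andbF orbF.
  by rewrite -(eq_ev _ vx) /Q evD evM !evC mulN1r subr_eq0 => /eqP.
Qed.

Lemma dif0 s p : dif s (fun=> 0) p = 0.
Proof. by elim: p => //= p -> q ->; rewrite ?mulr0 addr0. Qed.

(** The Lagrange multipliers l and m make r = q - l P - m Q stationary in the directions [o6] and
    [o7]. Hence at the points of [level_curve] the corrections w and w' do not affect the
    first-order variation of r, which is z times its derivative along c. As r keeps its value there,
    this is O(z^2), and the derivative is 0. *)
Lemma vanish_on_level s c q : ev s Psum8 != 0 -> jacobian s != 0 ->
  (forall x, ev x (Psum F) = ev s (Psum F) -> ev x (Pprod F) = ev s (Pprod F) ->
     ev x q = 0) ->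
  dif s c (Psum F) = 0 -> dif s c (Pprod F) = 0 -> dif s c q = 0.
Proof.
move=> A0 J0 q0 dP dQ.
have [e [K [e0 K0 H]]] := level_curve c A0 J0.
pose P6 := dif s unit6 (Psum F); pose P7 := dif s unit7 (Psum F).
pose Q6 := dif s unit6 (Pprod F); pose Q7 := dif s unit7 (Pprod F).
pose q6 := dif s unit6 q; pose q7 := dif s unit7 q.
have JE : jacobian s = P6 * Q7 - P7 * Q6 by [].
pose l := (q6 * Q7 - q7 * Q6) / jacobian s.
pose m := (P6 * q7 - P7 * q6) / jacobian s.
pose r := (q - (PCst l * Psum F + PCst m * Pprod F))%P.
have dr v : dif s v r = dif s v q - (l * dif s v (Psum F) + m * dif s v (Pprod F)).
  by rewrite /r /= !evC; ring.
have r6 : dif s unit6 r = 0.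
  rewrite dr -/q6 -/P6 -/Q6 /l /m JE; rewrite JE in J0; by field.
have r7 : dif s unit7 r = 0.
  rewrite dr -/q7 -/P7 -/Q7 /l /m JE; rewrite JE in J0; by field.
have rc : dif s c r = dif s c q by rewrite dr dP dQ !mulr0 addr0 subr0.
have [T T0 HT] := pexp_taylor r s.
have bound z : 0 < z -> z <= e -> `|dif s c q| <= T * K ^+ 2 * z.
  move=> z0 ze; have [Kz [w [w' [vb vP vQ]]]] := H z z0 ze.
  have := HT _ _ Kz vb; set v := fun i => _.
  have -> : ev (shift s v) r = ev s r.
    by rewrite /r !(evD, evM, evC) vP vQ !q0.
  have -> : dif s v r = z * dif s c q.
    have r67 : dif s (fun i => w * unit6 i + w' * unit7 i) r = 0.
      rewrite dif_linear r6 mulr0 add0r.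
      rewrite (eq_dif (x' := s) (c' := fun i => w' * unit7 i + (fun=> 0) i)) //.
        by rewrite dif_linear r7 mulr0 add0r dif0.
      by move=> i; rewrite addr0.
    by rewrite /v dif_linear rc r67 addr0.
  rewrite subrr sub0r normrN normrM ger0_norm ?(ltW z0) // exprMn.
  have -> : T * (K ^+ 2 * z ^+ 2) = z * (T * K ^+ 2 * z) by ring.
  by rewrite ler_pM2l.
apply/eqP; rewrite -normr_le0.
set D := `|dif s c q| in bound *.
have [//|D0] := boolP (D <= 0).
have Dp : 0 < D by rewrite lt_def normr_ge0 andbT; apply: contraNneq D0 => ->.
(* If D > 0, the bound at z = e D / (D + S) would read D <= S D / (D + S) < D. *)
pose S := T * K ^+ 2 * e.
have Sp : 0 <= S by rewrite /S mulr_ge0 ?(ltW e0) // mulr_ge0 ?exprn_ge0.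
have DS : 0 < D + S by rewrite ltr_wpDr.
have z0 : 0 < e * (D / (D + S)) by rewrite mulr_gt0 ?divr_gt0.
have ze : e * (D / (D + S)) <= e by rewrite ger_pMr // ler_pdivrMr // mul1r lerDl.
have := bound _ z0 ze; rewrite mulrA -/S mulrA ler_pdivlMr // mulrDr [S * D]mulrC gerDr.
by rewrite lt_geF ?mulr_gt0.
Qed.

End LevelCurves.

(** * The tangent spaces of both leaves in coordinates *)

Section Leaves.
Variable R : realType.
Local Notation C := R[i].
Implicit Types (u v : charvar R) (D E : char_ring R -> C).

Lemma boundary30 u : boundary_map Sigma30 u =
  [:: (coord u o0, coord u o1); (coord u o2, coord u o3); (coord u o5, coord u o4)].
Proof. by []. Qed.

Lemma boundary11 u : boundary_map Sigma11 u = [:: (u (tcomm' R), comm u)].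
Proof. by []. Qed.

Lemma tangent_shift u D (f : char_ring R) : tangent u D ->
  D (f - (u f)%:A) = D f.
Proof. by move=> tD; rewrite (tangentB tD) (tangentC tD) subr0. Qed.

Definition boundary6 : seq 'I_8 := [:: o0; o1; o2; o3; o4; o5].

Lemma quadratic_roots (P Q : C) : P ^+ 2 - 4 * Q != 0 -> exists t1 t2 : C,
  [/\ t1 ^+ 2 = P * t1 - Q, t2 ^+ 2 = P * t2 - Q & t1 - t2 != 0].
Proof.
move=> D0; pose d := sqrtC (P ^+ 2 - 4 * Q).
have d2 : d ^+ 2 = P ^+ 2 - 4 * Q by rewrite sqrtCK.
exists ((P + d) / 2), ((P - d) / 2); split.
- by transitivity ((P ^+ 2 + 2 * P * d + d ^+ 2) / 4); [field | rewrite d2; field].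
- by transitivity ((P ^+ 2 - 2 * P * d + d ^+ 2) / 4); [field | rewrite d2; field].
rewrite (_ : _ - _ = d); last by field.
by apply: contraNneq D0 => d0; rewrite -d2 d0 expr0n.
Qed.

Lemma PdiscE (s : 'I_8 -> C) :
  ev s (Pdisc C) = ev s (Psum C) ^+ 2 - 4 * ev s (Pprod C).
Proof. by rewrite Pdisc.unlock !(evD, evM, evC); ring. Qed.

(** The line of direction D through the coordinates of u keeps the boundary traces, so it lifts to
    the leaf with both values of t wherever [Pdisc] is nonzero. A function p + q t vanishing on the
    leaf thus has p = q = 0 identically on this line. *)
Lemma tangent_leaf30 u D : unramified u ->
  tangent_sub (leaf Sigma30 (boundary_map Sigma30 u)) u D <->
  tangent u D /\ {in boundary6, forall i, tvec D i = 0}.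
Proof.
move=> nu; split=> [[tD vanish]|[tD D0]].
  split=> // i i6; rewrite /tvec -(tangent_shift _ tD); apply: vanish => v [_].
  rewrite !boundary30 => -[e0 e1 e2 e3 e5 e4].
  rewrite charvarB charvarA -/(coord v i) -/(coord u i).
  by move: i6; rewrite !inE => /or4P[|||/or3P[||]] /eqP ->; rewrite ?e0 ?e1 ?e2 ?e3 ?e4 ?e5 subrr.
split=> // f vanish; have [p fE] := normal_formE f.
pose L q := pev polyC (line (coord u) (tvec D)) q.
have L0 q : (forall z, (L q).[z] * (L (Pdisc C)).[z] = 0) -> L q = 0.
  move=> q0; have /eqP : L q * L (Pdisc C) = 0.
    by apply: poly_fun_eq0 => z; rewrite hornerM.
  rewrite mulf_eq0 => /orP[/eqP //|/eqP d0].
  have : (L (Pdisc C)).[0] = 0 by rewrite d0 horner0.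
  rewrite horner_line (eq_ev _ (along0 _ _)) => /eqP.
  by rewrite (negPf nu).
have H z : (L (Pdisc C)).[z] != 0 -> (L p.1).[z] = 0 /\ (L p.2).[z] = 0.
  rewrite !horner_line; set s := along _ _ _ => ds.
  have := ds; rewrite PdiscE => /quadratic_roots[t1 [t2 [r1 r2 t12]]].
  have val t : t ^+ 2 = ev s (Psum C) * t - ev s (Pprod C) ->
      ev s p.1 + ev s p.2 * t = 0.
    move=> rt; have [v [vs vt]] := point_exists rt.
    rewrite -(eq_ev p.1 vs) -(eq_ev p.2 vs) -vt -charvar_nf -fE; apply: vanish; split.
      by apply: unramified_smooth; rewrite /unramified (eq_ev _ vs).
    rewrite !boundary30 !vs /s /along !D0 ?inE // !mul0r !addr0.
    by [].
  have e1 := val _ r1; have e2 := val _ r2.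
  have p20 : ev s p.2 = 0.
    apply/eqP; have /eqP : ev s p.2 * (t1 - t2) = 0.
      by rewrite mulrBr; apply/eqP; rewrite subr_eq0 -(inj_eq (addrI (ev s p.1))) e1 e2.
    by rewrite mulf_eq0 (negPf t12) orbF.
  by split=> //; move: e1; rewrite p20 mul0r addr0.
have [L1 L2] : L p.1 = 0 /\ L p.2 = 0.
  split; apply: L0 => z; have [->|/H[e1 e2]] := eqVneq (L (Pdisc C)).[z] 0;
    by rewrite ?mulr0 ?e1 ?e2 ?mul0r.
have p2 : ev (coord u) p.2 = 0.
  have : (L p.2).[0] = 0 by rewrite L2 horner0.
  by rewrite horner_line (eq_ev _ (along0 _ _)).
by rewrite fE (tangent_nf _ tD) !dif_line -!/(L _) L1 L2 p2 !deriv0 !horner0 mul0r mulr0 !addr0.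
Qed.

(** On the leaf t is constant, and p + q t becomes a polynomial in the s_i vanishing on a level set
    of (P, Q), to which [vanish_on_level] applies. Killing t and t' amounts to killing P = t + t'
    and Q = t t'. *)
Lemma tangent_leaf11 u D : unramified u -> ev (coord u) (Psum8 C) != 0 ->
  jacobian (coord u) != 0 ->
  tangent_sub (leaf Sigma11 (boundary_map Sigma11 u)) u D <->
  [/\ tangent u D, D (tcomm R) = 0 & D (tcomm' R) = 0].
Proof.
move=> nu A0 J0; split=> [[tD vanish]|[tD D0 D0']].
  split=> //; rewrite -(tangent_shift _ tD); apply: vanish => v [_];
    rewrite !boundary11 => -[e e']; rewrite charvarB charvarA.
    by rewrite -/(comm v) -/(comm u) e' subrr.
  by rewrite e subrr.
split=> // f vanish; have [p fE] := normal_formE f.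
pose q := (p.1 + p.2 * PCst (comm u))%P.
have dP : dif (coord u) (tvec D) (Psum C) = 0.
  by rewrite -(tangent_PE _ tD) -tcommD (tangentD tD) D0 D0' addr0.
have dQ : dif (coord u) (tvec D) (Pprod C) = 0.
  have := tangent_comm nu tD; rewrite D0 /comm_slope dP mulr0 sub0r => /esym/eqP.
  by rewrite mulf_eq0 invr_eq0 (negPf (unramifiedP nu)) orbF oppr_eq0 => /eqP.
suff dq : dif (coord u) (tvec D) q = 0.
  rewrite fE (tangent_nf _ tD) D0 mulr0 add0r -[RHS]dq /q /= evC mulr0 add0r.
  by [].
apply: (vanish_on_level A0 J0) => // x xP xQ.
have rel : comm u ^+ 2 = ev x (Psum C) * comm u - ev x (Pprod C).
  by rewrite xP xQ comm_rel.
have [v [vx vt]] := point_exists rel.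
rewrite /q evD evM evC -(eq_ev p.1 vx) -(eq_ev p.2 vx) -vt -charvar_nf -fE.
apply: vanish; split.
  by apply: unramified_smooth; rewrite /unramified PdiscE !(eq_ev _ vx) xP xQ -PdiscE.
by rewrite !boundary11 vt !charvar_comm' vt (eq_ev _ vx) xP.
Qed.

End Leaves.

(** * Goldman brackets *)

Section CombinatorialLoops.
Variable R : realType.
Local Notation C := R[i].

(* Loops whose crossings have parameters k / 20, so that linking is decided by
   computation on natural numbers. *)
Definition nloop : Type := seq (letter * nat).

Definition real_crossing (c : letter * nat) : crossing R := (c.1, c.2%:R / 20%:R).
Definition real_loop (a : nloop) : loop R := map real_crossing a.

Definition ncircle (S : surface) (c : letter * nat) : nat :=
  (index c.1 (sides S) * 20 + c.2)%N.
Definition nglue (c : letter * nat) : letter * nat := (inv_letter c.1, 20 - c.2)%N.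
Definition nchord (S : surface) (a : nloop) (i : nat) : nat * nat :=
  (ncircle S (nglue (nth (x1, 0%N) (rotr 1 a) i)), ncircle S (nth (x1, 0%N) a i)).
Definition nccw (p q r : nat) : bool := [|| p < q < r, q < r < p | r < p < q]%N.
Definition nsign (p q : nat * nat) : int :=
  if nccw p.1 q.1 p.2 && nccw p.2 q.2 p.1 then 1
  else if nccw p.1 q.2 p.2 && nccw p.2 q.1 p.1 then -1 else 0.
Definition ngeneric (S : surface) (a b : nloop) : bool :=
  all (fun c => 0 < c.2 < 20)%N (a ++ b)
  && uniq (map (ncircle S) (a ++ b) ++ map (ncircle S \o nglue) (a ++ b)).
Definition ncrossings (S : surface) (a b : nloop) : seq (nat * nat * int) :=
  [seq c <- [seq ((i, j), nsign (nchord S a i) (nchord S b j))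
               | i <- iota 0 (size a), j <- iota 0 (size b)] | c.2 != 0].

Let p20 : 0 < 20%:R^-1 :> R. Proof. by rewrite invr_gt0 ltr0n. Qed.

Lemma circle_point_real S c :
  circle_point S (real_crossing c) = (ncircle S c)%:R / 20%:R.
Proof.
by rewrite /circle_point /real_crossing /ncircle natrD natrM mulrDl mulfK ?pnatr_eq0.
Qed.

Lemma glue_real c : (c.2 <= 20)%N -> Defs.glue (real_crossing c) = real_crossing (nglue c).
Proof.
by move=> c20; rewrite /Defs.glue /real_crossing /nglue /= natrB // mulrBl divff ?pnatr_eq0.
Qed.

Lemma ccw_real (p q r : nat) :
  ccw (p%:R / 20%:R) (q%:R / 20%:R) (r%:R / 20%:R : R) = nccw p q r.
Proof. by rewrite /ccw /nccw !(ltr_pM2r p20) !ltr_nat. Qed.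

Lemma chord_real S a i : all (fun c => c.2 < 20)%N a -> (i < size a)%N ->
  chord S (real_loop a) i =
  ((nchord S a i).1%:R / 20%:R, (nchord S a i).2%:R / 20%:R).
Proof.
move=> a20 ia; rewrite /chord /nchord /real_loop.
have -> : (x1, 0 : R) = real_crossing (x1, 0%N) by rewrite /real_crossing mul0r.
rewrite -map_rotr !(nth_map (x1, 0%N)) ?size_rotr // glue_real ?circle_point_real //.
have /allP/(_ (nth (x1, 0%N) (rotr 1 a) i)) := a20.
by rewrite -(mem_rotr 1) mem_nth ?size_rotr // => /(_ isT)/ltnW.
Qed.

Lemma chord_sign_real S a b i j :
  all (fun c => c.2 < 20)%N a -> all (fun c => c.2 < 20)%N b ->
  (i < size a)%N -> (j < size b)%N ->
  chord_sign (chord S (real_loop a) i) (chord S (real_loop b) j) =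
  nsign (nchord S a i) (nchord S b j).
Proof.
move=> a20 b20 ia jb; rewrite !chord_real // /chord_sign /nsign /=.
by rewrite !ccw_real.
Qed.

Definition crossing_term (w w' : seq letter) (i j : nat) : char_ring R :=
  trace_word R (rot i w ++ rot j w')
  - (3%:R^-1 : C) *: (trace_word R w * trace_word R w').

Lemma goldman_crossings S br (a b : nloop) : goldman_bracket S br ->
  ngeneric S a b ->
  br (trace_word R (map fst a)) (trace_word R (map fst b)) =
  \sum_(c <- ncrossings S a b)
    crossing_term (map fst a) (map fst b) c.1.1 c.1.2 *~ c.2.
Proof.
move=> [_ brE] /andP[ab20 ab_uniq].
have wordE (d : nloop) : word_of (real_loop d) = map fst d.
  by rewrite /word_of /real_loop -map_comp.
have gen : generic_loops S (real_loop a) (real_loop b).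
  split.
    move=> c; rewrite -map_cat => /mapP[d dab ->] /=.
    have /allP/(_ d dab)/andP[d0 d20] := ab20.
    by rewrite divr_gt0 ?ltr0n //= ltr_pdivrMr ?ltr0n // mul1r ltr_nat.
  pose q (n : nat) : R := n%:R / 20%:R.
  have e1 : map (circle_point S) (real_loop (a ++ b)) =
      map q (map (ncircle S) (a ++ b)).
    by rewrite -!map_comp; apply: eq_map => c; exact: circle_point_real.
  have e2 : map (circle_point S \o @Defs.glue R) (real_loop (a ++ b)) =
      map q (map (ncircle S \o nglue) (a ++ b)).
    rewrite -!map_comp; apply/eq_in_map => c cab /=.
    rewrite glue_real ?circle_point_real //.
    by have /allP/(_ c cab)/andP[_ /ltnW] := ab20.
  rewrite -map_cat -/(real_loop (a ++ b)) e1 e2 -map_cat map_inj_uniq //.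
  by move=> m n /(mulIf (lt0r_neq0 p20)) /eqP; rewrite eqr_nat => /eqP.
have := brE _ _ gen; rewrite !wordE => ->.
have a20 : all (fun c => c.2 < 20)%N a.
  by apply/allP => c ca; have /allP/(_ c) := ab20; rewrite mem_cat ca => /(_ isT)/andP[].
have b20 : all (fun c => c.2 < 20)%N b.
  by apply/allP => c cb; have /allP/(_ c) := ab20; rewrite mem_cat cb orbT => /(_ isT)/andP[].
rewrite /goldman_sum /ncrossings big_filter [RHS]big_mkcond big_allpairs_dep /=.
rewrite /real_loop !size_map -/(real_loop a) -/(real_loop b).
have iotaE n : iota 0 n = index_iota 0 n by rewrite /index_iota subn0.
rewrite iotaE big_mkord; apply: eq_bigr => i _.
rewrite iotaE big_mkord; apply: eq_bigr => j _.
rewrite !wordE chord_sign_real //; by case: eqP => [->|_].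
Qed.

Lemma goldman_disjoint S br (a b : nloop) : goldman_bracket S br ->
  ngeneric S a b && nilp (ncrossings S a b) ->
  br (trace_word R (map fst a)) (trace_word R (map fst b)) = 0.
Proof.
move=> gb /andP[gen /nilP e].
by rewrite (goldman_crossings gb gen) e big_nil.
Qed.

Lemma goldman_single S br (a b : nloop) (i j : nat) (e : int) : goldman_bracket S br ->
  ngeneric S a b && (ncrossings S a b == [:: (i, j, e)]) ->
  br (trace_word R (map fst a)) (trace_word R (map fst b)) =
  crossing_term (map fst a) (map fst b) i j *~ e.
Proof.
move=> gb /andP[gen /eqP ce].
by rewrite (goldman_crossings gb gen) ce big_seq1.
Qed.

End CombinatorialLoops.

(** * Brackets of the coordinate traces on the two surfaces *)

Local Notation X1 := (inv_letter x1).
Local Notation X2 := (inv_letter x2).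

Section Brackets.
Variable R : realType.
Local Notation C := R[i].
Local Notation "f .[: g ]" := (\val f g) (at level 2, format "f .[:  g ]").

Definition bracket_entry (e : int) (p : pexp C) (k l : 'I_8) : pexp C :=
  (PCst e%:~R * (p - PCst 3^-1 * (PVar C k * PVar C l)))%P.

Lemma goldman_entry S br (a b : nloop) (i j : nat) (e : int) p k l :
  goldman_bracket S br ->
  ngeneric S a b && (ncrossings S a b == [:: (i, j, e)]) ->
  map fst a = coord_word k -> map fst b = coord_word l ->
  trace_word R (rot i (coord_word k) ++ rot j (coord_word l)) = PE p ->
  br (tc R k) (tc R l) = PE (bracket_entry e p k l).
Proof.
move=> gb chk ak bl pE; rewrite /tc -ak -bl (goldman_single gb chk) ak bl.
rewrite /crossing_term pE -!/(tc R _) /bracket_entry !(PEM, PED, PEC, PEX).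
rewrite !mulr_algl scaleN1r -scaler_int; congr (_ *: _).
Qed.

Lemma cayley_hamilton3 (F : fieldType) (A : 'M[F]_3) : \det A = 1 ->
  A *m A = \tr A *: A - \tr (invmx A) *: 1%:M + invmx A.
Proof.
move=> dA; rewrite invmx3 // !tr3.
by apply: mx3P; rewrite !mxE !sum3 ?mxE /= ?mulr1n ?mulr0n; ring.
Qed.

(** Cayley-Hamilton removes a repeated letter; this brings the words with a square that arise at
    crossings back to the eight traces. *)
Lemma tr_square_mul (F : fieldType) (A M : 'M[F]_3) : \det A = 1 ->
  \tr (A *m A *m M) = \tr A * \tr (A *m M) - \tr (invmx A) * \tr M
    + \tr (invmx A *m M).
Proof.
move=> dA; rewrite cayley_hamilton3 // !mulmxDl mulNmx !linearD linearN /=.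
by rewrite -!scalemxAl mul1mx !mxtraceZ.
Qed.

Lemma trace_word_PE w p : (forall g : rep2 R, \tr (rep_word g w) = ev (tg g) p) ->
  trace_word R w = PE p.
Proof. by move=> H; apply: char_ring_ext => g; rewrite trace_wordE PE_val. Qed.

Lemma rep_unit (g : rep2 R) : (val g).1 \in unitmx /\ (val g).2 \in unitmx.
Proof. by rewrite !unitmxE rep_det1 rep_det2 unitr1. Qed.

Ltac word_tac := apply: trace_word_PE => g; have [uA uB] := rep_unit g;
  rewrite !rep_word_cons rep_word_nil mulmx1.

Lemma tw_12 : trace_word R [:: x1; x2] = PE (PVar C o4).
Proof. by word_tac; rewrite evX tg4. Qed.
Lemma tw_1V2 : trace_word R [:: x1; X2] = PE (PVar C o6).
Proof. by word_tac; rewrite evX tg6. Qed.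
Lemma tw_V12 : trace_word R [:: X1; x2] = PE (PVar C o7).
Proof. by word_tac; rewrite evX tg7 mxtrace_mulC. Qed.
Lemma tw_V1V2 : trace_word R [:: X1; X2] = PE (PVar C o5).
Proof. by word_tac; rewrite evX tg5 mxtrace_mulC. Qed.
Lemma tw_1V1V2 : trace_word R [:: x1; X1; X2] = PE (PVar C o3).
Proof. by word_tac; rewrite evX tg3 mulKVmx. Qed.
Lemma tw_V121 : trace_word R [:: X1; x2; x1] = PE (PVar C o2).
Proof. by word_tac; rewrite evX tg2 mxtrace_mulC mulmxK. Qed.
Lemma tw_2V1V2 : trace_word R [:: x2; X1; X2] = PE (PVar C o1).
Proof. by word_tac; rewrite evX tg1 mxtrace_mulC mulmxKV. Qed.
Lemma tw_V221 : trace_word R [:: X2; x2; x1] = PE (PVar C o0).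
Proof. by word_tac; rewrite evX tg0 mulKmx. Qed.

Lemma tw_121 : trace_word R [:: x1; x2; x1] =
  PE (PVar C o0 * PVar C o4 - PVar C o1 * PVar C o2 + PVar C o7)%P.
Proof.
word_tac; rewrite !(evD, evM, evC, evX) tg0 tg1 tg2 tg4 tg7.
by rewrite mulmxA mxtrace_mulC mulmxA tr_square_mul ?rep_det1 // mulN1r [\tr (invmx _ *m _)]mxtrace_mulC.
Qed.

Lemma tw_V1V1V2 : trace_word R [:: X1; X1; X2] =
  PE (PVar C o1 * PVar C o5 - PVar C o0 * PVar C o3 + PVar C o6)%P.
Proof.
word_tac; rewrite !(evD, evM, evC, evX) tg0 tg1 tg3 tg5 tg6.
have dV : \det (invmx (val g).1) = 1 by rewrite det_inv rep_det1 invr1.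
rewrite mulmxA (tr_square_mul _ dV) invmxK mulN1r.
by rewrite [\tr (invmx _ *m invmx _)]mxtrace_mulC.
Qed.

Lemma tw_221 : trace_word R [:: x2; x2; x1] =
  PE (PVar C o2 * PVar C o4 - PVar C o3 * PVar C o0 + PVar C o6)%P.
Proof.
word_tac; rewrite !(evD, evM, evC, evX) tg0 tg2 tg3 tg4 tg6.
rewrite mulmxA tr_square_mul ?rep_det2 // mulN1r.
by rewrite [\tr (_ *m (val g).1)]mxtrace_mulC [\tr (invmx _ *m _)]mxtrace_mulC.
Qed.

Lemma tw_V2V1V2 : trace_word R [:: X2; X1; X2] =
  PE (PVar C o3 * PVar C o5 - PVar C o2 * PVar C o1 + PVar C o7)%P.
Proof.
word_tac; rewrite !(evD, evM, evC, evX) tg1 tg2 tg3 tg5 tg7.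
have dV : \det (invmx (val g).2) = 1 by rewrite det_inv rep_det2 invr1.
by rewrite mulmxA mxtrace_mulC mulmxA (tr_square_mul _ dV) invmxK mulN1r.
Qed.

(** The brackets of s1, ..., s6 above the diagonal; the pairs left to the default value have
    disjoint loops. *)
Definition torus_entry (i j : nat) : pexp C :=
  match i, j with
  | 0, 2 => bracket_entry 1 (PVar C o4) o0 o2
  | 0, 3 => bracket_entry (-1) (PVar C o6) o0 o3
  | 0, 4 => bracket_entry 1
      (PVar C o0 * PVar C o4 - PVar C o1 * PVar C o2 + PVar C o7) o0 o4
  | 0, 5 => bracket_entry (-1) (PVar C o3) o0 o5
  | 1, 2 => bracket_entry (-1) (PVar C o7) o1 o2
  | 1, 3 => bracket_entry 1 (PVar C o5) o1 o3
  | 1, 4 => bracket_entry (-1) (PVar C o2) o1 o4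
  | 1, 5 => bracket_entry 1
      (PVar C o1 * PVar C o5 - PVar C o0 * PVar C o3 + PVar C o6) o1 o5
  | 2, 4 => bracket_entry (-1)
      (PVar C o2 * PVar C o4 - PVar C o3 * PVar C o0 + PVar C o6) o2 o4
  | 2, 5 => bracket_entry 1 (PVar C o1) o2 o5
  | 3, 4 => bracket_entry 1 (PVar C o0) o3 o4
  | 3, 5 => bracket_entry (-1)
      (PVar C o3 * PVar C o5 - PVar C o2 * PVar C o1 + PVar C o7) o3 o5
  | _, _ => PCst 0
  end%P.

(** The parameters are chosen so that any two distinct loops among the first six cross at most
    once. *)
Definition torus_loop (i : 'I_8) : nloop := nth [::]
  [:: [:: (x1, 10)]; [:: (X1, 8)]; [:: (x2, 10)]; [:: (X2, 8)];
      [:: (x1, 8); (x2, 8)]; [:: (X2, 11); (X1, 11)];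
      [:: (x1, 10); (X2, 10)]; [:: (x2, 10); (X1, 10)]]%N i.

Lemma torus_loop_word i : map fst (torus_loop i) = coord_word i.
Proof. by elim/ord8_ind: i. Qed.

Lemma torus_bracket br (i j : 'I_8) : goldman_bracket Sigma11 br ->
  (i < j)%N -> (j < 6)%N -> br (tc R i) (tc R j) = PE (torus_entry i j).
Proof.
move=> gb.
have zero k l : ngeneric Sigma11 (torus_loop k) (torus_loop l)
    && nilp (ncrossings Sigma11 (torus_loop k) (torus_loop l)) ->
    br (tc R k) (tc R l) = PE (PCst 0).
  rewrite /tc -!torus_loop_word PEC scale0r; exact: goldman_disjoint.
have single k l m n e p : ngeneric Sigma11 (torus_loop k) (torus_loop l) &&
      (ncrossings Sigma11 (torus_loop k) (torus_loop l) == [:: (m, n, e)]) ->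
    trace_word R (rot m (coord_word k) ++ rot n (coord_word l)) = PE p ->
    br (tc R k) (tc R l) = PE (bracket_entry e p k l).
  by move=> chk; apply: (goldman_entry gb chk); exact: torus_loop_word.
elim/ord8_ind: i; elim/ord8_ind: j => // _ _.
- exact: (zero o0 o1 isT).
- exact: (single o0 o2 0 0 1 _ isT tw_12).
- exact: (single o0 o3 0 0 (-1) _ isT tw_1V2).
- exact: (single o0 o4 0 1 1 _ isT tw_121).
- exact: (single o0 o5 0 1 (-1) _ isT tw_1V1V2).
- exact: (single o1 o2 0 0 (-1) _ isT tw_V12).
- exact: (single o1 o3 0 0 1 _ isT tw_V1V2).
- exact: (single o1 o4 0 1 (-1) _ isT tw_V121).
- exact: (single o1 o5 0 1 1 _ isT tw_V1V1V2).
- exact: (zero o2 o3 isT).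
- exact: (single o2 o4 0 1 (-1) _ isT tw_221).
- exact: (single o2 o5 0 1 1 _ isT tw_2V1V2).
- exact: (single o3 o4 0 1 1 _ isT tw_V221).
- exact: (single o3 o5 0 1 (-1) _ isT tw_V2V1V2).
- exact: (zero o4 o5 isT).
Qed.

(** The loops [a] and [b] run along the boundary: the parameters 19/20 and 1/20 make each of their
    chords cut off a corner of the disc, away from the other loops. *)
Lemma torus_casimir br (i : 'I_8) : goldman_bracket Sigma11 br ->
  br (tcomm R) (tc R i) = 0 /\ br (tcomm' R) (tc R i) = 0.
Proof.
move=> gb.
pose a : nloop := [:: (x1, 19); (x2, 19); (X1, 19); (X2, 19)]%N.
pose b : nloop := [:: (x2, 1); (x1, 1); (X2, 1); (X1, 1)]%N.
have aE : tcomm R = trace_word R (map fst a) by [].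
have bE : tcomm' R = trace_word R (map fst b) by [].
rewrite aE bE /tc -torus_loop_word.
split; apply: (goldman_disjoint gb); by elim/ord8_ind: i.
Qed.

(** The first six loops are parallel to the boundary; [pants_boundary_loop] is a second copy of
    them, pushed further into the corners of the disc so as to meet none of the eight loops. *)
Definition pants_loop (i : 'I_8) : nloop := nth [::]
  [:: [:: (x1, 2)]; [:: (X1, 18)]; [:: (x2, 2)]; [:: (X2, 18)];
      [:: (x1, 18); (x2, 18)]; [:: (X2, 2); (X1, 2)];
      [:: (x1, 10); (X2, 10)]; [:: (x2, 8); (X1, 8)]]%N i.

Definition pants_boundary_loop (i : 'I_8) : nloop := nth [::]
  [:: [:: (x1, 1)]; [:: (X1, 19)]; [:: (x2, 1)]; [:: (X2, 19)];
      [:: (x1, 19); (x2, 19)]; [:: (X2, 1); (X1, 1)]]%N i.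

Lemma pants_casimir br (i j : 'I_8) : goldman_bracket Sigma30 br ->
  i \in boundary6 -> br (tc R i) (tc R j) = 0.
Proof.
move=> gb i6.
have jE : map fst (pants_loop j) = coord_word j by elim/ord8_ind: j.
have iE : map fst (pants_boundary_loop i) = coord_word i.
  by move: i6; elim/ord8_ind: i.
rewrite /tc -iE -jE; apply: (goldman_disjoint gb).
by move: i6; elim/ord8_ind: i {iE} => // _; elim/ord8_ind: j {jE}.
Qed.

(** The two loops cross twice with opposite signs: the terms in 1/3 cancel, and the two resolved
    words are conjugate to the commutator and its inverse. *)
Lemma pants_bracket br : goldman_bracket Sigma30 br ->
  br (tc R o6) (tc R o7) = tcomm R - tcomm' R.
Proof.
move=> gb.
pose k : char_ring R :=
  (3%:R^-1 : C) *: (trace_word R [:: x1; X2] * trace_word R [:: x2; X1]).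
have e : br (tc R o6) (tc R o7) = (trace_word R [:: x1; X2; X1; x2] - k) *~ (-1)
    + (trace_word R [:: X2; x1; x2; X1] - k).
  have := @goldman_crossings R Sigma30 br (pants_loop o6) (pants_loop o7) gb isT.
  rewrite (_ : ncrossings _ _ _ = [:: (0, 1, -1 : int); (1, 0, 1 : int)]%N) //.
  by rewrite !big_cons big_nil addr0 mulr1z; exact.
rewrite e mulrN1z opprB addrC addrA subrK.
congr (_ - _).
  apply: char_ring_ext => g; rewrite tcommE trace_wordE !rep_word_cons rep_word_nil mulmx1.
  by rewrite mxtrace_mulC !mulmxA.
apply: char_ring_ext => g; rewrite tcomm'E trace_wordE !rep_word_cons rep_word_nil mulmx1.
by rewrite !mulmxA mxtrace_mulC !mulmxA.
Qed.

End Brackets.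

(** * Generic invertibility of the bracket matrix on the torus *)

Section TorusMatrix.
Variable R : realType.
Local Notation C := R[i].
Implicit Types (s : 'I_8 -> C) (u : charvar R).

Definition torus_mx s : 'M[C]_6 := \matrix_(i, j)
  if (i < j)%N then ev s (torus_entry R i j)
  else if (j < i)%N then - ev s (torus_entry R j i) else 0.

Lemma torus_det_pexp : exists p : pexp C, forall s, ev s p = \det (torus_mx s).
Proof.
rewrite /determinant.
pose pol (F : _ -> C) := exists p : pexp C, forall s, ev s p = F s.
have polC c : pol (fun=> c) by exists (PCst c).
have polM F G : pol F -> pol G -> pol (fun s => F s * G s).
  by move=> [p pF] [q qG]; exists (PMul p q) => s; rewrite evM pF qG.
have polD F G : pol F -> pol G -> pol (fun s => F s + G s).
  by move=> [p pF] [q qG]; exists (PAdd p q) => s; rewrite evD pF qG.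
have pol_prod (r : seq 'I_6) G : (forall i, pol (G i)) ->
    pol (fun s => \prod_(i <- r) G i s).
  move=> pG; elim: r => [|i r [p pE]].
    by exists (PCst 1) => s; rewrite big_nil.
  have [q qE] := pG i; exists (PMul q p) => s.
  by rewrite big_cons evM pE qE.
have pol_sum (I : Type) (r : seq I) G : (forall i, pol (G i)) ->
    pol (fun s => \sum_(i <- r) G i s).
  move=> pG; elim: r => [|i r [p pE]].
    by exists (PCst 0) => s; rewrite big_nil.
  have [q qE] := pG i; exists (PAdd q p) => s.
  by rewrite big_cons evD pE qE.
have pol_entry i j : pol (fun s => torus_mx s i j).
  case: (ltngtP i j) => ij.
  - by exists (torus_entry R i j) => s; rewrite mxE ij.
  - exists (PCst (-1) * torus_entry R j i)%P => s.
    by rewrite evM evC mulN1r mxE ltnNge (ltnW ij) /= ij.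
  - by exists (PCst 0) => s; rewrite mxE ij ltnn.
apply: pol_sum => w; apply: (polM (fun=> _)); first exact: polC.
by apply: pol_prod => i; exact: pol_entry.
Qed.

(** At this point s7 = 1 is the only nonzero coordinate, and the only surviving brackets are {s1,
    s4} = {s3, s5} = -1 and {s2, s6} = 1: a skew signed permutation matrix, whose square is -1. *)
Lemma torus_det_base : \det (torus_mx (base_pt R)) != 0.
Proof.
have e : torus_mx (base_pt R) *m (- torus_mx (base_pt R)) = 1%:M.
  apply/matrixP => i j; rewrite mxE.
  rewrite 6!big_ord_recl big_ord0 !mxE.
  case: i => [[|[|[|[|[|[|//]]]]]] ip]; case: j => [[|[|[|[|[|[|//]]]]]] jp];
    rewrite /= /bump /=; rewrite /bracket_entry /= /ev /=; ring.
have := congr1 determinant e; rewrite det_mulmx det1 => /eqP.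
by apply: contraTneq => ->; rewrite mul0r eq_sym oner_eq0.
Qed.

Definition bd (i : 'I_6) : 'I_8 := widen_ord (isT : (6 <= 8)%N) i.

Lemma torus_mxE br u (i j : 'I_6) : goldman_bracket Sigma11 br ->
  u (br (tc R (bd i)) (tc R (bd j))) = torus_mx (coord u) i j.
Proof.
move=> gb; have [[_ anti _ _] _] := gb.
rewrite mxE; case: (ltngtP i j) => ij.
- by rewrite (@torus_bracket _ _ (bd i) (bd j) gb ij (ltn_ord j)) charvar_PE.
- rewrite anti (@torus_bracket _ _ (bd j) (bd i) gb ij (ltn_ord i)) -charvar_PE.
  exact: rmorphN.
have <- : i = j by apply: val_inj.
have : u (br (tc R (bd i)) (tc R (bd i))) = - u (br (tc R (bd i)) (tc R (bd i))).
  by rewrite {1}anti; exact: rmorphN.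
move/eqP; rewrite -addr_eq0 -mulr2n -mulr_natl mulf_eq0 pnatr_eq0 /=.
by move/eqP.
Qed.

End TorusMatrix.

(** * Symplectic duality *)

Section SymplecticLinearAlgebra.
Variables (R : realType) (V : lmodType R[i]).
Local Notation C := R[i].
Implicit Types (W : set V) (w : V -> V -> C) (D E : V).

Definition linear_subspace W : Prop :=
  W 0 /\ forall (c : C) D E, W D -> W E -> W (c *: D + E).

Lemma linear_subspaceB W D E : linear_subspace W -> W D -> W E -> W (D - E).
Proof. by move=> [_ WL] WD WE; rewrite addrC -scaleN1r; exact: WL. Qed.

Lemma symplectic0l W w E : linear_subspace W -> symplectic_on W w -> W E -> w 0 E = 0.
Proof.
move=> [W0 _] [wL _ _] WE; have := wL (-1) 0 0 E W0 W0 WE.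
by rewrite scaler0 addr0 mulN1r addNr.
Qed.

Lemma symplectic0r W w D : linear_subspace W -> symplectic_on W w -> W D -> w D 0 = 0.
Proof.
move=> lW sw WD; have [W0 _] := lW; have [_ wA _] := sw.
by rewrite wA // (symplectic0l lW sw WD) oppr0.
Qed.

Lemma direct_sum_uniq W W1 W2 D1 D2 E1 E2 : direct_sum W W1 W2 ->
  linear_subspace W1 -> linear_subspace W2 ->
  W1 D1 -> W1 E1 -> W2 D2 -> W2 E2 -> D1 + D2 = E1 + E2 -> D1 = E1 /\ D2 = E2.
Proof.
move=> [_ W12] l1 l2 WD1 WE1 WD2 WE2 e.
have e' : D1 - E1 = E2 - D2.
  by rewrite -[D1](addrK D2) e addrAC [E1 + E2]addrC addrK.
have : (W1 `&` W2) (D1 - E1).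
  by split; [exact: linear_subspaceB | rewrite e'; exact: linear_subspaceB].
rewrite W12 => /= z; split; apply/eqP; first by rewrite -subr_eq0 z.
by rewrite eq_sym -subr_eq0 -e' z.
Qed.

(** The components picked by [xget] are forced by the uniqueness of the decomposition. *)
Lemma product_formE W W1 W2 w1 w2 D1 D2 E1 E2 : direct_sum W W1 W2 ->
  linear_subspace W1 -> linear_subspace W2 ->
  W1 D1 -> W1 E1 -> W2 D2 -> W2 E2 ->
  product_form W1 W2 w1 w2 (D1 + D2) (E1 + E2) = w1 D1 E1 + w2 D2 E2.
Proof.
move=> ds l1 l2 WD1 WE1 WD2 WE2; rewrite /product_form.
have split_eq F1 F2 : W1 F1 -> W2 F2 ->
    xget (0, 0) [set p | [/\ W1 p.1, W2 p.2 & F1 + F2 = p.1 + p.2]] = (F1, F2).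
  move=> WF1 WF2; case: xgetP => [[G1 G2] _ [/= WG1 WG2 e]|/(_ (F1, F2)) []//].
  by have [-> ->] := direct_sum_uniq ds l1 l2 WF1 WG1 WF2 WG2 e.
by rewrite !split_eq.
Qed.

Lemma direct_sum_symplectic_duals W W1 W2 w1 w2 : direct_sum W W1 W2 ->
  linear_subspace W1 -> linear_subspace W2 ->
  symplectic_on W1 w1 -> symplectic_on W2 w2 ->
  symplectic_duals W (product_form W1 W2 w1 w2) W1 W2.
Proof.
move=> ds l1 l2 s1 s2; have [W1_0 _] := l1; have [W2_0 _] := l2.
have [WE _] := ds; have pfE := product_formE w1 w2 ds l1 l2.
have in1 D : W1 D -> W D by move=> WD; rewrite WE; exists D, 0; rewrite addr0.
have in2 D : W2 D -> W D by move=> WD; rewrite WE; exists 0, D; rewrite add0r.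
split; apply/seteqP; split=> D.
- move=> WD; split=> [|E WE2]; first exact: in1.
  rewrite -[D]addr0 -[E]add0r pfE //.
  by rewrite (symplectic0r l1 s1 WD) (symplectic0l l2 s2 WE2) addr0.
- rewrite /symplectic_complement /= WE => -[[D1 [D2 [WD1 WD2 ->]]] orth].
  suff -> : D2 = 0 by rewrite addr0.
  have [_ _ nondeg] := s2; apply: nondeg => // E WE2.
  have := orth E WE2; rewrite -{1}[E]add0r pfE //.
  by rewrite (symplectic0r l1 s1 WD1) add0r.
- move=> WD; split=> [|E WE1]; first exact: in2.
  rewrite -[D]add0r -[E]addr0 pfE //.
  by rewrite (symplectic0l l1 s1 WE1) (symplectic0r l2 s2 WD) addr0.
- rewrite /symplectic_complement /= WE => -[[D1 [D2 [WD1 WD2 ->]]] orth].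
  suff -> : D1 = 0 by rewrite add0r.
  have [_ _ nondeg] := s1; apply: nondeg => // E WE1.
  have := orth E WE1; rewrite -{1}[E]addr0 pfE //.
  by rewrite (symplectic0r l2 s2 WD2) addr0.
Qed.

End SymplecticLinearAlgebra.

(** * Hamiltonian vectors and the symplectic form they carry *)

Section Hamiltonian.
Variable R : realType.
Local Notation C := R[i].
Variables (br : char_ring R -> char_ring R -> char_ring R) (u : charvar R).
Hypothesis pb : poisson_bracket br.

Lemma hamiltonian_anti f g : hamiltonian br f u g = - hamiltonian br g u f.
Proof. by have [_ anti _ _] := pb; rewrite /hamiltonian anti; exact: rmorphN. Qed.

Lemma hamiltonian_tangent f : tangent u (hamiltonian br f u).
Proof.
have [lin _ leib _] := pb; split=> [c g1 g2|g1 g2].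
  by rewrite /hamiltonian lin charvarD charvarZ.
by rewrite /hamiltonian leib charvarD !charvarM addrC [_ * u g2]mulrC.
Qed.

Lemma hamiltonian_comb c f g :
  hamiltonian br (c *: f + g) u = c *: hamiltonian br f u + hamiltonian br g u.
Proof.
apply/funext => h; rewrite hamiltonian_anti (tangentL (hamiltonian_tangent h)).
by rewrite opprD -mulrN -!hamiltonian_anti.
Qed.

Lemma hamiltonian_sum n (c : 'I_n -> C) (f : 'I_n -> char_ring R) g :
  hamiltonian br (\sum_i c i *: f i) u g = \sum_i c i * hamiltonian br (f i) u g.
Proof.
have tH := hamiltonian_tangent g.
rewrite hamiltonian_anti.
elim/big_rec2: _ => [|i x h _ <-]; first by rewrite (tangent0r tH) oppr0.
by rewrite (tangentL tH) opprD -mulrN -(hamiltonian_anti (f i)).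
Qed.

(** For D = H_f and E = H_g the form has to be {g, f} = E f, so a potential f is chosen for each D.
    By antisymmetry the value is also - D g, hence independent of the choice. If it vanishes for all
    E, then D g = 0 for every g. *)
Lemma leaf_form_exists L : tangent_sub L u = range (hamiltonian br ^~ u) ->
  exists w, leaf_form br L u w.
Proof.
move=> TE.
pose pot D : char_ring R := xget 0 [set f | hamiltonian br f u = D].
have potE f : hamiltonian br (pot (hamiltonian br f u)) u = hamiltonian br f u.
  by rewrite /pot; case: xgetP => [g _ //|/(_ f) []].
have potT D : tangent_sub L u D -> hamiltonian br (pot D) u = D.
  by rewrite TE => -[f _ <-].
have wE D E : tangent_sub L u D -> tangent_sub L u E -> E (pot D) = - D (pot E).
  by move=> TD TF; rewrite -{1}(potT E TF) hamiltonian_anti potT.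
exists (fun D E => E (pot D)); split=> //; last first.
  by move=> f g; rewrite hamiltonian_anti potE -hamiltonian_anti.
split=> [c D1 D2 E T1 T2 TF|D E|D TD D0].
- have T12 : tangent_sub L u (c *: D1 + D2).
    rewrite TE -(potT D1 T1) -(potT D2 T2) -hamiltonian_comb.
    by exists (c *: pot D1 + pot D2).
  rewrite (wE _ _ T12 TF) (wE _ _ T1 TF) (wE _ _ T2 TF).
  by rewrite -[(c *: D1 + D2) _]/(c * D1 (pot E) + D2 (pot E)) opprD -mulrN.
- exact: wE.
apply/funext => f; have := D0 (hamiltonian br f u).
rewrite hamiltonian_anti potT // TE => /(_ (ex_intro2 _ _ f I erefl))/eqP.
by rewrite oppr_eq0 => /eqP.
Qed.

End Hamiltonian.

(** * The two leaves through a generic point *)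

Section TransverseLeaves.
Variable R : realType.
Local Notation C := R[i].
Variable u : charvar R.
Implicit Types (D E : char_ring R -> C).
Hypothesis nu : unramified u.
Hypothesis A0 : ev (coord u) (Psum8 C) != 0.
Hypothesis J0 : jacobian (coord u) != 0.
Local Notation s := (coord u).
Local Notation T1 := (tangent_sub (leaf Sigma11 (boundary_map Sigma11 u)) u).
Local Notation T3 := (tangent_sub (leaf Sigma30 (boundary_map Sigma30 u)) u).

Lemma tangent_sub_subspace (L : set (charvar R)) : linear_subspace (tangent_sub L u).
Proof.
split; first by split; [exact: tangent0 | ].
move=> c D E [tD D0] [tE E0]; split; first exact: tangent_comb.
move=> f Lf; rewrite -[LHS]/(c * D f + E f) D0 // E0 // mulr0.
exact: addr0.
Qed.

Lemma tangent_boundary11 D : tangent u D ->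
  D (tcomm R) = 0 /\ D (tcomm' R) = 0 <->
  dif s (tvec D) (Psum C) = 0 /\ dif s (tvec D) (Pprod C) = 0.
Proof.
move=> tD; have nz := unramifiedP nu.
have Dsum : D (tcomm R) + D (tcomm' R) = dif s (tvec D) (Psum C).
  by rewrite -(tangentD tD) tcommD (tangent_PE _ tD).
have := tangent_comm nu tD; rewrite /comm_slope.
split=> [[D1 D2]|[P0 Q0]].
  have P0 : dif s (tvec D) (Psum C) = 0 by rewrite -Dsum D1 D2 addr0.
  move: H; rewrite D1 P0 mulr0 sub0r mulNr => /eqP.
  rewrite eq_sym oppr_eq0 mulf_eq0 invr_eq0 (negPf nz) orbF => /eqP //.
have D1 : D (tcomm R) = 0 by rewrite H P0 Q0 mulr0 subr0 mul0r.
by move: Dsum; rewrite D1 add0r P0.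
Qed.

Definition fiber_vec (a b : C) (i : 'I_8) : C := a * unit6 C i + b * unit7 C i.

Lemma dif_fiber a b p :
  dif s (fiber_vec a b) p = a * dif s (unit6 C) p + b * dif s (unit7 C) p.
Proof.
rewrite /fiber_vec dif_linear; congr (_ + _).
rewrite -[RHS]addr0 -(dif0 s p) -dif_linear.
by apply: eq_dif => // i; rewrite addr0.
Qed.

Lemma fiber_vec6 a b : fiber_vec a b o6 = a.
Proof. by rewrite /fiber_vec /unit6 /unit7 /= mulr1 mulr0 addr0. Qed.

Lemma fiber_vec7 a b : fiber_vec a b o7 = b.
Proof. by rewrite /fiber_vec /unit6 /unit7 /= mulr1 mulr0 add0r. Qed.

Lemma fiber_vec_boundary a b : {in boundary6, forall i, fiber_vec a b i = 0}.
Proof.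
move=> i; rewrite !inE /fiber_vec /unit6 /unit7.
by move=> /or4P[|||/or3P[||]] /eqP -> /=; rewrite !mulr0 !addr0.
Qed.

Lemma fiber_vecE (c : 'I_8 -> C) : {in boundary6, forall i, c i = 0} ->
  c =1 fiber_vec (c o6) (c o7).
Proof.
move=> c0; elim/ord8_ind; rewrite ?fiber_vec6 ?fiber_vec7 //;
  by rewrite fiber_vec_boundary ?c0.
Qed.

(** A vector of [T3] moves only [o6] and [o7]; if it is also in [T1], then dP and dQ kill it, and
    the Jacobian makes them independent on this plane. *)
Lemma leaves_meet_trivially D : T1 D -> T3 D -> D = 0.
Proof.
move=> /(tangent_leaf11 D nu A0 J0)[tD c1 c2] /(tangent_leaf30 D nu)[_ /fiber_vecE De].
have /(tangent_boundary11 tD)[] := conj c1 c2.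
rewrite !(eq_dif _ (frefl _) De) !dif_fiber => eP eQ.
move: J0; rewrite /jacobian.
move: (dif s (unit6 C) (Psum C)) (dif s (unit7 C) (Psum C))
  (dif s (unit6 C) (Pprod C)) (dif s (unit7 C) (Pprod C)) eP eQ => p q p' q' eP eQ J.
have d6 : tvec D o6 = 0.
  apply: (mulIf J); rewrite mul0r.
  transitivity (q' * (tvec D o6 * p + tvec D o7 * q)
    - q * (tvec D o6 * p' + tvec D o7 * q')); first by ring.
  by rewrite eP eQ !mulr0 subr0.
have d7 : tvec D o7 = 0.
  apply: (mulIf J); rewrite mul0r.
  transitivity (p * (tvec D o6 * p' + tvec D o7 * q')
    - p' * (tvec D o6 * p + tvec D o7 * q)); first by ring.
  by rewrite eP eQ !mulr0 subr0.
apply: (tangent_inj nu tD (tangent0 u)) => i.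
by rewrite De d6 d7 /fiber_vec !mul0r !addr0.
Qed.

(** Cramer's rule gives E in [T3] on which dP and dQ take the same values as on D; then D - E is in
    [T1]. *)
Lemma leaves_direct_sum : direct_sum (tangent u) T1 T3.
Proof.
split; last first.
  apply/seteqP; split=> [D [D1 D3]|D -> /=]; first exact: leaves_meet_trivially.
  by have [] := tangent_sub_subspace (leaf Sigma11 (boundary_map Sigma11 u));
    have [] := tangent_sub_subspace (leaf Sigma30 (boundary_map Sigma30 u)).
apply/seteqP; split=> [D tD|D [D1 [D3 [[t1 _] [t3 _] ->]]]]; last first.
  by rewrite -[D1]scale1r; exact: tangent_comb.
pose p := dif s (unit6 C) (Psum C); pose q := dif s (unit7 C) (Psum C).
pose p' := dif s (unit6 C) (Pprod C); pose q' := dif s (unit7 C) (Pprod C).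
pose dP := dif s (tvec D) (Psum C); pose dQ := dif s (tvec D) (Pprod C).
pose J := p * q' - q * p'.
have J_neq0 : J != 0 := J0.
have [E [tE Ec]] := tangent_exists
  (fiber_vec ((q' * dP - q * dQ) / J) ((p * dQ - p' * dP) / J)) nu.
have tDE : tangent u (D - E).
  by rewrite addrC -scaleN1r; exact: tangent_comb.
exists (D - E), E; rewrite subrK; split=> //.
- apply/(tangent_leaf11 _ nu A0 J0).
  have tvecB : tvec (D - E) =1 (fun i => (-1) * tvec E i + tvec D i).
    by move=> i; rewrite mulN1r addrC.
  suff /(tangent_boundary11 tDE)[-> ->] : dif s (tvec (D - E)) (Psum C) = 0 /\
      dif s (tvec (D - E)) (Pprod C) = 0 by [].
  split; rewrite (eq_dif _ (frefl _) tvecB) dif_linear (eq_dif _ (frefl _) Ec) dif_fiber.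
    rewrite -/p -/q -/dP; clearbody p q p' q' dP dQ; rewrite /J in J_neq0 *; field.
    exact: J_neq0.
  rewrite -/p' -/q' -/dQ; clearbody p q p' q' dP dQ; rewrite /J in J_neq0 *; field.
  exact: J_neq0.
- apply/(tangent_leaf30 _ nu); split=> // i i6.
  by rewrite Ec fiber_vec_boundary.
Qed.

(** A derivation at an unramified point is determined by the eight coordinates, so vanishing
    brackets with them extend to the whole ring. *)
Lemma hamiltonian_casimir br f : poisson_bracket br ->
  (forall i, br f (tc R i) = 0) -> hamiltonian br f u = 0.
Proof.
move=> pb f0; apply: (tangent_inj nu (hamiltonian_tangent u pb f) (tangent0 u)) => i.
by rewrite /tvec /hamiltonian f0; exact: rmorph0.
Qed.

(** Inverting the bracket matrix gives a combination f of s1, ..., s6 whose Hamiltonian vector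
    agrees with D on s1, ..., s6. The difference is then in both [T1] and [T3], hence 0. *)
Lemma torus_leaf_range br : goldman_bracket Sigma11 br ->
  \det (torus_mx s) != 0 -> T1 = range (hamiltonian br ^~ u).
Proof.
move=> gb detM; have [pb _] := gb.
have ham1 f : T1 (hamiltonian br f u).
  apply/(tangent_leaf11 _ nu A0 J0); split; first exact: hamiltonian_tangent.
    rewrite (hamiltonian_anti u pb) (hamiltonian_casimir pb) ?oppr0 // => i.
    by have [] := torus_casimir i gb.
  rewrite (hamiltonian_anti u pb) (hamiltonian_casimir pb) ?oppr0 // => i.
  by have [] := torus_casimir i gb.
apply/seteqP; split=> [D D1|_ [f _ <-]]; last exact: ham1.
have M_unit : torus_mx s \in unitmx by rewrite unitmxE unitfE.
pose d := \row_(j < 6) tvec D (bd j).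
pose y := d *m invmx (torus_mx s).
pose f := \sum_i y 0 i *: tc R (bd i).
exists f => //; apply/eqP; rewrite eq_sym -subr_eq0; apply/eqP.
have l1 := tangent_sub_subspace (leaf Sigma11 (boundary_map Sigma11 u)).
have B1 := linear_subspaceB l1 D1 (ham1 f).
apply: leaves_meet_trivially => //.
apply/(tangent_leaf30 _ nu); split; first by have [] := B1.
have bd0 j : tvec (D - hamiltonian br f u) (bd j) = 0.
  rewrite -[LHS]/(D (tc R (bd j)) - hamiltonian br f u (tc R (bd j))).
  rewrite (hamiltonian_sum u pb).
  have /matrixP/(_ 0 j) : y *m torus_mx s = d by rewrite mulmxKV.
  rewrite !mxE -/(tvec D (bd j)) => <-; apply/eqP; rewrite subr_eq0; apply/eqP.
  by apply: eq_bigr => i _; rewrite -(torus_mxE u i j gb).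
move=> i; rewrite !inE => /or4P[|||/or3P[||]] /eqP ->.
- by have := bd0 (@Ordinal 6 0 isT); rewrite (_ : bd _ = o0) //; exact: val_inj.
- by have := bd0 (@Ordinal 6 1 isT); rewrite (_ : bd _ = o1) //; exact: val_inj.
- by have := bd0 (@Ordinal 6 2 isT); rewrite (_ : bd _ = o2) //; exact: val_inj.
- by have := bd0 (@Ordinal 6 3 isT); rewrite (_ : bd _ = o3) //; exact: val_inj.
- by have := bd0 (@Ordinal 6 4 isT); rewrite (_ : bd _ = o4) //; exact: val_inj.
- by have := bd0 (@Ordinal 6 5 isT); rewrite (_ : bd _ = o5) //; exact: val_inj.
Qed.

Lemma pants_leaf_range br : goldman_bracket Sigma30 br ->
  T3 = range (hamiltonian br ^~ u).
Proof.
move=> gb; have [pb _] := gb.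
apply/seteqP; split=> [D /(tangent_leaf30 _ nu)[tD /fiber_vecE De]|_ [f _ <-]].
  pose k := 2 * comm u - ev s (Psum C).
  have k0 : k != 0 := unramifiedP nu.
  have H67 : hamiltonian br (tc R o6) u (tc R o7) = k.
    rewrite /hamiltonian (pants_bracket gb) charvarB charvar_comm' -/(comm u) /k.
    by ring.
  have HT := hamiltonian_tangent u pb.
  have H66 f : hamiltonian br f u f = 0.
    have /eqP := hamiltonian_anti u pb f f.
    by rewrite -addr_eq0 -mulr2n -mulr_natl mulf_eq0 pnatr_eq0 => /eqP.
  (* Since {s7, s8} = k, the Hamiltonian vector of s7 is k times the direction of s8, and that of s8
     is -k times the direction of s7. *)
  exists ((tvec D o7 / k) *: tc R o6 + (- tvec D o6 / k) *: tc R o7) => //.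
  apply: (tangent_inj nu (HT _) tD) => i; rewrite /tvec.
  rewrite (hamiltonian_anti u pb) (tangentL (HT _)) (tangentZ (HT _)).
  have Hbd j : j \in boundary6 -> hamiltonian br (tc R j) u = 0.
    by move=> j6; apply: (hamiltonian_casimir pb) => i'; exact: pants_casimir.
  have H76 : hamiltonian br (tc R o7) u (tc R o6) = - k.
    by rewrite (hamiltonian_anti u pb) H67.
  have z6 j : j \in boundary6 -> tvec D j = 0.
    by move=> j6; rewrite De fiber_vec_boundary.
  have bdcase j : j \in boundary6 ->
      - (tvec D o7 / k * hamiltonian br (tc R j) u (tc R o6)
         + - tvec D o6 / k * hamiltonian br (tc R j) u (tc R o7)) = D (tc R j).
    move=> j6; have H0 f : hamiltonian br (tc R j) u f = 0 by rewrite Hbd.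
    by rewrite !H0 -/(tvec D j) (z6 j) // !mulr0 addr0 oppr0.
  elim/ord8_ind: i; try exact: bdcase.
    by rewrite H66 H67 mulr0 add0r divfK // opprK.
  by rewrite H66 H76 mulr0 addr0 mulrN opprK divfK.
have [HT f6] : tangent u (hamiltonian br f u) /\
    {in boundary6, forall i, tvec (hamiltonian br f u) i = 0}.
  split; first exact: hamiltonian_tangent.
  move=> j j6; rewrite /tvec (hamiltonian_anti u pb) (hamiltonian_casimir pb) ?oppr0 // => i.
  exact: pants_casimir.
by apply/(tangent_leaf30 _ nu).
Qed.

End TransverseLeaves.

(** * Density *)

Section ArchimedeanComplex.
Variable R : realType.
Local Notation C := R[i].

Lemma complex_bound (x : C) : 0 <= x -> exists n : nat, x < n%:R.
Proof.
move=> x0; exists (Num.bound (complex.Re x)).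
have xE : (complex.Re x)%:C%C = x by rewrite RRe_real // ger0_real.
have : 0 <= complex.Re x by rewrite -ler0c xE.
move=> /archi_boundP; rewrite -ltcR xE => /lt_le_trans; apply.
by rewrite rmorph_nat.
Qed.

End ArchimedeanComplex.

(** * The Euclidean topology read on s1, ..., s8 and t *)

Section CharvarTopology.
Variable R : realType.
Local Notation C := R[i].
Implicit Types (u v : charvar R).

Lemma charvar_open_neq0 (f : char_ring R) : open [set u : charvar R | u f != 0].
Proof.
exists [set g : {ptws char_ring R -> C^o} | g f != 0]; last by [].
rewrite openE => g /= gf; rewrite /interior.
have cont : g' f @[g' --> g] --> (g f : C^o).
  exact: (@proj_continuous (char_ring R) (fun=> C^o) f g).
apply: (cont [set z : C^o | z != 0]).
apply: open_nbhs_nbhs; split=> //.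
rewrite (_ : [set _ | _] = ~` [set 0]); last first.
  by apply/seteqP; split=> z /= /eqP.
apply: closed_openC; apply: accessible_closed_set1.
apply: hausdorff_accessible; exact: norm_hausdorff.
Qed.

Definition near_point u (n : nat) : set (charvar R) :=
  [set v | (forall i, `|coord v i - coord u i| <= n.+1%:R^-1) /\
           `|comm v - comm u| <= n.+1%:R^-1].

Definition coord_nbhs u : set_system (charvar R) :=
  [set B | exists n, near_point u n `<=` B].

Lemma coord_nbhs_filter u : Filter (coord_nbhs u).
Proof.
split; first by exists 0.
- move=> A B [m mA] [n nB]; exists (maxn m n) => v [v1 v2].
  have le k : (k <= maxn m n)%N -> ((maxn m n).+1%:R^-1 : C) <= k.+1%:R^-1.
    by move=> kmn; rewrite lef_pV2 ?posrE ?ltr0n // ler_nat ltnS.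
  split; [apply: mA | apply: nB]; split=> [i|].
  + exact: le_trans (v1 i) (le _ (leq_maxl _ _)).
  + exact: le_trans v2 (le _ (leq_maxl _ _)).
  + exact: le_trans (v1 i) (le _ (leq_maxr _ _)).
  + exact: le_trans v2 (le _ (leq_maxr _ _)).
- by move=> A B AB [n nA]; exists n; exact: subset_trans AB.
Qed.

Lemma inv_nat_le (x e : C) : 0 <= x -> 0 < e ->
  exists n : nat, forall m, (n <= m)%N -> x * m.+1%:R^-1 < e.
Proof.
move=> x0 e0; have [n xn] := complex_bound (divr_ge0 x0 (ltW e0)).
exists n => m nm; rewrite ltr_pdivrMr ?ltr0n // mulrC -ltr_pdivrMr //.
by apply: (lt_trans xn); rewrite ltr_nat ltnS.
Qed.

Lemma regular_near u (f : char_ring R) : exists2 K : C, 0 <= K &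
  forall n v, near_point u n v -> `|v f - u f| <= K * n.+1%:R^-1.
Proof.
have [[p q] ->] := normal_formE f.
have [K1 K1_0 H1] := pexp_lipschitz p (coord u).
have [K2 K2_0 H2] := pexp_lipschitz q (coord u).
exists (K1 + (K2 * (`|comm u| + 1) + `|ev (coord u) q|)) => [|n v [vn vc]].
  by rewrite !(addr_ge0, mulr_ge0).
rewrite !charvar_nf /=; set r := n.+1%:R^-1 in vn vc *.
have r0 : 0 <= r by rewrite invr_ge0.
have r1 : r <= 1 by rewrite invf_le1 ?ltr0n // ler1n.
have vE : coord v =1 shift (coord u) (fun i => coord v i - coord u i).
  by move=> i; rewrite /shift addrC subrK.
have {}H1 := H1 r _ r1 vn; have {}H2 := H2 r _ r1 vn.
rewrite -!(eq_ev _ vE) in H1 H2.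
have c1 : `|comm v| <= `|comm u| + 1.
  rewrite -[comm v](subrK (comm u)) addrC; apply: le_trans (ler_normD _ _) _.
  by rewrite lerD2l; exact: le_trans vc r1.
rewrite opprD addrACA mulrDl; apply: le_trans (ler_normD _ _) _; apply: lerD => //.
have -> : ev (coord v) q * comm v - ev (coord u) q * comm u =
  (ev (coord v) q - ev (coord u) q) * comm v + ev (coord u) q * (comm v - comm u).
  by ring.
apply: le_trans (ler_normD _ _) _; rewrite [leRHS]mulrDl; apply: lerD.
  by rewrite normrM mulrAC ler_pM.
by rewrite normrM ler_wpM2l.
Qed.

(** Regular functions are polynomials in the s_i and t, hence continuous for the coordinate
    neighbourhoods; these are therefore at least as fine as the initial topology, and density can be
    tested on them. *)
Lemma nbhs_near u (W : set (charvar R)) : nbhs u W -> exists n, near_point u n `<=` W.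
Proof.
have FF := coord_nbhs_filter u.
suff cvg : charvar_eval v @[v --> coord_nbhs u] --> charvar_eval u.
  rewrite nbhsE => -[_ [[B oB <-] Bu] BW].
  have [n nB] : coord_nbhs u (@charvar_eval R @^-1` B).
    exact: (cvg B (open_nbhs_nbhs (conj oB Bu))).
  by exists n; exact: subset_trans BW.
apply/cvg_sup => f A; rewrite nbhsE => -[_ [[B oB <-] Bu] BA].
have /nbhs_ballP[e /= e0 eB] := open_nbhs_nbhs (conj oB Bu).
have [K K0 KP] := regular_near u f.
have [n nP] := inv_nat_le K0 e0.
exists n => v vn; apply: BA; apply: eB.
rewrite -ball_normE /ball_ /= distrC.
exact: le_lt_trans (KP n v vn) (nP n _).
Qed.

End CharvarTopology.

(** t^2 - P t + Q = (t1 - t) (t2 - t), and the product would exceed r^2 if both factors exceeded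
    r. *)
Lemma near_root (R : realType) (P Q t r : R[i]) :
  P ^+ 2 - 4 * Q != 0 -> 0 <= r -> `|t ^+ 2 - P * t + Q| < r * r ->
  exists2 t', t' ^+ 2 = P * t' - Q & `|t' - t| <= r.
Proof.
move=> /quadratic_roots[t1 [t2 [root1 root2 t12]]] r0 near.
have [r1|r1] := real_leP (normr_real (t1 - t)) (ger0_real r0); first by exists t1.
have [r2|r2] := real_leP (normr_real (t2 - t)) (ger0_real r0); first by exists t2.
have PE : P = t1 + t2.
  apply: (mulIf t12); transitivity ((P * t1 - Q) - (P * t2 - Q)); first by ring.
  by rewrite -root1 -root2; ring.
have QE : Q = t1 * t2.
  by transitivity (P * t1 - t1 ^+ 2); [rewrite root1; ring | rewrite PE; ring].
have : r * r < `|t ^+ 2 - P * t + Q|.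
  rewrite (_ : _ + Q = (t1 - t) * (t2 - t)); last by rewrite PE QE; ring.
  by rewrite normrM ltr_pM.
by move/(lt_trans near); rewrite ltxx.
Qed.

(** On the line from the coordinates of u to b, the product of [h] and [Pdisc] is a nonzero
    polynomial, so arbitrarily small steps avoid its zeros. P and Q change little, and [near_root]
    lifts the new coordinates to a point with t close to that of u. *)
Lemma generic_point_near (R : realType) (u : charvar R) (h : pexp R[i]) b n :
  ev b h != 0 -> ev b (Pdisc R[i]) != 0 ->
  exists v, [/\ near_point u n v, ev (coord v) h != 0 & unramified v].
Proof.
pose C := R[i]; move=> hb db; pose s := coord u; pose t := comm u; pose c i := b i - s i.
pose L := pev polyC (line s c) (PMul h (Pdisc C)).
have L_neq0 : L != 0.
  apply: contraNneq (mulf_neq0 hb db) => L0.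
  rewrite -evM -(eq_ev _ (_ : along s c 1 =1 b)); last first.
    by move=> i; rewrite /along /c mulr1 addrC subrK.
  by rewrite -horner_line -/L L0 horner0.
pose B := 1 + \sum_i `|c i|.
have B0 : 0 < B by rewrite ltr_pwDl // sumr_ge0.
have cB i : `|c i| <= B.
  rewrite /B (bigD1 i) //= addrCA lerDl addr_ge0 //; exact: sumr_ge0.
pose r : C := n.+1%:R^-1.
have r0 : 0 < r by rewrite invr_gt0 ltr0n.
have [KP KP0 HP] := pexp_lipschitz (Psum C) s.
have [KQ KQ0 HQ] := pexp_lipschitz (Pprod C) s.
have [m1 m1P] := inv_nat_le (ler01 : 0 <= 1 :> C) r0.
have K0 : 0 <= KP * `|t| + KQ by rewrite addr_ge0 ?mulr_ge0.
have [m2 m2P] := inv_nat_le K0 (mulr_gt0 r0 r0).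
(* [m1] makes the step smaller than r, [m2] keeps the new quadratic polynomial below r^2 at t, and k
   remains free to avoid the zeros of L. *)
pose rho k : C := (m1 + m2 + k).+1%:R^-1.
have [k Lk] : exists k, L.[rho k / B] != 0.
  apply: contrapT => /forallNP H; move/eqP: L_neq0; apply.
  apply: (@poly_seq_eq0 _ (fun k => rho k / B)) => [k l|k]; last first.
    by have /negP/negPn/eqP := H k.
  move=> /(mulIf (invr_neq0 (lt0r_neq0 B0)))/invr_inj/eqP.
  by rewrite eqr_nat eqSS eqn_add2l => /eqP.
have rho0 : 0 < rho k by rewrite invr_gt0 ltr0n.
have rho_r : rho k < r by rewrite -[rho k]mul1r; apply: m1P; rewrite -addnA leq_addr.
have rho1 : rho k <= 1 by rewrite invf_le1 ?ltr0n // ler1n.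
move: Lk; rewrite horner_line evM mulf_eq0 negb_or => /andP[].
set s' := along _ _ _ => hs ds.
have vrho i : `|c i * (rho k / B)| <= rho k.
  rewrite normrM (ger0_norm (ltW (divr_gt0 rho0 B0))) mulrCA ger_pMr //.
  by rewrite ler_pdivrMr // mul1r.
have {}HP := HP _ _ rho1 vrho; have {}HQ := HQ _ _ rho1 vrho.
have [||t' root_t' near_t'] := @near_root R (ev s' (Psum C)) (ev s' (Pprod C)) t r _ (ltW r0).
- by rewrite -PdiscE.
- have -> : t ^+ 2 - ev s' (Psum C) * t + ev s' (Pprod C) =
      - (ev s' (Psum C) - ev s (Psum C)) * t + (ev s' (Pprod C) - ev s (Pprod C)).
    by rewrite [t ^+ 2]comm_rel -/s -/t; ring.
  have m2_le : (m2 <= m1 + m2 + k)%N by rewrite -addnA addnCA leq_addr.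
  apply: (le_lt_trans _ (m2P _ m2_le)).
  apply: le_trans (ler_normD _ _) _; rewrite [leRHS]mulrDl; apply: lerD => //.
  by rewrite normrM normrN mulrAC ler_wpM2r.
have [v [vs vt]] := point_exists root_t'.
exists v; split; rewrite /unramified ?(eq_ev _ vs) //.
split=> [i|]; last by rewrite vt.
rewrite vs /s' /along -/(coord u i) -/(s i) addrC addKr.
exact: le_trans (vrho i) (ltW rho_r).
Qed.

Lemma jacobian_base (F : numClosedFieldType) :
  jacobian (pt8 0 0 0 0 0 0 1 0 : 'I_8 -> F) = - 3.
Proof.
rewrite /jacobian Psum.unlock Pprod.unlock.
rewrite /unit6 /unit7 /dif /ev /pev /pt8 /=.
ring.
Qed.

Lemma generic_locus (R : realType) : exists h : pexp R[i],
  ev (base_pt R) h != 0 /\ forall s, ev s h != 0 ->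
  [/\ ev s (Psum8 R[i]) != 0, jacobian s != 0 & \det (torus_mx s) != 0].
Proof.
have [d dE] := torus_det_pexp R.
pose j : pexp R[i] := (pdir (unit6 _) (Psum _) * pdir (unit7 _) (Pprod _)
  - pdir (unit7 _) (Psum _) * pdir (unit6 _) (Pprod _))%P.
have jE s : ev s j = jacobian s.
  by rewrite /j evD !evM evC !ev_pdir mulN1r.
exists (Psum8 _ * j * d)%P; split=> [|s].
  rewrite !evM jE dE jacobian_base !mulf_neq0 ?torus_det_base ?oppr_eq0 ?pnatr_eq0 //.
  by rewrite /Psum8 /ev /= mul0r mulr0 addr0 oner_eq0.
by rewrite !evM jE dE !mulf_eq0 !negb_or -andbA => /and3P.
Qed.

Theorem theorem2 (R : realType) :
  exists U : set (charvar R),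
    [/\ exists O : set (charvar R), open O /\ U = O `&` @smooth_locus R,
        @smooth_locus R `<=` closure U &
        forall u : charvar R, U u ->
          let L1 := leaf Sigma11 (boundary_map Sigma11 u) in
          let L3 := leaf Sigma30 (boundary_map Sigma30 u) in
          let T1 := tangent_sub L1 u in
          let T3 := tangent_sub L3 u in
          direct_sum (tangent u) T1 T3 /\
          forall br1 br3 : char_ring R -> char_ring R -> char_ring R,
            goldman_bracket Sigma11 br1 -> goldman_bracket Sigma30 br3 ->
            [/\ exists w1, leaf_form br1 L1 u w1,
                exists w3, leaf_form br3 L3 u w3 &
                forall w1 w3, leaf_form br1 L1 u w1 -> leaf_form br3 L3 u w3 ->
                  symplectic_duals (tangent u) (product_form T1 T3 w1 w3) T1 T3]].
Proof.
have [h [h_base hP]] := generic_locus R.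
pose g := PMul h (Pdisc R[i]).
(* One regular function carries all the genericity conditions, so the locus is a principal open
   set. *)
pose O := [set u : charvar R | u (PE g) != 0].
have OE u : O u <-> ev (coord u) h != 0 /\ unramified u.
  rewrite /O /= charvar_PE evM mulf_eq0 negb_or; split=> [/andP[]//|[h0 nu]].
  by rewrite h0.
exists (O `&` @smooth_locus R); split.
- by exists O; split=> //; exact: charvar_open_neq0.
- move=> u _ B /nbhs_near[n nB].
  have base_unramified : ev (base_pt R) (Pdisc R[i]) != 0.
    by rewrite Pdisc_base oppr_eq0 pnatr_eq0.
  have [v [vn vh nv]] := generic_point_near u n h_base base_unramified.
  exists v; split; last exact: nB.
  by split; [apply/OE | exact: unramified_smooth].
move=> u [/OE[/hP[A0 J0 det0] nu] _] L1 L3 T1 T3.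
have ds := leaves_direct_sum nu A0 J0; split=> // br1 br3 gb1 gb3.
split.
- have [pb _] := gb1; apply: (leaf_form_exists pb); exact: torus_leaf_range.
- have [pb _] := gb3; apply: (leaf_form_exists pb); exact: pants_leaf_range.
move=> w1 w3 [_ s1 _] [_ s3 _].
exact: (direct_sum_symplectic_duals ds (tangent_sub_subspace _ _)
  (tangent_sub_subspace _ _) s1 s3).
Qed.
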